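(* Suppose that $H_{B,\sigma}$ is the joint distribution of $(\mathbf Y,\mathbf X)\in\mathbb{R}^m\times\mathbb{R}^p$ under (a) $\mathbf X\sim N_p(\mathbf 0,\Sigma)$ and (b) $\mathbf Y\mid\mathbf X\sim N_m(B^t\mathbf X,\sigma^2I_m)$, and let $\mathcal{P}_\varepsilon(H_{B,\sigma})$ be its $\varepsilon$-contamination neighborhood. Let $\varepsilon'<1/3$, $\delta\in(0,1/2)$ and $\alpha=1-2\delta$. For $\varepsilon\in[0,\varepsilon']$ and $(p+\log(1/\delta))/n$ sufficiently small, there exists a constant $C>0$ (depending on $\varepsilon'$ but independent of $p,n,\varepsilon$) such that $$\inf_{B\in\mathbb{R}^{p\times m},\ P\in\mathcal{P}_\varepsilon(H_{B,\sigma})}P\left[\operatorname{tr}\left((\hat B_n-B)^t\Sigma(\hat B_n-B)\right)\le C\sigma^2\left(\frac{pm}{n}\vee b_{MR}^2(\varepsilon)\right)+\frac{\log(1/\delta)}{n}\right]\ge \alpha ,$$ where $\hat B_n$ is the deepest multivariate regression estimator based on a random sample of size $n$ from $P$, and $$b_{MR}^2(\varepsilon)=g^{-1}\!\left(\frac{1+\varepsilon}{2(1-\varepsilon)}\right),\qquad g(t)=E\,\Phi(t|Z|),\ t\ge 0,\ Z\sim N(0,1).$$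
   Context: $\Phi$ is the standard normal distribution function; $\varepsilon\mapsto g^{-1}\big(\frac{1+\varepsilon}{2(1-\varepsilon)}\big)$ maps $[0,1/3)$ to $[0,\infty)$. $a\vee b=\max(a,b)$. $\mathcal{P}_\varepsilon(H)=\{(1-\varepsilon)H+\varepsilon G: G\text{ any distribution on }\mathbb{R}^m\times\mathbb{R}^p\}$. The multivariate regression depth of $B\in\mathbb{R}^{p\times m}$ with respect to a distribution $P$ of $(\mathbf Y,\mathbf X)$ is $D_{MR}(B,P)=\inf_{U\in\mathbb{R}^{p\times m}\setminus\{0\}}P(\langle U^t\mathbf X,\mathbf Y-B^t\mathbf X\rangle\ge 0)$, and $\hat B_n=\arg\max_{B\in\mathbb{R}^{p\times m}}D_{MR}(B,P_n)$ with $P_n$ the empirical distribution of the sample. *)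

(* Defs.v *)
(* MathComp world, with MathComp-Analysis. *)
From HB Require Import structures.
From mathcomp Require Import all_boot all_order all_algebra.
From mathcomp Require Import all_classical all_reals all_analysis.

Set Implicit Arguments.
Unset Strict Implicit.
Unset Printing Implicit Defensive.

Import Order.TTheory GRing.Theory Num.Theory.
Import numFieldNormedType.Exports.

Local Open Scope classical_set_scope.
Local Open Scope ring_scope.

(* The Borel sigma-algebra of the finite-dimensional space of matrices,
   presented as the sigma-algebra generated by the entries. *)
Section measurable_matrix.
Context (R : realType) (m n : nat).

Definition matrix_sigma : set (set 'M[R]_(m, n)) :=
  <<s \bigcup_(ij in [set: 'I_m * 'I_n])
        preimage_set_system setT (fun M : 'M[R]_(m, n) => M ij.1 ij.2)
          measurable >>.

Let matrix_sigma0 : matrix_sigma set0.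
Proof. exact: sigma_algebra0. Qed.

Let matrix_sigmaC A : matrix_sigma A -> matrix_sigma (~` A).
Proof. exact: sigma_algebraC. Qed.

Let matrix_sigma_bigcup (F : (set 'M[R]_(m, n))^nat) :
  (forall i, matrix_sigma (F i)) -> matrix_sigma (\bigcup_i (F i)).
Proof. exact: sigma_algebra_bigcup. Qed.

HB.instance Definition _ := @isMeasurable.Build
  default_measure_display 'M[R]_(m, n)
  matrix_sigma matrix_sigma0 matrix_sigmaC matrix_sigma_bigcup.

End measurable_matrix.

Section gaussian.
Context (R : realType).

Definition Phi (x : R) : R := fine (normal_prob 0 1 `]-oo, x]).

Definition g (t : R) : R := \int[normal_prob 0 1]_z Phi (t * `|z|).

(* [g] is restricted to nonnegative arguments before being inverted; the
   default value 0 is only used outside of the range of this restriction. *)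
Definition ginv : R -> R := 'pinv_(fun=> 0) [set t : R | 0 <= t] g.

(* This is the quantity denoted by the squared symbol b_MR^2; the value of
   [ginv] is not squared. *)
Definition bMR2 (eps : R) : R := ginv ((1 + eps) / (2 * (1 - eps))).

(* Univariate normal law with mean [mu] and variance [v], a Dirac mass when
   [v = 0] ([normal_prob] is parameterized by the standard deviation, and is
   not a Dirac mass when the latter is 0). *)
Definition normal_law (mu v : R) (A : set R) : \bar R :=
  if v == 0 then \d_mu A else normal_prob mu (Num.sqrt v) A.

(* The multivariate normal law N_k(mu, S), S possibly singular: all linear
   functionals are normal with the corresponding mean and variance. *)
Definition is_mvnormal k (mu : 'cV[R]_k) (S : 'M[R]_k)
    (N : {measure set 'cV[R]_k -> \bar R}) : Prop :=
  forall (u : 'cV[R]_k) (A : set R), measurable A ->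
    N [set x | A ((u^T *m x) 0 0)] =
    normal_law ((u^T *m mu) 0 0) ((u^T *m S *m u) 0 0) A.

Definition is_covariance k (S : 'M[R]_k) : Prop :=
  S^T = S /\ forall u : 'cV[R]_k, 0 <= (u^T *m S *m u) 0 0.

End gaussian.

Section regression.
Context (R : realType) (m p : nat).
Local Notation sample_space := ('cV[R]_m * 'cV[R]_p)%type.

(* [H] is the law of (Y, X) with X ~ N_p(0, Sigma) and
   Y | X ~ N_m(B^T X, sigma^2 I_m); [K] is the conditional law of Y given X. *)
Definition regression_law (B : 'M[R]_(p, m)) (sigma : R) (Sigma : 'M[R]_p)
    (H : probability sample_space R) : Prop :=
  exists (NX : probability 'cV[R]_p R) (K : R.-pker 'cV[R]_p ~> 'cV[R]_m),
  [/\ is_mvnormal 0 Sigma NX,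
      forall x, is_mvnormal (B^T *m x) (sigma ^+ 2)%:M (K x) &
      forall (A : set 'cV[R]_m) (C : set 'cV[R]_p),
        measurable A -> measurable C ->
        H (A `*` C) = (\int[NX]_(x in C) K x A)%E].

Definition mr_depth (B : 'M[R]_(p, m)) (P : set sample_space -> \bar R) :
    \bar R :=
  ereal_inf [set P [set yx : sample_space |
                 0 <= \sum_(j < m) (U^T *m yx.2) j 0 *
                                   (yx.1 - B^T *m yx.2) j 0]
            | U in [set U : 'M[R]_(p, m) | U != 0]].

Definition deepest (P : set sample_space -> \bar R) (B : 'M[R]_(p, m)) : Prop :=
  forall B' : 'M[R]_(p, m), (mr_depth B' P <= mr_depth B P)%E.

End regression.

Section sampling.
Context d (T : measurableType d) (R : realType).

Definition in_contamination (eps : R) (H P : probability T R) : Prop :=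
  exists G : probability T R, forall A : set T, measurable A ->
    P A = ((1 - eps)%:E * H A + eps%:E * G A)%E.

Definition empirical n (z : 'I_n -> T) (A : set T) : \bar R :=
  ((n%:R^-1)%:E * \sum_(i < n) \d_(z i) A)%E.

(* Mutual independence: letting some of the sets [A i] be the full space gives
   the product rule for the subfamilies. *)
Definition random_sample d' (Omega : measurableType d')
    (Pr : probability Omega R) (P : probability T R)
    n (Z : 'I_n -> {RV Pr >-> T}) : Prop :=
  (forall (i : 'I_n) (A : set T), measurable A ->
     distribution Pr (Z i) A = P A) /\
  (forall A : 'I_n -> set T, (forall i, measurable (A i)) ->
     Pr (\bigcap_(i in [set: 'I_n]) (Z i @^-1` A i)) =
     (\prod_(i < n) Pr (Z i @^-1` A i))%E).

End sampling.

(* Main.v *)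
From HB Require Import structures.
Require Import Defs.
From mathcomp Require Import all_boot all_order all_algebra.
From mathcomp Require Import all_classical all_reals all_analysis.
From mathcomp Require Import measurable_realfun ring lra zify.

Import Order.TTheory GRing.Theory Num.Theory.
Import numFieldNormedType.Exports.

(** Write [eps] for the contamination level, [t] for the distance of a matrix
    from the truth [B] in the norm [Q |-> sqrt (tr (Q^T Sigma Q))], divided by
    [sigma], and [d = p m].

    Under the model every halfspace through the true residual has probability at
    least 1/2, so under the contaminated law the depth of [B] is at least
    [(1 - eps) / 2].  A matrix at distance [t] has small depth, because one test
    direction exposes it: with [Q = Bhat - B], testing in the direction [Q] itself
    gives, given [X = x], a normal probability
    [Phi (- |Q^T x| / sigma)], which is bounded away from 1/2 by a multiple of
    [t] when [t] is bounded, and tends to 0 uniformly when [t] grows, since the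
    Gaussian vector [Q^T X] is seldom small ([nrm2_small_ball], with a constant
    that does not depend on the dimension).  As [eps < 1/3], the resulting gap
    beats the mass [eps] which the contamination can add, both for bounded and for
    large [t] ([depth_gap]); comparing the depths of [Bhat] and [B] then forces
    [t] to be at most of the order of [eps / (1 - eps)] plus the uniform
    deviation of the empirical measure ([distance_contradiction]).  Since [g] is
    Lipschitz with [g 0 = 1/2], the quantity [bMR2 eps] dominates
    [eps / (1 - eps)] up to a factor ([bMR2_ge]), and this ratio is bounded,
    hence also dominates its own square.

    The deviation has to be of order [sqrt (d / n)] without a logarithm and with a
    constant free of [m] and [p].  Testing in the direction [Q] leads to regions
    which are quadratic in [Q], with a dimension of order [p^2] if they are
    linearized.  Instead the test direction is rounded to a point [W] of a finite
    net of [exp (O(d))] matrices of unit norm ([covariance_net]).  For a fixed [W]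
    the regions [positive_part B W Q] are halfspaces in [d + 1] features, linear in
    [Q], and a union bound over the net costs only [O(d)] in the exponent.  The
    rounding error is absorbed in [depth_gap]: replacing the direction [V] by
    [W] changes the exponent only by [|(V - W)^T x|], whose second moment is as small as
    wanted.

    The uniform deviation of halfspaces is a Vapnik-Chervonenkis bound in
    exponential form.  A finite subfamily only sees the atoms that it generates, so
    that the sampling problem becomes one on a finite set with an explicit product
    weight, where symmetrization with a second sample and random signs is a
    manipulation of finite sums ([symmetrization]).  The random signs are controlled by
    chaining along nets of the family for the Hamming distance
    ([rademacher_vc]); their cardinalities come from Dudley's packing argument
    ([vc_packing]), which itself rests on counting shattered sets
    ([card_shattered]).  Countable families follow by monotone limits, and all
    halfspaces because each is a pointwise limit of halfspaces with integer
    coefficients ([halfspace_approx]). *)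

Set Implicit Arguments.
Unset Strict Implicit.
Unset Printing Implicit Defensive.

(** * Shattering and the growth of set families *)

Section shattering.
Local Open Scope nat_scope.
Context (I : finType).
Implicit Types (A X Y : {set I}) (F : {set {set I}}).

Definition shatters F X := [forall Y : {set I}, (Y \subset X) ==>
  [exists A in F, A :&: X == Y]].

Lemma shattersP F X :
  reflect (forall Y, Y \subset X -> exists2 A, A \in F & A :&: X = Y)
          (shatters F X).
Proof.
apply: (iffP forallP) => [H Y YX|H Y].
  by have /implyP/(_ YX)/exists_inP[A AF /eqP] := H Y; exists A.
by apply/implyP => /H[A AF <-]; apply/exists_inP; exists A.
Qed.

Definition shattered F := [set X | shatters F X].

Lemma shatters_sub F F' X : F \subset F' -> shatters F X -> shatters F' X.
Proof.
by move=> /fintype.subsetP FF' /shattersP H; apply/shattersP => Y /H[A /FF' ? ?]; exists A.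
Qed.

Lemma shatters_notin F X x b : (forall A, A \in F -> (x \in A) = b) ->
  shatters F X -> x \notin X.
Proof.
move=> Fx /shattersP H; apply/negP => xX.
have [A AF /setP/(_ x)] := H finset.set0 (finset.sub0set _).
rewrite !inE xX andbT (Fx _ AF) => bF.
have [A' A'F /setP/(_ x)] := H X (subxx _).
by rewrite !inE xX andbT (Fx _ A'F) bF.
Qed.

(** Pajor's form of the Sauer-Shelah lemma.  Split the family according to a point
    [x] which separates two of its members.  Sets shattered by either half avoid
    [x], and a set shattered by both halves can be enlarged by [x]: so the sets
    shattered by the halves are counted with multiplicity by those shattered by
    the family. *)
Lemma card_shattered F : #|F| <= #|shattered F|.
Proof.
elim: {F}_.+1 {-2}F (ltnSn #|F|) => // n IH F; rewrite ltnS => Fn.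
have [|F1] := leqP #|F| 1.
  move=> F1; case: (finset.set_0Vmem F) => [->|[A AF]]; first by rewrite cards0.
  rewrite (leq_trans F1)//; apply/card_gt0P; exists finset.set0; rewrite inE.
  apply/shattersP => Y; rewrite finset.subset0 => /eqP ->; exists A => //.
  by rewrite finset.setI0.
have [A [B [AF BF AB]]] : exists A B, [/\ A \in F, B \in F & A != B].
  by have /card_gt1P[A [B [? ? ?]]] := F1; exists A, B.
have [x xAB] : exists x, (x \in A) != (x \in B).
  apply/existsP; apply: contraR AB; rewrite negb_exists => /forallP H.
  by apply/eqP/setP => x; have := H x; rewrite negbK => /eqP.
pose F0 := [set C in F | x \notin C]; pose F1' := [set C in F | x \in C].
have F0F : F0 \subset F by apply/fintype.subsetP => C; rewrite inE => /andP[].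
have F1F : F1' \subset F by apply/fintype.subsetP => C; rewrite inE => /andP[].
have cF : #|F| = #|F0| + #|F1'|.
  rewrite -(cardsID [set C : {set I} | x \in C] F) addnC; congr (_ + _).
    by apply: eq_card => C; rewrite !inE andbC.
  by apply: eq_card => C; rewrite !inE.
have [c0 c1] : 0 < #|F0| /\ 0 < #|F1'|.
  move: xAB; case xA: (x \in A); case xB: (x \in B) => // _; split; apply/card_gt0P.
  - by exists B; rewrite inE BF xB.
  - by exists A; rewrite inE AF xA.
  - by exists A; rewrite inE AF xA.
  - by exists B; rewrite inE BF xB.
have h0 : #|F0| <= #|shattered F0| by apply: IH; lia.
have h1 : #|F1'| <= #|shattered F1'| by apply: IH; lia.
rewrite cF (leq_trans (leq_add h0 h1))// -finset.cardsUI.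
set U := _ :|: _; set V := _ :&: _.
have nx0 X : X \in shattered F0 -> x \notin X.
  rewrite inE; apply: (@shatters_notin _ _ _ false) => C.
  by rewrite inE => /andP[_ /negbTE].
have nx1 X : X \in shattered F1' -> x \notin X.
  by rewrite inE; apply: (@shatters_notin _ _ _ true) => C; rewrite inE => /andP[].
have injV : {in V &, injective (fun X => x |: X)}.
  move=> X Y; rewrite inE => /andP[/nx0 Xx _]; rewrite inE => /andP[/nx0 Yx _] XY.
  apply/setP => y; have /setP/(_ y) := XY; rewrite !inE.
  by have [->|//] := eqVneq y x; rewrite (negbTE Xx) (negbTE Yx).
rewrite -(card_in_imset injV).
have dis : U :&: [set x |: X | X in V] = finset.set0.
  apply/setP => X; rewrite finset.in_setI finset.in_set0; apply/negbTE/negP => /andP[XU /imsetP[Y _ XY]].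
  have xX : x \in X by rewrite XY !inE eqxx.
  by move: XU; rewrite inE => /orP[/nx0|/nx1]; rewrite xX.
rewrite -finset.cardsUI dis cards0 addn0; apply: subset_leq_card.
apply/fintype.subsetP => X; rewrite inE => /orP[|].
  rewrite !inE => /orP[]; exact: shatters_sub.
move=> /imsetP[Y]; rewrite !inE => /andP[/shattersP Y0 /shattersP Y1] ->.
apply/shattersP => Z ZY.
have Zx : Z :\ x \subset Y.
  apply/fintype.subsetP => y; rewrite !inE => /andP[yx /(fintype.subsetP ZY)].
  by rewrite !inE (negbTE yx).
case xZ : (x \in Z).
  have [C + CZ] := Y1 _ Zx; rewrite inE => /andP[CF xC]; exists C => //.
  apply/setP => y; have /setP/(_ y) := CZ; rewrite !inE.
  by have [->|yx] := eqVneq y x; rewrite ?xC ?xZ.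
have [C + CZ] := Y0 _ Zx; rewrite inE => /andP[CF xC]; exists C => //.
apply/setP => y; have /setP/(_ y) := CZ; rewrite !inE.
by have [->|yx] := eqVneq y x; rewrite ?(negbTE xC) ?xZ.
Qed.

Definition vc_le F D := forall X, shatters F X -> #|X| <= D.

Lemma vc_le_sub F F' D : F \subset F' -> vc_le F' D -> vc_le F D.
Proof. by move=> FF' H X /(shatters_sub FF')/H. Qed.

End shattering.

Section growth.
Context (R : realType).
Local Open Scope ring_scope.

Lemma sum_expr_card (I : finType) (lam : R) :
  \sum_(X : {set I}) lam ^+ #|X| = (1 + lam) ^+ #|I|.
Proof.
transitivity (\prod_(i : I) \sum_(b : bool) (if b then lam else 1)).
  rewrite bigA_distr_bigA /=.
  rewrite (reindex (fun f : {ffun I -> bool} => [set i | f i])) /=; last first.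
    exists (fun A : {set I} => [ffun i => i \in A]) => [f _|A _].
      by apply/ffunP => i; rewrite ffunE inE.
    by apply/setP => i; rewrite inE ffunE.
  apply: eq_bigr => f _; rewrite -big_mkcond /= prodr_const; congr (_ ^+ _).
  by apply: eq_card => i; rewrite inE.
by rewrite (eq_bigr (fun=> 1 + lam)) ?prodr_const// => i _; rewrite big_bool /= addrC.
Qed.

(** The growth bound in the generating-function form [lam ^ D]: unlike the binomial sum,
    it allows [lam] to be tuned to the radius in [vc_packing]. *)
Lemma vc_growth (I : finType) (F : {set {set I}}) D (lam : R) :
  0 < lam -> lam <= 1 -> vc_le F D ->
  #|F|%:R * lam ^+ D <= (1 + lam) ^+ #|I|.
Proof.
move=> l0 l1 FD; rewrite -sum_expr_card.
apply: (@le_trans _ _ (\sum_(X in shattered F) lam ^+ #|X|)); last first.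
  rewrite big_mkcond /=; apply: ler_sum => X _; case: ifP => // _.
  by rewrite exprn_ge0// ltW.
apply: (@le_trans _ _ (\sum_(X in shattered F) lam ^+ D)).
  rewrite sumr_const -[leRHS]mulr_natl ler_wpM2r ?exprn_ge0 ?(ltW l0)// ler_nat.
  exact: card_shattered.
apply: ler_sum => X; rewrite inE => /FD XD.
by rewrite ler_wiXn2l// ltW.
Qed.

End growth.

(** * Packing numbers *)

Section packing.
Context (R : realType).
Local Open Scope ring_scope.

Definition symd (I : finType) (A B : {set I}) := [set i | (i \in A) != (i \in B)].

Lemma symdC (I : finType) (A B : {set I}) : symd A B = symd B A.
Proof. by apply/setP => i; rewrite !inE eq_sym. Qed.

Lemma symd_eq0 (I : finType) (A B : {set I}) : #|symd A B| = 0%N -> A = B.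
Proof.
move=> /eqP; rewrite cards_eq0 => /eqP/setP AB; apply/setP => i.
by have := AB i; rewrite !inE => /negbFE/eqP.
Qed.

Definition pullback (J I : finType) (f : J -> I) (A : {set I}) : {set J} :=
  [set j | f j \in A].

Lemma vc_preim (J I : finType) (f : J -> I) (F : {set {set I}}) D :
  vc_le F D -> vc_le [set pullback f A | A in F] D.
Proof.
move=> FD X /shattersP XF.
have finj : {in X &, injective f}.
  move=> i j iX jX fij; have [|A /imsetP[B BF ->] /setP BX] := XF [set i].
    by rewrite finset.sub1set.
  have := BX i; have := BX j; rewrite !inE iX jX fij !andbT eqxx => ->.
  by move/eqP.
rewrite -(card_in_imset finj); apply: FD; apply/shattersP => Y YX.
have [|A /imsetP[B BF ->] /setP BX] := XF (pullback f Y :&: X).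
  exact: finset.subsetIr.
exists B => //; apply/setP => y; rewrite inE.
apply/andP/idP => [[yB /imsetP[x xX yx]]|yY].
  by have := BX x; rewrite !inE xX -yx yB /= => /esym; rewrite andbT.
have yfX := fintype.subsetP YX _ yY; split => //.
by case/imsetP: yfX => x xX yx; have := BX x; rewrite !inE xX -yx yY !andbT.
Qed.

Lemma expR_lnK_nat (M : nat) : (0 < M)%N -> expR (ln M%:R) = M%:R :> R.
Proof. by move=> M0; rewrite lnK// posrE ltr0n. Qed.

Lemma leq_card_bigcup (T J : finType) (P : pred J) (F : J -> {set T}) :
  (#|\bigcup_(j | P j) F j| <= \sum_(j | P j) #|F j|)%N.
Proof.
elim/big_ind2: _ => [|A a B b Aa Bb|j _]; [by rewrite cards0| |exact: leqnn].
by rewrite (leq_trans (finset.leq_card_setU a b))// leq_add.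
Qed.

Lemma card_missing (I : finType) (k : nat) (S : {set I}) :
  #|[set f : {ffun 'I_k -> I} | [forall j, f j \notin S]]| = (#|~: S| ^ k)%N.
Proof.
rewrite -[k in RHS]card_ord -card_ffun_on; apply: eq_card => f; rewrite inE.
by apply/forallP/ffun_onP => H j; have := H j; rewrite inE.
Qed.

(** Dudley's random-sampling argument: [k] random points of [I], with [k] just above
    [2 ln |F| / e], distinguish all members of a family which is separated at
    relative distance [e], so that [|F|] is at most the growth function at [k].  With
    [lam = e / 4] the growth bound is [(4 / e) ^ D * |F| ^ (1/2)] up to a constant,
    and the square root is absorbed on the left. *)
Lemma vc_packing (I : finType) (F : {set {set I}}) D (e : R) :
  0 < e -> e <= 1 -> vc_le F D ->
  (forall A B, A \in F -> B \in F -> A != B -> e * #|I|%:R <= #|symd A B|%:R) ->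
  #|F|%:R <= expR (2^-1 + 2 * D%:R * ln (4 / e)).
Proof.
move=> e0 e1 FD Fsep.
have le4 : 0 <= ln (4 / e).
  by apply: ln_ge0; rewrite ler_pdivlMr// mul1r; lra.
have [F1|F1] := leqP #|F| 1.
  rewrite (@le_trans _ _ 1)//; first by rewrite lern1.
  rewrite -[leLHS]expR0 ler_expR; apply: addr_ge0; first by rewrite invr_ge0.
  by rewrite !mulr_ge0.
have M0 : (0 < #|F|)%N by apply: leq_trans F1.
set M := #|F| in F1 M0 *.
have I0 : (0 < #|I|)%N.
  have /card_gt1P[A [B [_ _ AB]]] := F1.
  rewrite lt0n; apply: contraNN AB => /eqP I0; apply/eqP/setP => i.
  by have := fintype.card0_eq I0 i; rewrite inE.
have lnM0 : 0 <= ln (M%:R : R) by apply: ln_ge0; rewrite ler1n.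
pose k := (Num.truncn (2 * ln (M%:R : R) / e)).+1.
have kgt : 2 * ln (M%:R : R) < e * k%:R.
  by rewrite -ltr_pdivrMl// mulrC /k -truncn_lt_nat// divr_ge0 ?mulr_ge0// ltW.
have kle : e * k%:R <= 2 * ln (M%:R : R) + e.
  have /truncn_itv/andP[h _] : 0 <= 2 * ln (M%:R : R) / e.
    by rewrite divr_ge0 ?mulr_ge0// ltW.
  rewrite /k -[_.+1]addn1 natrD mulrDr mulr1 lerD2r.
  by move: h; rewrite ler_pdivlMr// mulrC.
clearbody k.
(* otherwise each [f] misses the symmetric difference of some pair, which at most
   [|F|^2 (|I| exp (- e))^k < |I|^k] functions do *)
have [f finj] : exists f : {ffun 'I_k -> I}, {in F &, injective (pullback f)}.
  pose bad := fun AB : {set I} * {set I} =>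
    [set f : {ffun 'I_k -> I} | [forall j, f j \notin symd AB.1 AB.2]].
  pose P := [set AB : {set I} * {set I} | [&& AB.1 \in F, AB.2 \in F & AB.1 != AB.2]].
  have [/existsP[f fP]|nf] := boolP [exists f, f \notin \bigcup_(AB in P) bad AB].
    exists f => A B AF BF /setP fAB; apply/eqP; apply: contraNT fP => AB.
    apply/bigcupP; exists (A, B); rewrite inE/= ?AF ?BF//.
    by apply/forallP => j; have := fAB j; rewrite !inE => ->; rewrite negbK.
  exfalso; move: nf; rewrite negb_exists => /forallP nf.
  have : (#|{: {ffun 'I_k -> I}}| <= \sum_(AB in P) #|bad AB|)%N.
    apply: leq_trans (_ : #|\bigcup_(AB in P) bad AB| <= _)%N.
      by apply: subset_leq_card; apply/fintype.subsetP => f _; have := nf f; rewrite negbK.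
    exact: leq_card_bigcup.
  rewrite card_ffun card_ord -(ler_nat R) natrX natr_sum.
  apply/negP; rewrite -ltNge.
  apply: (@le_lt_trans _ _ (\sum_(AB in P) (#|I|%:R * expR (- e)) ^+ k)).
    apply: ler_sum => -[A B]; rewrite inE /= => /and3P[AF BF AB].
    rewrite card_missing natrX lerXn2r ?nnegrE ?mulr_ge0 ?expR_ge0//.
    have := cardsC (symd A B) => /(congr1 (fun i => i%:R : R)); rewrite natrD.
    have := Fsep _ _ AF BF AB; have := expR_ge1Dx (- e).
    move=> h1 h2 h3; rewrite (@le_trans _ _ (#|I|%:R * (1 - e)))//.
      by lra.
    by rewrite ler_wpM2l.
  rewrite sumr_const -[ltLHS]mulr_natl exprMn mulrCA gtr_pMr; last first.
    by rewrite exprn_gt0// ltr0n.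
  have -> : expR (- e) ^+ k = expR (- (e * k%:R)) by rewrite -expRM_natr mulNr.
  have cP : (#|P| <= M * M)%N.
    rewrite -cardsX; apply: subset_leq_card; apply/fintype.subsetP => -[A B].
    by rewrite !inE /= => /and3P[-> ->].
  apply: (@le_lt_trans _ _ ((M * M)%:R * expR (- (e * k%:R)))).
    by rewrite ler_wpM2r ?expR_ge0// ler_nat.
  rewrite natrM -[in X in X * _ * _](expR_lnK_nat M0) -(expR_lnK_nat M0) -!expRD.
  by rewrite -[ltRHS]expR0 ltr_expR; rewrite expR_lnK_nat//; lra.
have := @vc_growth R _ [set pullback f A | A in F] D (e / 4) _ _ (vc_preim FD).
rewrite card_in_imset// card_ord -/M => H.
have {H} : M%:R * (e / 4) ^+ D <= expR (2^-1 * ln (M%:R : R) + 4^-1).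
  apply: le_trans (H _ _) _; [lra|lra|].
  apply: (@le_trans _ _ (expR (e / 4) ^+ k)).
    by rewrite lerXn2r ?nnegrE ?expR_ge0 ?expR_ge1Dx//; lra.
  rewrite -expRM_natr ler_expR mulrAC ler_pdivrMr//.
  by lra.
have -> : (e / 4) ^+ D = expR (- (D%:R * ln (4 / e))).
  rewrite -mulrN expRM_natl -lnV ?posrE ?divr_gt0//.
  by rewrite lnK ?posrE ?invr_gt0 ?divr_gt0// invf_div.
rewrite -[X in X * _](expR_lnK_nat M0) -expRD ler_expR => H.
by rewrite -(expR_lnK_nat M0) ler_expR; lra.
Qed.

End packing.

(** * Random signs summed over a set family *)

Section rademacher.
Context (R : realType).
Local Open Scope ring_scope.

(** Proved from [1 + x <= expR x] alone: for [x^2 <= 1/2] the left-hand side is at most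
    [1 / (1 - x^2)], and otherwise [`|x| <= 2 x^2]. *)
Lemma cosh_le_expR (x : R) : (expR x + expR (- x)) / 2 <= expR (2 * x ^+ 2).
Proof.
have [x2|x2] := leP (x ^+ 2) 2^-1.
  have h1 := expR_ge1Dx (- x); have h2 := expR_ge1Dx x.
  have x1 : x < 1 by nra.
  have x1' : -1 < x by nra.
  have i1 : expR x <= (1 - x)^-1.
    rewrite -[x in expR x]opprK expRN lef_pV2 ?posrE ?expR_gt0 ?subr_gt0//.
  have i2 : expR (- x) <= (1 + x)^-1.
    by rewrite expRN lef_pV2 ?posrE ?expR_gt0//; lra.
  apply: (@le_trans _ _ (1 - x ^+ 2)^-1).
    have -> : (1 - x ^+ 2)^-1 = ((1 - x)^-1 + (1 + x)^-1) / 2.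
      have p1 : 1 - x != 0 by rewrite gt_eqF; lra.
      have p2 : 1 + x != 0 by rewrite gt_eqF; lra.
      have p3 : 1 - x ^+ 2 != 0 by rewrite gt_eqF; lra.
      by field; rewrite p1 p2 p3.
    by lra.
  apply: (@le_trans _ _ (1 + 2 * x ^+ 2)); last exact: expR_ge1Dx.
  by rewrite -[_^-1]mul1r ler_pdivrMr; nra.
apply: (@le_trans _ _ (expR `|x|)).
  have [x0|x0] := leP 0 x.
    have : expR (- x) <= expR x by rewrite ler_expR; lra.
    by rewrite ger0_norm//; lra.
  have : expR x <= expR (- x) by rewrite ler_expR; lra.
  by rewrite ltr0_norm//; lra.
by rewrite ler_expR; have := real_normK (num_real x); have := normr_ge0 x; nra.
Qed.

Variable I : finType.
Implicit Types (s : {ffun I -> bool}) (f : I -> R).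

Definition signed_sum f s : R := \sum_i (-1) ^+ (s i) * f i.

Lemma signed_sum_mgf f (l : R) :
  \sum_s expR (l * signed_sum f s)
    <= 2 ^+ #|I| * expR (2 * l ^+ 2 * \sum_i f i ^+ 2).
Proof.
have -> : \sum_s expR (l * signed_sum f s) =
    \prod_i \sum_(b : bool) expR (l * ((-1) ^+ b * f i)).
  rewrite bigA_distr_bigA; apply: eq_bigr => s _ /=.
  by rewrite mulr_sumr expR_sum.
rewrite mulr_sumr expR_sum -prodr_const -big_split /=.
apply: ler_prod => i _; rewrite big_bool /= expr1 expr0 mul1r mulN1r mulrN.
rewrite addr_ge0 ?expR_ge0//=.
by have := cosh_le_expR (l * f i); rewrite exprMn mulrA; lra.
Qed.

Lemma signed_sum_tail1 f (N t : R) : 0 < N -> 0 <= t -> \sum_i f i ^+ 2 <= N ->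
  #|[set s | t < signed_sum f s]|%:R
    <= 2 ^+ #|I| * expR (- (t ^+ 2 / (8 * N))).
Proof.
move=> N0 t0 fN; pose l := t / (4 * N).
have l0 : 0 <= l by rewrite divr_ge0// mulr_ge0// ltW.
apply: (@le_trans _ _ (\sum_s expR (l * signed_sum f s - l * t))).
  rewrite -sum1_card natr_sum big_mkcond /=; apply: ler_sum => s _.
  rewrite inE; case: ifP => [ts|_]; last exact: expR_ge0.
  by rewrite -[leLHS]expR0 ler_expR -mulrBr mulr_ge0// subr_ge0 ltW.
under eq_bigr do rewrite expRD.
rewrite -mulr_suml; apply: le_trans.
  by apply: ler_wpM2r (signed_sum_mgf f l); exact: expR_ge0.
rewrite -[leLHS]mulrA -expRD ler_wpM2l ?exprn_ge0// ler_expR.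
have -> : - (t ^+ 2 / (8 * N)) = 2 * l ^+ 2 * N - l * t.
  by rewrite /l; field; rewrite gt_eqF.
by rewrite lerD2r ler_wpM2l// mulr_ge0// exprn_ge0.
Qed.

Lemma signed_sum_tail f (N t : R) : 0 < N -> 0 <= t -> \sum_i f i ^+ 2 <= N ->
  #|[set s | t < `|signed_sum f s|]|%:R
    <= 2 ^+ #|I| * (2 * expR (- (t ^+ 2 / (8 * N)))).
Proof.
move=> N0 t0 fN.
have h1 := signed_sum_tail1 N0 t0 fN.
have h2 : #|[set s | t < signed_sum (fun i => - f i) s]|%:R
    <= 2 ^+ #|I| * expR (- (t ^+ 2 / (8 * N))).
  by apply: signed_sum_tail1 => //; under eq_bigr do rewrite sqrrN.
have : (#|[set s | (t < `|signed_sum f s|)%R]| <=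
  #|[set s | (t < signed_sum f s)%R]| + #|[set s | (t < signed_sum (fun i => - f i) s)%R]|)%N.
  rewrite (leq_trans _ (finset.leq_card_setU _ _))//.
  apply: subset_leq_card; apply/fintype.subsetP => s; rewrite !inE.
  rewrite /signed_sum; under [X in _ -> _ || (_ < X)]eq_bigr do rewrite mulrN.
  by rewrite sumrN lter_normr.
by rewrite -(ler_nat R) natrD; lra.
Qed.

End rademacher.

Section chaining.
Context (R : realType) (I : finType).
Local Open Scope ring_scope.
Implicit Types (s : {ffun I -> bool}) (A B : {set I}) (F S : {set {set I}}).

Definition rad s A : R := signed_sum (fun i => (i \in A)%:R) s.

Lemma rad_sub s A B : rad s A - rad s B =
  signed_sum (fun i => (i \in A)%:R - (i \in B)%:R) s.
Proof. by rewrite -sumrB; apply: eq_bigr => i _; rewrite mulrBr. Qed.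

Lemma sum_indic_sub A B :
  \sum_i ((i \in A)%:R - (i \in B)%:R) ^+ 2 = #|symd A B|%:R :> R.
Proof.
rewrite -sum1_card natr_sum [RHS]big_mkcond /=; apply: eq_bigr => i _.
rewrite inE; case: (i \in A); case: (i \in B) => /=;
  by rewrite ?subrr ?subr0 ?sub0r ?sqrrN ?expr0n ?expr1n.
Qed.

Definition separated k S := [forall A in S, forall B in S,
  (A != B) ==> (#|I| <= 4 ^ k * #|symd A B|)%N].

Definition is_net F k S := maxset (fun S => (S \subset F) && separated k S) S.

Lemma net_exists F k : exists S, is_net F k S.
Proof.
pose P (S : {set {set I}}) := (S \subset F) && separated k S.
have [|S SP] := @ex_maxset _ P; last by exists S.
exists finset.set0; rewrite /P finset.sub0set.
by apply/forall_inP => A; rewrite inE.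
Qed.

Definition net F k : {set {set I}} := xchoose (net_exists F k).

Lemma net_sub F k : net F k \subset F.
Proof. by have /maxsetp/andP[] := xchooseP (net_exists F k). Qed.

Lemma net_separated F k A B : A \in net F k -> B \in net F k -> A != B ->
  (#|I| <= 4 ^ k * #|symd A B|)%N.
Proof.
move=> AN BN AB; have /maxsetp/andP[_] := xchooseP (net_exists F k).
by move=> /forall_inP/(_ _ AN)/forall_inP/(_ _ BN)/implyP/(_ AB).
Qed.

(** A maximal separated subfamily is a covering: a member far from all of it could be
    added. *)
Lemma net_cover F k A : A \in F ->
  exists2 B, B \in net F k & (A == B) || (4 ^ k * #|symd A B| < #|I|)%N.
Proof.
move=> AF; apply/exists_inP; apply: contraT.
rewrite negb_exists_in => /forall_inP H.
have AN : A \notin net F k.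
  by apply/negP => /H; rewrite eqxx.
have far B : B \in net F k -> (#|I| <= 4 ^ k * #|symd A B|)%N.
  by move=> /H; rewrite negb_or -leqNgt => /andP[].
have /maxsetP[_ /(_ (A |: net F k))] := xchooseP (net_exists F k).
rewrite -/(net F k) finset.subsetU1 => /(_ _ isT) E.
suff /E/setP/(_ A) : (A |: net F k \subset F) && separated k (A |: net F k).
  by rewrite setU11 (negbTE AN).
rewrite finset.subUset finset.sub1set AF net_sub /=.
apply/forall_inP => B /setU1P[->|BN]; apply/forall_inP => C /setU1P[->|CN];
  apply/implyP => BC.
- by rewrite eqxx in BC.
- exact: far.
- by rewrite symdC; exact: far.
- exact: (net_separated BN CN BC).
Qed.

Lemma net_card F D k : vc_le F D ->
  #|net F k|%:R <= expR (2^-1 + 4 * D%:R * k.+1%:R) :> R.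
Proof.
move=> FD; have k0 : 0 < 4%:R ^- k :> R by rewrite invr_gt0 exprn_gt0.
have k1 : 4%:R ^- k <= 1 :> R by rewrite invf_le1 ?exprn_gt0// exprn_ege1// ler1n.
have vN := vc_le_sub (net_sub F k) FD.
apply: le_trans (vc_packing k0 k1 vN _) _.
  move=> A B AN BN AB; rewrite mulrC ler_pdivrMr ?exprn_gt0//.
  by rewrite mulrC -natrX -natrM ler_nat; exact: (net_separated AN BN AB).
rewrite ler_expR lerD2l invrK -exprS lnXn// -[ln _ *+ _]mulr_natr.
have -> : 4 * D%:R * k.+1%:R = 2 * D%:R * (2 * k.+1%:R) :> R by ring.
rewrite ler_wpM2l ?mulr_ge0// ler_wpM2r//.
have -> : 4%:R = 2 ^+ 2 :> R by ring.
rewrite lnXn// -[ln _ *+ _]mulr_natr.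
have := @le_ln1Dx R 1 _; lra.
Qed.

(** At level 0 the parent is the empty set, over which the signed sum vanishes; this
    starts the chain without a special treatment of the coarsest net. *)
Definition parent F k A : {set I} :=
  if k is k'.+1 then
    odflt finset.set0 [pick B in net F k' | (4 ^ k' * #|symd A B| <= #|I|)%N]
  else finset.set0.

Lemma parent_near F k A : A \in F -> (4 ^ k * #|symd A (parent F k A)| <= 4 * #|I|)%N.
Proof.
move=> AF; case: k => [|k] /=.
  by rewrite expn0 mul1n (leq_trans (max_card _))// leq_pmull.
case: pickP => [B /andP[BN]/=|H]; first by rewrite expnS -mulnA leq_mul2l.
have [B BN /orP[/eqP AB|AB]] := net_cover k AF; have := H B; rewrite BN /=.
  suff -> : #|symd A B| = 0%N by rewrite muln0.
  by apply: eq_card0 => i; rewrite inE AB eqxx.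
by rewrite ltnW.
Qed.

Lemma parent_net F k A : A \in F -> parent F k.+1 A \in net F k.
Proof.
move=> AF /=; case: pickP => [B /andP[BN]//|H].
have [B BN /orP[/eqP AB|AB]] := net_cover k AF; have := H B; rewrite BN /=.
  suff -> : #|symd A B| = 0%N by rewrite muln0.
  by apply: eq_card0 => i; rewrite inE AB eqxx.
by rewrite ltnW.
Qed.

Lemma net_last F : net F #|I| = F.
Proof.
apply/eqP; rewrite finset.eqEsubset net_sub /=; apply/fintype.subsetP => A AF.
have [B BN /orP[/eqP ->//|]] := net_cover #|I| AF.
have [/symd_eq0 -> //|AB] := posnP #|symd A B|.
have : (#|I| < 4 ^ #|I|)%N by apply: ltn_expl.
move=> h1 h2; have := leq_pmulr (4 ^ #|I|) AB; lia.
Qed.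

(** The increment allowed at level [k].  Its Gaussian exponent is proportional to
    [(1 + k/2)^2 >= 1 + k], which pays for the [exp (O(D (k + 1)))] members of the net,
    while the factor [2 ^ -k] keeps the sum of the increments bounded. *)
Definition chain_step (w : R) (k : nat) : R := w * ((1 + k%:R / 2) / 2 ^+ k).

Lemma sum_chain_step w L : 0 <= w -> \sum_(k < L) chain_step w k <= 3 * w.
Proof.
move=> w0; rewrite -mulr_sumr.
have -> : \sum_(k < L) ((1 + k%:R / 2) / 2 ^+ k) = 3 - (L%:R + 3) / 2 ^+ L :> R.
  elim: L => [|L IH]; first by rewrite big_ord0 expr0; field.
  rewrite big_ord_recr /= IH exprS -natr1; field.
  by rewrite expf_neq0.
by rewrite mulrC ler_wpM2r// gerBl divr_ge0 ?exprn_ge0//.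
Qed.

Definition bad_step F (w : R) k := [set s | [exists A in net F k,
  chain_step w k < `|rad s A - rad s (parent F k A)|]].

Lemma rad_le_chain F w k s : (forall j, (j <= k)%N -> s \notin bad_step F w j) ->
  forall A, A \in net F k -> `|rad s A| <= \sum_(j < k.+1) chain_step w j.
Proof.
elim: k => [|k IH] sk A AN.
  have := sk 0%N (leqnn _); rewrite inE negb_exists_in => /forall_inP/(_ A AN).
  rewrite -leNgt big_ord_recl big_ord0 addr0.
  rewrite /rad [X in _ - X]big1 ?subr0// => i _.
  by rewrite inE mulr0.
have AF := fintype.subsetP (net_sub F k.+1) _ AN.
have := sk k.+1 (leqnn _); rewrite inE negb_exists_in => /forall_inP/(_ A AN).
rewrite -leNgt => h1; rewrite big_ord_recr /=.
have h2 := IH (fun j jk => sk j (leqW jk)) _ (parent_net k AF).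
have -> : rad s A = rad s (parent F k.+1 A) + (rad s A - rad s (parent F k.+1 A)).
  by rewrite addrC subrK.
by rewrite (le_trans (ler_normD _ _))// lerD.
Qed.

Lemma card_bad_step F D (x : R) k : (0 < D)%N -> 0 <= x -> vc_le F D -> (0 < #|I|)%N ->
  #|bad_step F (Num.sqrt (32 * #|I|%:R * (x + 7 * D%:R))) k|%:R
    <= 2 ^+ #|I| * (expR (- x) * 2 ^- k.+1).
Proof.
move=> D0 x0 FD I0; set y := x + 7 * D%:R.
have y0 : 0 <= y by rewrite addr_ge0// mulr_ge0.
set w := Num.sqrt _.
have n0 : 0 < #|I|%:R :> R by rewrite ltr0n.
have w2 : w ^+ 2 = 32 * #|I|%:R * y by rewrite sqr_sqrtr// !mulr_ge0.
have p2 : 0 < 2 ^+ k :> R by rewrite exprn_gt0.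
have st0 : 0 <= chain_step w k.
  by rewrite !mulr_ge0 ?sqrtr_ge0 ?invr_ge0 ?(ltW p2)// addr_ge0// divr_ge0.
pose N : R := 4 * #|I|%:R / 4 ^+ k.
have N0 : 0 < N by rewrite divr_gt0 ?mulr_gt0 ?exprn_gt0.
pose bnd := 2 ^+ #|I| * (2 * expR (- (chain_step w k ^+ 2 / (8 * N)))) : R.
apply: (@le_trans _ _ (\sum_(A in net F k) bnd)).
  apply: (@le_trans _ _ (\sum_(A in net F k)
      #|[set s | chain_step w k < `|rad s A - rad s (parent F k A)|]|%:R)).
    rewrite -natr_sum ler_nat (leq_trans _ (leq_card_bigcup _ _))//.
    apply: subset_leq_card; apply/fintype.subsetP => s; rewrite inE.
    by move=> /exists_inP[A AN h]; apply/bigcupP; exists A => //; rewrite inE.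
  apply: ler_sum => A AN; have AF := fintype.subsetP (net_sub F k) _ AN.
  rewrite (eq_card (B := mem [set s | chain_step w k <
     `|signed_sum (fun i => (i \in A)%:R - (i \in parent F k A)%:R) s|])); last first.
    by move=> s; rewrite !inE rad_sub.
  apply: signed_sum_tail => //; rewrite sum_indic_sub /N ler_pdivlMr ?exprn_gt0//.
  by rewrite mulrC -natrX -!natrM ler_nat; exact: parent_near.
rewrite sumr_const -[leLHS]mulr_natl /bnd mulrCA ler_wpM2l ?exprn_ge0//.
have -> : chain_step w k ^+ 2 / (8 * N) = y * (1 + k%:R / 2) ^+ 2.
  rewrite /chain_step exprMn w2 /N.
  have -> : 4 ^+ k = 2 ^+ k * 2 ^+ k :> R by rewrite -exprMn; congr (_ ^+ _); ring.
  by field; rewrite ?gt_eqF.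
have e1 : 2 <= expR 1 :> R by have := expR_ge1Dx (1 : R); lra.
apply: (@le_trans _ _ (expR (2^-1 + 4 * D%:R * k.+1%:R) * (expR 1 * expR (- (y * k.+1%:R))))).
  apply: ler_pM; [by []|by rewrite mulr_ge0 ?expR_ge0|exact: net_card|].
  apply: ler_pM; [by []|exact: expR_ge0|exact: e1|].
  rewrite ler_expR lerN2 ler_wpM2l// -natr1.
  by have := sqr_ge0 (k%:R : R); nra.
have -> : 2 ^- k.+1 = (2^-1) ^+ k.+1 :> R by rewrite exprVn.
apply: (@le_trans _ _ (expR (- x) * expR (-1) ^+ k.+1)); last first.
  rewrite ler_wpM2l ?expR_ge0// lerXn2r ?nnegrE ?expR_ge0//.
  by rewrite expRN lef_pV2 ?posrE ?expR_gt0.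
rewrite -expRM_natr -!expRD ler_expR /y.
have D1 : 1 <= D%:R :> R by rewrite ler1n.
have k1 : 1 <= k.+1%:R :> R by rewrite ler1n.
nra.
Qed.

(** Chaining: outside of an event of probability [exp (- x)] all increments from a net to
    the next coarser one are within [chain_step], and the finest net is the whole
    family.  The logarithm which a plain union bound over the family would cost does
    not appear, because large nets only carry small increments. *)
Lemma rademacher_vc F D (x : R) : (0 < D)%N -> 0 <= x -> vc_le F D ->
  #|[set s | [exists A in F,
       Num.sqrt (288 * #|I|%:R * (x + 7 * D%:R)) < `|rad s A|]]|%:R
    <= 2 ^+ #|I| * expR (- x).
Proof.
move=> D0 x0 FD; have [I0|I0] := posnP #|I|.
  rewrite [#|_|]eq_card0 ?mulr_ge0 ?exprn_ge0 ?expR_ge0// => s.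
  rewrite !inE; apply/negbTE; rewrite negb_exists_in; apply/forall_inP => A _.
  rewrite -leNgt.
  rewrite I0 mulr0 mul0r sqrtr0 normr_le0 /rad /signed_sum big1// => i.
  by have := fintype.card0_eq I0 i; rewrite inE.
pose w := Num.sqrt (32 * #|I|%:R * (x + 7 * D%:R)).
have w3 : Num.sqrt (288 * #|I|%:R * (x + 7 * D%:R)) = 3 * w.
  have -> : 288 * #|I|%:R * (x + 7 * D%:R) = 3 ^+ 2 * (32 * #|I|%:R * (x + 7 * D%:R)).
    by ring.
  by rewrite sqrtrM ?sqr_ge0// sqrtr_sqr ger0_norm.
apply: (@le_trans _ _ (\sum_(k < #|I|.+1) #|bad_step F w k|%:R)).
  rewrite -natr_sum ler_nat (leq_trans _ (leq_card_bigcup _ _))//.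
  apply: subset_leq_card; apply/fintype.subsetP => s; rewrite inE w3.
  move=> /exists_inP[A AF h]; apply: contraLR h => sbad.
  rewrite -leNgt; apply: (@le_trans _ _ (\sum_(j < #|I|.+1) chain_step w j)).
    apply: (@rad_le_chain F w #|I|); last by rewrite net_last.
    move=> j jI; apply: contraNN sbad => sj.
    by apply/bigcupP; exists (inord j); rewrite ?inordK.
  by apply: sum_chain_step; rewrite sqrtr_ge0.
apply: (@le_trans _ _ (\sum_(k < #|I|.+1) 2 ^+ #|I| * (expR (- x) * 2 ^- k.+1))).
  by apply: ler_sum => k _; exact: card_bad_step.
rewrite -mulr_sumr ler_wpM2l ?exprn_ge0// -mulr_sumr ler_piMr ?expR_ge0//.
have -> L : \sum_(k < L) 2 ^- k.+1 = 1 - 2 ^- L :> R.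
  elim: L => [|L IH]; first by rewrite big_ord0 expr0 invr1 subrr.
  by rewrite big_ord_recr /= IH exprS; field; rewrite expf_neq0.
by rewrite gerBl invr_ge0 exprn_ge0.
Qed.

End chaining.

(** * Symmetrization on a finite sample space *)

Section symmetrization.
Context (R : realType) (T : finType) (mu : T -> R).
Hypotheses (mu0 : forall t, (0 <= mu t)%R) (mu1 : (\sum_t mu t = 1)%R).
Local Open Scope ring_scope.
Implicit Types (A : {set T}) (F : {set {set T}}).

Definition weight n (z : {ffun 'I_n -> T}) : R := \prod_i mu (z i).

Lemma weight_ge0 n (z : {ffun 'I_n -> T}) : 0 <= weight z.
Proof. by rewrite prodr_ge0. Qed.

Lemma sum_weight_prod n (h : T -> R) :
  \sum_(z : {ffun 'I_n -> T}) weight z * \prod_i h (z i) =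
  (\sum_t mu t * h t) ^+ n.
Proof.
rewrite -[n in RHS]card_ord -prodr_const bigA_distr_bigA.
by apply: eq_bigr => z _; rewrite -big_split.
Qed.

Lemma sum_weight n : \sum_(z : {ffun 'I_n -> T}) weight z = 1.
Proof.
transitivity ((\sum_t mu t * 1) ^+ n).
  rewrite -(sum_weight_prod n (fun=> 1)).
  by apply: eq_bigr => z _; rewrite big1 ?mulr1.
by under eq_bigr do rewrite mulr1; rewrite mu1 expr1n.
Qed.

Definition mass A : R := \sum_(t in A) mu t.

Definition hits n (z : {ffun 'I_n -> T}) A : R := #|pullback z A|%:R.

Lemma hitsE n (z : {ffun 'I_n -> T}) A : hits z A = \sum_i (z i \in A)%:R.
Proof.
rewrite /hits -sum1_card natr_sum big_mkcond /=.
by apply: eq_bigr => i _; rewrite inE; case: ifP.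
Qed.

(** Symmetrization replaces the centering: multiplying by the generating function of an
    independent copy of [- (X - E X)], which is at least 1 by Jensen's inequality, leaves the
    symmetric variable [X - X'], to which [cosh_le_expR] applies. *)
Lemma mass_mgf A (l : R) :
  \sum_t mu t * expR (l * ((t \in A)%:R - mass A)) <= expR (2 * l ^+ 2).
Proof.
set X := fun t => (t \in A)%:R : R; set p := mass A.
have pE : p = \sum_t mu t * X t.
  rewrite /p /mass big_mkcond /=; apply: eq_bigr => t _.
  by rewrite /X; case: ifP; rewrite ?mulr1 ?mulr0.
have ge1 : 1 <= \sum_t mu t * expR (- l * (X t - p)).
  have <- : \sum_t mu t * (1 + - l * (X t - p)) = 1.
    have -> : \sum_t mu t * (1 + - l * (X t - p)) =
        \sum_t mu t - l * (\sum_t mu t * X t - p * \sum_t mu t).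
      rewrite !mulr_sumr -sumrB mulr_sumr -sumrB; apply: eq_bigr => t _.
      by ring.
    by rewrite mu1 -pE mulr1 subrr mulr0 subr0.
  by apply: ler_sum => t _; rewrite ler_wpM2l ?expR_ge1Dx.
have ge0 : 0 <= \sum_t mu t * expR (l * (X t - p)).
  by apply: sumr_ge0 => t _; rewrite mulr_ge0 ?expR_ge0.
apply: (le_trans (ler_peMr ge0 ge1)).
pose G := \sum_t \sum_u mu t * mu u * expR (l * (X t - X u)).
have -> : (\sum_t mu t * expR (l * (X t - p))) * (\sum_t mu t * expR (- l * (X t - p))) = G.
  rewrite mulr_suml; apply: eq_bigr => t _; rewrite mulr_sumr; apply: eq_bigr => u _.
  rewrite mulrACA -expRD; congr (_ * expR _); ring.
have GE : G = \sum_t \sum_u mu t * mu u *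
    ((expR (l * (X t - X u)) + expR (- (l * (X t - X u)))) / 2).
  have G' : G = \sum_t \sum_u mu t * mu u * expR (- (l * (X t - X u))).
    rewrite /G exchange_big /=; apply: eq_bigr => t _; apply: eq_bigr => u _.
    by rewrite [mu u * _]mulrC -mulrN opprB.
  transitivity ((G + G) / 2); first by field.
  rewrite {2}G' /G -big_split mulr_suml; apply: eq_bigr => t _ /=.
  rewrite -big_split mulr_suml; apply: eq_bigr => u _ /=.
  by rewrite -mulrDr mulrA.
have -> : expR (2 * l ^+ 2) = \sum_t \sum_u mu t * mu u * expR (2 * l ^+ 2).
  under eq_bigr => t _ do rewrite -mulr_suml -mulr_sumr mu1 mulr1.
  by rewrite -mulr_suml mu1 mul1r.
rewrite GE; apply: ler_sum => t _; apply: ler_sum => u _.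
rewrite ler_wpM2l ?mulr_ge0//; apply: (le_trans (cosh_le_expR _)).
rewrite ler_expR exprMn ler_wpM2l// ler_piMr ?sqr_ge0//.
rewrite /X; case: (t \in A); case: (u \in A) => /=;
  by rewrite ?subrr ?subr0 ?sub0r ?sqrrN ?expr0n ?expr1n.
Qed.

Lemma hits_tail1 n A (e t : R) : (0 < n)%N -> 0 <= t -> e ^+ 2 = 1 ->
  \sum_(z : {ffun 'I_n -> T} | t < e * (hits z A - n%:R * mass A)) weight z
    <= expR (- (t ^+ 2 / (8 * n%:R))).
Proof.
move=> n0 t0 e1; have n0' : 0 < n%:R :> R by rewrite ltr0n.
pose l := t / (4 * n%:R).
have l0 : 0 <= l by rewrite divr_ge0// mulr_ge0.
apply: (@le_trans _ _ (\sum_(z : {ffun 'I_n -> T})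
    weight z * expR (l * (e * (hits z A - n%:R * mass A)) - l * t))).
  rewrite big_mkcond /=; apply: ler_sum => z _; case: ifP => [h|_].
    rewrite ler_peMr ?weight_ge0// -[leLHS]expR0 ler_expR -mulrBr mulr_ge0//.
    by rewrite subr_ge0 ltW.
  by rewrite mulr_ge0 ?weight_ge0 ?expR_ge0.
under eq_bigr do rewrite expRD mulrA.
rewrite -mulr_suml.
rewrite (eq_bigr (fun z => weight z *
    \prod_i expR (l * e * ((z i \in A)%:R - mass A)))); last first.
  move=> z _; congr (_ * _); rewrite -expR_sum -mulr_sumr mulrA; congr (expR (_ * _)).
  by rewrite hitsE sumrB sumr_const card_ord mulr_natl.
rewrite (sum_weight_prod n (fun t => expR (l * e * ((t \in A)%:R - mass A)))).
apply: (@le_trans _ _ (expR (2 * l ^+ 2) ^+ n * expR (- (l * t)))).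
  rewrite ler_wpM2r ?expR_ge0// lerXn2r ?nnegrE ?expR_ge0//.
    by apply: sumr_ge0 => u _; rewrite mulr_ge0 ?expR_ge0.
  by have := mass_mgf A (l * e); rewrite exprMn e1 mulr1.
rewrite -expRM_natr -expRD ler_expR le_eqVlt; apply/orP; left; apply/eqP.
by rewrite /l; field; rewrite gt_eqF.
Qed.

Lemma hits_tail n A (t : R) : (0 < n)%N -> 0 <= t ->
  \sum_(z : {ffun 'I_n -> T} | t < `|hits z A - n%:R * mass A|) weight z
    <= 2 * expR (- (t ^+ 2 / (8 * n%:R))).
Proof.
move=> n0 t0.
have h1 := @hits_tail1 n A 1 t n0 t0 (expr1n _ 2).
have h2 := @hits_tail1 n A (-1) t n0 t0 _.
rewrite sqrrN expr1n in h2; have {}h2 := h2 erefl.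
apply: le_trans (_ : _ <= _ + _) (le_trans (lerD h1 h2) _); last by lra.
rewrite [leLHS]big_mkcond [X in _ <= X + _]big_mkcond [X in _ <= _ + X]big_mkcond.
rewrite -big_split; apply: ler_sum => z _ /=.
rewrite lter_normr mul1r mulN1r; have := weight_ge0 z.
by case: (t < _); case: (t < - _) => /=; lra.
Qed.

Definition swap n (s : {ffun 'I_n -> bool}) (zz : {ffun 'I_n -> T} * {ffun 'I_n -> T}) :=
  ([ffun i => if s i then zz.2 i else zz.1 i], [ffun i => if s i then zz.1 i else zz.2 i]).

Lemma swapK n s : involutive (@swap n s).
Proof. by move=> [z z']; congr pair; apply/ffunP => i; rewrite !ffunE /=; case: (s i). Qed.

Lemma weight_swap n s zz : weight (@swap n s zz).1 * weight (swap s zz).2 =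
  weight zz.1 * weight zz.2.
Proof.
rewrite -!big_split; apply: eq_bigr => i _ /=; rewrite !ffunE.
by case: (s i) => //; rewrite mulrC.
Qed.

Lemma hits_swap n s zz A : hits (@swap n s zz).1 A - hits (swap s zz).2 A =
  rad R s (pullback zz.1 A) - rad R s (pullback zz.2 A).
Proof.
rewrite !hitsE -!sumrB; apply: eq_bigr => i _ /=; rewrite !ffunE !inE.
by case: (s i); rewrite ?expr1 ?expr0; ring.
Qed.

Section ghost.
Variables (n : nat) (F : {set {set T}}) (r q : R).
Hypotheses (n0 : (0 < n)%N) (r0 : 0 <= r).
Hypothesis (concr : 2 * expR (- ((2 * r) ^+ 2 / (8 * n%:R))) <= 2^-1).
Hypothesis (radq : forall z : {ffun 'I_n -> T},
  #|[set s : {ffun 'I_n -> bool} | [exists A in F, r < `|rad R s (pullback z A)|]]|%:R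
    <= 2 ^+ n * q).

Let far (zz : {ffun 'I_n -> T} * {ffun 'I_n -> T}) :=
  [exists A in F, 2 * r < `|hits zz.1 A - hits zz.2 A|].

(** The joint weight of the two samples is invariant under exchanging any set of
    coordinates, so it may be averaged over all exchanges [s]; given the two samples, the
    difference of the hits is then a difference of two signed sums. *)
Lemma ghost_far : \sum_(zz | far zz) weight zz.1 * weight zz.2 <= 2 * q.
Proof.
have p2 : 0 < 2 ^+ n :> R by rewrite exprn_gt0.
rewrite -(ler_pM2l p2).
have -> : 2 ^+ n * \sum_(zz | far zz) weight zz.1 * weight zz.2 =
    \sum_(s : {ffun 'I_n -> bool}) \sum_zz (far (swap s zz))%:R * (weight zz.1 * weight zz.2).
  rewrite [RHS](eq_bigr (fun=> \sum_(zz | far zz) weight zz.1 * weight zz.2)); last first.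
    move=> s _; rewrite [RHS]big_mkcond [RHS](reindex_inj (inv_inj (swapK s))) /=.
    apply: eq_bigr => zz _; rewrite weight_swap.
    by case: ifP; rewrite ?mul1r ?mul0r.
  by rewrite sumr_const card_ffun card_bool card_ord -[RHS]mulr_natl natrX.
rewrite exchange_big /=.
pose G (z : {ffun 'I_n -> T}) :=
  [set s : {ffun 'I_n -> bool} | [exists A in F, r < `|rad R s (pullback z A)|]].
apply: (@le_trans _ _ (\sum_(zz : {ffun 'I_n -> T} * {ffun 'I_n -> T})
    (weight zz.1 * weight zz.2) * (2 ^+ n * (2 * q)))).
  apply: ler_sum => zz _; rewrite -mulr_suml mulrC ler_wpM2l ?mulr_ge0 ?weight_ge0//.
  apply: (@le_trans _ _ (#|G zz.1|%:R + #|G zz.2|%:R)); last first.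
    by have := radq zz.1; have := radq zz.2; rewrite -/(G _) -/(G _); lra.
  rewrite -natr_sum -natrD ler_nat -!sum1_card [X in (_ <= X + _)%N]big_mkcond.
  rewrite [X in (_ <= _ + X)%N]big_mkcond -big_split; apply: leq_sum => s _ /=.
  case: (boolP (far _)) => // /exists_inP[A AF]; rewrite hits_swap => h.
  rewrite !inE; have : (r < `|rad R s (pullback zz.1 A)|) || (r < `|rad R s (pullback zz.2 A)|).
    apply: contraLR h; rewrite negb_or -!leNgt => /andP[h1 h2].
    by rewrite (le_trans (ler_normB _ _))//; lra.
  case/orP => h'.
    have -> : [exists A in F, r < `|rad R s (pullback zz.1 A)|].
      by apply/exists_inP; exists A.
    by [].
  have -> : [exists A in F, r < `|rad R s (pullback zz.2 A)|].
    by apply/exists_inP; exists A.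
  by rewrite addn1.
rewrite -mulr_suml -(pair_big predT predT (fun z z' => weight z * weight z')) /=.
under eq_bigr do rewrite -mulr_sumr sum_weight mulr1.
by rewrite sum_weight mul1r.
Qed.

(** If the first sample has a set [A] of large deviation, then, by concentration for this
    one set, at least half of the second samples are close to the mean at [A], and hence far
    from the first sample. *)
Lemma symmetrization :
  \sum_(z : {ffun 'I_n -> T} |
     [exists A in F, 4 * r < `|hits z A - n%:R * mass A|]) weight z <= 4 * q.
Proof.
suff : \sum_(z : {ffun 'I_n -> T} |
     [exists A in F, 4 * r < `|hits z A - n%:R * mass A|]) weight z <=
  2 * \sum_(zz | far zz) weight zz.1 * weight zz.2 by have := ghost_far; lra.
have -> : \sum_(zz | far zz) weight zz.1 * weight zz.2 =
    \sum_z \sum_(z' | far (z, z')) weight z * weight z'.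
  by rewrite pair_big_dep.
rewrite mulr_sumr big_mkcond /=; apply: ler_sum => z _.
have nn : 0 <= 2 * \sum_(z' | far (z, z')) weight z * weight z'.
  by rewrite mulr_ge0// sumr_ge0// => z' _; rewrite mulr_ge0 ?weight_ge0.
case: ifP => [/exists_inP[A AF h]|_//].
rewrite -mulr_sumr mulrCA ler_peMr ?weight_ge0//.
have near2 : 2^-1 <= \sum_(z' : {ffun 'I_n -> T} |
    ~~ (2 * r < `|hits z' A - n%:R * mass A|)) weight z'.
  have := sum_weight n.
  rewrite (bigID (fun z' => 2 * r < `|hits z' A - n%:R * mass A|)) /=.
  have := @hits_tail n A (2 * r) n0 _; have : 0 <= 2 * r by rewrite mulr_ge0.
  by move=> h2 /(_ h2); move: concr; lra.
suff : \sum_(z' : {ffun 'I_n -> T} | ~~ (2 * r < `|hits z' A - n%:R * mass A|))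
   weight z' <= \sum_(z' | far (z, z')) weight z' by move: near2; lra.
rewrite big_mkcond [leRHS]big_mkcond /=; apply: ler_sum => z' _.
case: ifP => [h'|_]; last by case: ifP => // _; exact: weight_ge0.
suff -> : far (z, z') by [].
apply/exists_inP; exists A => //=; rewrite ltNge; apply/negP => h2.
move: h; rewrite ltNge; apply/negP; rewrite negbK -leNgt in h' *.
have -> : hits z A - n%:R * mass A =
  (hits z A - hits z' A) + (hits z' A - n%:R * mass A) by ring.
by rewrite (le_trans (ler_normD _ _))//; lra.
Qed.

End ghost.

(** The ghost-sample step only needs concentration with probability 1/2 for a single
    set, which the size of the deviation guarantees as [D >= 1]. *)
Lemma finite_vc_deviation n F D (x : R) : (0 < n)%N -> (0 < D)%N -> 0 <= x -> vc_le F D ->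
  \sum_(z : {ffun 'I_n -> T} | [exists A in F,
     4 * Num.sqrt (288 * n%:R * (x + 7 * D%:R)) < `|hits z A - n%:R * mass A|]) weight z
  <= 4 * expR (- x).
Proof.
move=> n0 D0 x0 FD; apply: symmetrization => //.
  have D1 : 1 <= D%:R :> R by rewrite ler1n.
  have n0' : 0 < n%:R :> R by rewrite ltr0n.
  rewrite exprMn sqr_sqrtr ?mulr_ge0 ?addr_ge0 ?mulr_ge0//.
  have -> : 2 ^+ 2 * (288 * n%:R * (x + 7 * D%:R)) / (8 * n%:R) = 144 * (x + 7 * D%:R).
    by field; rewrite gt_eqF.
  have h : expR (- (144 * (x + 7 * D%:R))) <= expR (-1) ^+ 2.
    by rewrite -expRM_natr ler_expR; lra.
  have h1 : expR (-1) <= 2^-1 :> R.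
    rewrite expRN lef_pV2 ?posrE ?expR_gt0//.
    by have := expR_ge1Dx (1 : R); lra.
  have := expR_ge0 (-1 : R); nra.
move=> z; have := @rademacher_vc R _ [set pullback z A | A in F] D x D0 x0 (vc_preim FD).
rewrite card_ord; apply: le_trans; rewrite ler_nat; apply: subset_leq_card.
apply/fintype.subsetP => s; rewrite !inE => /exists_inP[A AF h].
by apply/exists_inP; exists (pullback z A) => //; apply: imset_f.
Qed.

End symmetrization.

(** * Uniform deviations for families of measurable sets *)

Section fibers.
Local Open Scope ereal_scope.
Local Open Scope classical_set_scope.
Context d (T : measurableType d) (R : realType) (P : probability T R).

Lemma measurable_fin_fiber (C : finType) (f : T -> C) (Q : pred C) :
  (forall c, measurable (f @^-1` [set c])) -> measurable [set t | Q (f t)].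
Proof.
move=> mf; have -> : [set t | Q (f t)] = \bigcup_(c in [set c | Q c]) (f @^-1` [set c]).
  by apply/seteqP; split => [t Qt|t [c Qc] /= ->//]; exists (f t).
by apply: fin_bigcup_measurable => // c _; exact: mf.
Qed.

Lemma probability_fin_fiber (C : finType) (f : T -> C) (Q : pred C) :
  (forall c, measurable (f @^-1` [set c])) ->
  P [set t | Q (f t)] = \sum_(c | Q c) P (f @^-1` [set c]).
Proof.
move=> mf; rewrite -big_enum /=.
have -> : [set t | Q (f t)] = [set t | f t \in enum Q].
  by apply/seteqP; split => t /=; rewrite mem_enum.
elim: (enum Q) (enum_uniq Q) => [_|c s IH /= /andP[cs us]].
  rewrite big_nil (_ : [set t | _] = set0) ?measure0//.
  by apply/seteqP; split.
have -> : [set t | f t \in c :: s] = (f @^-1` [set c]) `|` [set t | f t \in s].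
  apply/seteqP; split => t /=; rewrite inE; first by case/orP => [/eqP|]; [left|right].
  by case => [->|->]; rewrite ?eqxx ?orbT.
rewrite big_cons measureU//; first by congr (_ + _)%R; exact: IH.
  exact: (measurable_fin_fiber (fun c => c \in s)).
by apply/seteqP; split => // t [/= ->]; exact/negP.
Qed.

End fibers.

Section transfer.
Local Open Scope ring_scope.
Local Open Scope classical_set_scope.

(** Points of a sample are enough to express shattering here, repetitions included: a
    repeated point makes the hypothesis fail. *)
Definition vc_family (T J : Type) (S : J -> set T) (D : nat) :=
  forall m (t : 'I_m -> T),
    (forall Y : {set 'I_m}, exists j, forall i, (i \in Y) <-> S j (t i)) -> (m <= D)%N.

Context d (T : measurableType d) (R : realType) (P : probability T R).
Context d' (Omega : measurableType d') (Pr : probability Omega R).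
Context (n : nat) (Z : 'I_n -> {RV Pr >-> T}).
Hypothesis (ZP : random_sample P Z).

Definition count (A : set T) (w : Omega) : R := \sum_(i < n) \1_A (Z i w).

Definition deviates (r : R) (A : set T) : set Omega :=
  [set w | r < `|count A w - n%:R * fine (P A)|].

Section finite_family.
Variables (K : nat) (S : 'I_K -> set T).
Hypothesis mS : forall k, measurable (S k).

Local Notation C := {ffun 'I_K -> bool}.

(* The atoms of the algebra generated by the family.  Codes which no point attains are
   excluded from the sets of [F], since the family constrains their traces in no way. *)
Let code (t : T) : C := [ffun k => `[< S k t >]].
Let attained (c : C) := `[< exists t, code t = c >].
Let F : {set {set C}} := [set [set c : C | c k && attained c] | k : 'I_K]%SET.
Let mu (c : C) : R := fine (P (code @^-1` [set c])).

Let mcode c : measurable (code @^-1` [set c]).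
Proof.
have -> : code @^-1` [set c] = \bigcap_(k in [set: 'I_K]) (if c k then S k else ~` S k).
  apply/seteqP; split => [t /= <- k _|t H].
    by rewrite ffunE; case: asboolP.
  apply/ffunP => k; rewrite ffunE; have := H k I.
  by case: (c k) => /= h; case: asboolP.
apply: fin_bigcap_measurable => // k _.
by case: (c k) => //; exact: measurableC.
Qed.

Let muE c : (mu c)%:E = P (code @^-1` [set c]).
Proof. by rewrite /mu fineK// fin_num_measure. Qed.

Let mu0 c : 0 <= mu c.
Proof. by rewrite -lee_fin muE measure_ge0. Qed.

Let mu1 : \sum_c mu c = 1.
Proof.
apply: EFin_inj; transitivity (\sum_c P (code @^-1` [set c]))%E.
  by rewrite -sumEFin; apply: eq_bigr => c _; exact: muE.
rewrite -(probability_fin_fiber P predT mcode) -[RHS](probability_setT P).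
by congr (P _); apply/seteqP; split.
Qed.

Let B k : {set C} := [set c : C | c k && attained c]%SET.

Let code_B t k : (code t \in B k) = `[< S k t >].
Proof.
rewrite inE ffunE; suff -> : attained (code t) by rewrite andbT.
by apply/asboolP; exists t.
Qed.

Let massB k : mass mu (B k) = fine (P (S k)).
Proof.
apply: EFin_inj; rewrite fineK ?fin_num_measure// -sumEFin.
transitivity (\sum_(c in B k) P (code @^-1` [set c]))%E.
  by apply: eq_bigr => c _; exact: muE.
rewrite -(probability_fin_fiber P (fun c => c \in B k) mcode); congr (P _).
apply/seteqP; split => t /=; rewrite code_B.
  by move/asboolP.
by move=> ?; apply/asboolP.
Qed.

Let zeta (w : Omega) : {ffun 'I_n -> C} := [ffun i => code (Z i w)].

Let zetaE z : zeta @^-1` [set z] =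
  \bigcap_(i in [set: 'I_n]) (Z i @^-1` (code @^-1` [set z i])).
Proof.
apply/seteqP; split => [w /= <- i _ /=|w H]; first by rewrite ffunE.
by apply/ffunP => i; rewrite ffunE; exact: H.
Qed.

Let mzeta z : measurable (zeta @^-1` [set z]).
Proof.
rewrite zetaE; apply: fin_bigcap_measurable => // i _.
by rewrite -[X in measurable X]setTI; exact: measurable_funPT.
Qed.

Let Pr_zeta z : Pr (zeta @^-1` [set z]) = (weight mu z)%:E.
Proof.
have [ZiP Zind] := ZP.
rewrite zetaE Zind// -prodEFin; apply: eq_bigr => i _.
by rewrite muE -(ZiP i)//; exact: mcode.
Qed.

Let hits_zeta w k : hits R (zeta w) (B k) = count (S k) w.
Proof.
rewrite hitsE; apply: eq_bigr => i _; rewrite ffunE code_B indicE.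
by congr ((nat_of_bool _)%:R); apply/asboolP/idP; rewrite inE.
Qed.

Let vcF D : vc_family S D -> vc_le F D.
Proof.
move=> SD X /shattersP XF; have [->|X0] := eqVneq X finset.set0; first by rewrite cards0.
have att c : c \in X -> attained c.
  move=> cX; have [_ /imsetP[k _ ->] /setP/(_ c)] := XF X (subxx _).
  by rewrite !inE cX andbT => /andP[_ /asboolP].
have [t tE] : {t : 'I_#|X| -> T & forall i, code (t i) = enum_val i}.
  apply: (@boolp.choice _ _ (fun i t => code t = enum_val i)) => i.
  by have /asboolP := att _ (enum_valP i).
apply: (SD _ t) => Y.
have [|_ /imsetP[k _ ->] /setP YE] := XF (enum_val @: Y)%SET.
  by apply/fintype.subsetP => _ /imsetP[i _ ->]; exact: enum_valP.
exists k => i; have := YE (enum_val i).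
rewrite finset.in_setI enum_valP andbT -tE code_B tE mem_imset; last exact: enum_val_inj.
by move=> <-; split => /asboolP.
Qed.

Lemma finite_family_deviation D (x : R) : (0 < n)%N -> (0 < D)%N -> 0 <= x ->
  vc_family S D ->
  let r := 4 * Num.sqrt (288 * n%:R * (x + 7 * D%:R)) in
  let E := \bigcup_(k in [set: 'I_K]) deviates r (S k) in
  measurable E /\ (Pr E <= (4 * expR (- x))%:E)%E.
Proof.
move=> n0 D0 x0 SD r E.
pose Q (z : {ffun 'I_n -> C}) :=
  [exists A in F, r < `|hits R z A - n%:R * mass mu A|].
have -> : E = [set w | Q (zeta w)].
  apply/seteqP; split => w.
    move=> [k _]; rewrite /deviates /= => h; apply/exists_inP; exists (B k).
      exact: imset_f.
    by rewrite hits_zeta massB.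
  move=> /exists_inP[_ /imsetP[k _ ->]]; rewrite hits_zeta massB => h.
  by exists k.
split; first exact: measurable_fin_fiber.
rewrite probability_fin_fiber//.
under eq_bigr do rewrite Pr_zeta.
rewrite sumEFin lee_fin.
exact: finite_vc_deviation (vcF SD).
Qed.

End finite_family.

(** The bound for finite families does not depend on their size, so it passes to the
    increasing union. *)
Lemma countable_family_deviation (S : nat -> set T) D (x : R) :
  (forall k, measurable (S k)) -> (0 < n)%N -> (0 < D)%N -> 0 <= x ->
  vc_family S D ->
  let r := 4 * Num.sqrt (288 * n%:R * (x + 7 * D%:R)) in
  let E := \bigcup_k deviates r (S k) in
  measurable E /\ (Pr E <= (4 * expR (- x))%:E)%E.
Proof.
move=> mS n0 D0 x0 SD r E.
pose G K := \bigcup_(k in [set: 'I_K]) deviates r (S k).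
have GP K : measurable (G K) /\ (Pr (G K) <= (4 * expR (- x))%:E)%E.
  apply: (@finite_family_deviation K (fun k => S k)) => // m t H.
  by apply: (SD m t) => Y; have [j jY] := H Y; exists (val j).
have EG : E = \bigcup_K G K.
  apply/seteqP; split => [w [k _ h]|w [K _ [k _ h]]]; last by exists (val k).
  by exists k.+1 => //; exists ord_max.
have mE : measurable E by rewrite EG; apply: bigcupT_measurable => K; case: (GP K).
split => //; rewrite EG in mE *.
have cv : (Pr \o G) K @[K --> \oo] --> Pr (\bigcup_K G K).
  apply: nondecreasing_cvg_mu => // [K|]; first by case: (GP K).
  move=> K L KL; apply/subsetPset => w [k _ h].
  by exists (widen_ord KL k).
rewrite -(cvg_lim _ cv)//; apply: lime_le; first by apply/cvg_ex; eexists; exact: cv.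
by apply: nearW => K /=; case: (GP K).
Qed.

End transfer.

(** * Halfspaces *)

Section halfspaces.
Local Open Scope ring_scope.
Local Open Scope classical_set_scope.
Context (R : realType).

(** Among more than [D] points there is a linear relation of the feature vectors with a
    positive coefficient.  No halfspace contains exactly the points whose coefficient is not
    positive: summing the relation against its normal vector would give a negative
    number. *)
Lemma linear_vc (T J : Type) D (phi : T -> 'I_D -> R) (theta : J -> 'I_D -> R) :
  vc_family (fun j => [set t | 0 <= \sum_i theta j i * phi t i]) D.
Proof.
move=> m t H; rewrite leqNgt; apply/negP => Dm.
pose M := \matrix_(k < m, i < D) phi (t k) i.
have : ~~ row_free M.
  by rewrite /row_free neq_ltn (leq_ltn_trans (rank_leq_col M)).
rewrite -kermx_eq0 => /rowV0Pn[u /sub_kermxP uM u0].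
have uphi i : \sum_k u 0 k * phi (t k) i = 0.
  have /rowP/(_ i) := uM; rewrite !mxE => uMi.
  by rewrite -[RHS]uMi; apply: eq_bigr => k _; rewrite mxE.
have [v [vphi [k0 vk0]]] : exists v : 'I_m -> R,
    (forall i, \sum_k v k * phi (t k) i = 0) /\ exists k, 0 < v k.
  have [k uk] : exists k, u 0 k != 0.
    by move/rV0Pn : u0.
  have [uk0|uk0] := ltP 0 (u 0 k); first by exists (u 0); split => //; exists k.
  exists (fun k => - u 0 k); split; last by exists k; rewrite oppr_gt0 lt_neqAle uk.
  by move=> i; under eq_bigr do rewrite mulNr; rewrite sumrN uphi oppr0.
have [j jP] := H [set k | v k <= 0]%SET.
have sum0 : \sum_k v k * (\sum_i theta j i * phi (t k) i) = 0.
  under eq_bigr do rewrite mulr_sumr.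
  rewrite exchange_big big1//= => i _.
  under eq_bigr do rewrite mulrCA.
  by rewrite -mulr_sumr vphi mulr0.
have neg k : v k * (\sum_i theta j i * phi (t k) i) <= 0.
  have [h1 h2] := jP k; rewrite inE /= in h1 h2; case: (leP (v k) 0) => vk.
    by rewrite mulr_le0_ge0// h1.
  rewrite mulr_ge0_le0// ?(ltW vk)// leNgt; apply/negP => /ltW/h2.
  by rewrite leNgt vk.
move: sum0; rewrite (bigD1 k0)//=; apply/eqP; rewrite lt_eqF//.
rewrite -[ltRHS](addr0 0) ltr_leD//; last by apply: sumr_le0.
rewrite pmulr_rlt0// ltNge; apply/negP => /(jP k0).2.
by rewrite inE leNgt vk0.
Qed.

Lemma affine_vc (T J : Type) D (phi : T -> 'I_D -> R) (theta : J -> 'I_D -> R)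
    (b : J -> R) :
  vc_family (fun j => [set t | 0 <= \sum_i theta j i * phi t i + b j]) D.+1.
Proof.
pose ext (a : R) (f : 'I_D -> R) i := oapp f a (unlift ord0 i).
have := @linear_vc T J D.+1 (fun t => ext 1 (phi t)) (fun j => ext (b j) (theta j)).
suff -> : (fun j => [set t | 0 <= \sum_i ext (b j) (theta j) i * ext 1 (phi t) i]) =
  (fun j => [set t | 0 <= \sum_i theta j i * phi t i + b j]) by [].
have E j t : \sum_i ext (b j) (theta j) i * ext 1 (phi t) i =
    \sum_i theta j i * phi t i + b j.
  rewrite big_ord_recl /ext unlift_none /= mulr1 addrC; congr (_ + _).
  by apply: eq_bigr => i _; rewrite liftK.
by apply/funext => j; apply/seteqP; split => t /=; rewrite E.
Qed.

Lemma cvg_probability d (T : measurableType d) (P : probability T R)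
    (A_ : nat -> set T) (A : set T) :
  (forall k, measurable (A_ k)) -> measurable A ->
  (forall t, \forall k \near \oo, A_ k t <-> A t) ->
  fine (P (A_ k)) @[k --> \oo] --> fine (P A).
Proof.
move=> mA_ mA AA; apply: fine_cvg; rewrite fineK ?fin_num_measure//.
have [//|||||_ _] := @dominated_convergence _ T R P setT measurableT
  (fun k t => (\1_(A_ k) t)%:E) (fun t => (\1_A t)%:E) (cst 1%:E).
- by move=> k; apply/measurable_EFinP; exact: measurable_indic.
- by apply/measurable_EFinP; exact: measurable_indic.
- apply: aeW => t _; apply: cvg_near_cst; near=> k.
  have [h1 h2] : A_ k t <-> A t by near: k; exact: AA.
  congr (_%:E); rewrite !indicE; congr ((nat_of_bool _)%:R).
  by apply/idP/idP; rewrite !inE.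
- apply/integrableP; split => //; rewrite integral_cst//= normr1 mul1e.
  by rewrite (le_lt_trans (probability_le1 _ _))// ltry.
- by apply: aeW => t k _; rewrite /= lee_fin indicE; case: (_ \in _); rewrite ?normr1 ?normr0.
rewrite integral_indic// setIT => h.
apply: cvg_trans h; apply: near_eq_cvg; apply: nearW => k.
by rewrite /= integral_indic// setIT.
Unshelve. all: by end_near. Qed.

(** Rounding [k^2 theta] to integers costs at most the sum of the [`|phi i|], which is
    eventually negligible with respect to the slack [k], while [k] is itself eventually
    negligible with respect to [k^2] times a negative margin.  So the integer halfspaces
    converge pointwise to the closed halfspace of [theta], from which every probability
    converges. *)
Lemma halfspace_approx D (theta phi : 'I_D -> R) :
  \forall k \near \oo,
    0 <= \sum_i (Num.floor (k%:R ^+ 2 * theta i))%:~R * phi i + k%:R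
    <-> 0 <= \sum_i theta i * phi i.
Proof.
set h := \sum_i theta i * phi i; pose M := \sum_i `|phi i|.
have close k : `|\sum_i (Num.floor (k%:R ^+ 2 * theta i))%:~R * phi i - k%:R ^+ 2 * h| <= M.
  rewrite mulr_sumr -sumrB; apply: le_trans (ler_norm_sum _ _ _) _.
  apply: ler_sum => i _; rewrite mulrA -mulrBl normrM ler_piMl//.
  rewrite distrC ger0_norm ?subr_ge0 ?floor_le_tmp//.
  by have := lt_succ_floor (k%:R ^+ 2 * theta i); rewrite intrD; lra.
have [h0|h0] := leP 0 h.
  near=> k; split => // _; have := close k; rewrite ler_distl => /andP[+ _].
  have kM : M <= k%:R by near: k; exact: nbhs_infty_ger.
  have : 0 <= k%:R ^+ 2 * h by rewrite mulr_ge0// sqr_ge0.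
  by lra.
near=> k; split => //; rewrite leNgt => /negP; apply: contra_notP => _.
have := close k; rewrite ler_distl => /andP[_].
have k1 : 1 <= k%:R :> R by near: k; exact: nbhs_infty_ger.
have kM : (M + 2) / - h <= k%:R by near: k; exact: nbhs_infty_ger.
rewrite ler_pdivrMr ?oppr_gt0// in kM.
have M0 : 0 <= M by apply: sumr_ge0.
nra.
Unshelve. all: by end_near. Qed.

Context d (T : measurableType d) (P : probability T R).
Context d' (Omega : measurableType d') (Pr : probability Omega R).
Context (n : nat) (Z : 'I_n -> {RV Pr >-> T}).
Hypothesis (ZP : random_sample P Z).

Lemma measurable_affine_halfspace D (phi : T -> 'I_D -> R) theta (b : R) :
  (forall i, measurable_fun setT (phi^~ i)) ->
  measurable [set t | 0 <= \sum_i theta i * phi t i + b].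
Proof.
move=> mphi.
have mf : measurable_fun setT (fun t => \sum_i theta i * phi t i + b).
  apply: measurable_funD => //; apply: measurable_sum => i.
  by apply: measurable_funM.
rewrite -[X in measurable X]setTI.
have := mf measurableT `[0, +oo[%classic (measurable_itv _).
by congr measurable; apply/seteqP; split => t /= [_]; rewrite in_itv /= andbT.
Qed.

Lemma measurable_halfspace D (phi : T -> 'I_D -> R) theta :
  (forall i, measurable_fun setT (phi^~ i)) ->
  measurable [set t | 0 <= \sum_i theta i * phi t i].
Proof.
move=> /(@measurable_affine_halfspace D phi theta 0).
by under eq_fun do rewrite addr0.
Qed.

(** Measurability of the exceptional event is the reason to pass through countably many
    integer halfspaces. *)
Lemma halfspace_deviation D (phi : T -> 'I_D -> R) (x : R) :
  (forall i, measurable_fun setT (phi^~ i)) -> (0 < n)%N -> 0 <= x ->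
  exists E : set Omega, [/\ measurable E, (Pr E <= (4 * expR (- x))%:E)%E &
    forall w, ~ E w -> forall theta : 'I_D -> R,
      `|count Z [set t | 0 <= \sum_i theta i * phi t i] w
        - n%:R * fine (P [set t | 0 <= \sum_i theta i * phi t i])|
        <= 4 * Num.sqrt (288 * n%:R * (x + 7 * D.+1%:R))].
Proof.
move=> mphi n0 x0; set r := 4 * Num.sqrt _.
pose idx (N : nat) : {ffun 'I_D -> int} * nat := odflt ([ffun=> 0], 0%N) (unpickle N).
pose H (a : {ffun 'I_D -> int} * nat) :=
  [set t | 0 <= \sum_i (a.1 i)%:~R * phi t i + a.2%:R].
have mH a : measurable (H a) by exact: measurable_affine_halfspace.
have [mE PE] := @countable_family_deviation _ T R P _ Omega Pr n Z ZP
  (fun N => H (idx N)) D.+1 x (fun N => mH _) n0 isT x0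
  (@affine_vc T nat D phi (fun N i => ((idx N).1 i)%:~R) (fun N => (idx N).2%:R)).
eexists; split; [exact: mE|exact: PE|] => w nE theta.
set A := [set t | 0 <= \sum_i theta i * phi t i].
have small a : `|count Z (H a) w - n%:R * fine (P (H a))| <= r.
  rewrite leNgt; apply/negP => ha; apply: nE; exists (pickle a) => //.
  by rewrite /deviates /= /idx pickleK.
pose a k : {ffun 'I_D -> int} * nat := ([ffun i => Num.floor (k%:R ^+ 2 * theta i)], k).
have HA t : \forall k \near \oo, H (a k) t <-> A t.
  have := halfspace_approx theta (phi t); apply: filterS => k.
  by rewrite /H /A /= => <-; under eq_bigr do rewrite ffunE.
have mA : measurable A by exact: measurable_halfspace.
have cv : `|count Z A w - n%:R * fine (P (H (a k)))| @[k --> \oo] -->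
    `|count Z A w - n%:R * fine (P A)|.
  apply: cvg_norm; apply: cvgB; first exact: cvg_cst.
  apply: cvgM; first exact: cvg_cst.
  exact: cvg_probability.
rewrite -(cvg_lim _ cv)//; apply: limr_le; first by apply/cvg_ex; eexists; exact: cv.
have cnt : \forall k \near \oo, count Z (H (a k)) w = count Z A w.
  have : \forall k \near \oo, forall i, H (a k) (Z i w) <-> A (Z i w).
    by apply: filter_forall => i; exact: HA.
  apply: filterS => k Hk; apply: eq_bigr => i _; rewrite !indicE.
  have [h1 h2] := Hk i; congr ((nat_of_bool _)%:R).
  by apply/idP/idP; rewrite !inE.
by move: cnt; apply: filterS => k <-; exact: small.
Qed.

End halfspaces.

(** * Integrals against a normal distribution *)

Section normal_density.
Context (R : realType) (m s : R).
Local Open Scope ereal_scope.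
Local Open Scope classical_set_scope.
Local Notation leb := (@lebesgue_measure R).
Local Notation nu := (normal_prob m s).
Local Notation pdf := (normal_pdf m s).
Implicit Types f : measurableTypeR R -> \bar R.

Let mpdf : measurable_fun setT (fun x : measurableTypeR R => (pdf x)%:E).
Proof. by apply/measurable_EFinP; exact: measurable_normal_pdf. Qed.

Let integral_normal_indic E : measurable E ->
  \int[nu]_x (\1_E x)%:E = \int[leb]_x ((\1_E x)%:E * (pdf x)%:E).
Proof.
move=> mE; rewrite integral_indic//= setIT /normal_prob integral_mkcond/=.
apply: eq_integral => x _; rewrite patchE indicE.
by case: (x \in E); rewrite ?mul1e ?mul0e.
Qed.

Import HBNNSimple.

Let integral_normal_nnsfun (f : {nnsfun measurableTypeR R >-> R}) :
  \int[nu]_x (f x)%:E = \int[leb]_x ((f x)%:E * (pdf x)%:E).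
Proof.
under [LHS]eq_integral do rewrite fimfunE -fsumEFin//.
rewrite [LHS]ge0_integral_fsum//; last 2 first.
  - by move=> r; exact/measurable_EFinP/measurableT_comp.
  - by move=> n x _; rewrite EFinM nnfun_muleindic_ge0.
under [RHS]eq_integral.
  move=> x xD; rewrite fimfunE -fsumEFin// muleC ge0_mule_fsumr; last first.
    by move=> r; rewrite EFinM nnfun_muleindic_ge0.
  over.
rewrite [RHS]ge0_integral_fsum//; last 2 first.
  - move=> r; apply: emeasurable_funM => //.
    by apply/measurable_EFinP; do 2 apply/measurableT_comp => //.
  - move=> n x _; apply: mule_ge0; first by rewrite lee_fin normal_pdf_ge0.
    by rewrite EFinM nnfun_muleindic_ge0.
apply: eq_fsbigr => r /set_mem[t _ <-].
under [LHS]eq_integral do rewrite EFinM.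
have mI : measurable_fun setT (fun x => (\1_(f @^-1` [set f t]) x)%:E : \bar R).
  exact/measurable_EFinP/measurable_indic.
rewrite ge0_integralZl//; last by rewrite lee_fin.
rewrite integral_normal_indic//.
under [RHS]eq_integral do rewrite EFinM muleCA [X in _ * X]muleC.
rewrite ge0_integralZl//.
- exact: emeasurable_funM.
- by move=> x _; rewrite mule_ge0// lee_fin ?normal_pdf_ge0.
- by rewrite lee_fin.
Qed.

Lemma integral_normal_prob f : measurable_fun setT f -> (forall x, 0 <= f x) ->
  \int[nu]_x f x = \int[leb]_x (f x * (pdf x)%:E).
Proof.
move=> mf f0; pose f_ := nnsfun_approx measurableT mf.
have mf_ n : measurable_fun setT (fun x => (f_ n x)%:E).
  exact/measurable_EFinP/measurable_funTS.
transitivity (lim (\int[nu]_x (f_ n x)%:E @[n --> \oo])).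
  rewrite -monotone_convergence//=.
  - apply: eq_integral => ? /[!inE] xD; apply/esym/cvg_lim => //=.
    exact: cvg_nnsfun_approx.
  - by move=> n ? _; rewrite lee_fin.
  - by move=> ? _ ? ? mn; rewrite lee_fin; exact/lefP/nd_nnsfun_approx.
transitivity (lim (\int[leb]_x ((f_ n x)%:E * (pdf x)%:E) @[n --> \oo])).
  by apply: congr_lim; apply/funext => n; exact: integral_normal_nnsfun.
rewrite -monotone_convergence//=.
- apply: eq_integral => x /[!inE] xD; apply/cvg_lim => //=.
  apply: cvgeZr => //; exact: cvg_nnsfun_approx.
- by move=> n; exact: emeasurable_funM.
- by move=> n ? _; rewrite mule_ge0// lee_fin ?normal_pdf_ge0.
- move=> x _ ? ? mn; rewrite lee_pmul ?lee_fin ?normal_pdf_ge0//.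
  exact/lefP/nd_nnsfun_approx.
Qed.

End normal_density.

(** * The standard normal distribution function *)

Section standard_normal.
Context (R : realType).
Local Open Scope ring_scope.
Local Open Scope classical_set_scope.
Implicit Types (x y t s : R) (A : set (measurableTypeR R)).
Local Notation phi := (normal_pdf 0 1 : R -> R).

Lemma normal_peak_le s : 0 < s -> normal_peak s <= s^-1.
Proof.
move=> s0; rewrite /normal_peak lef_pV2 ?posrE// ?sqrtr_gt0; last first.
  by rewrite pmulrn_lgt0// mulr_gt0 ?pi_gt0// exprn_gt0.
rewrite -[leLHS](ger0_norm (ltW s0)) -sqrtr_sqr ler_wsqrtr//.
by have := pi_ge2 R; have := sqr_ge0 s; rewrite -mulr_natr; nra.
Qed.

Lemma normal_prob_fin s m A : measurable A -> normal_prob m s A \is a fin_num.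
Proof. by move=> mA; exact: fin_num_measure. Qed.

Lemma normal_prob_itv_le m s x y : 0 < s -> x <= y ->
  (normal_prob m s `[x, y] <= ((y - x) / s)%:E)%E.
Proof.
move=> s0 xy; rewrite /normal_prob.
apply: (@le_trans _ _ (\int[lebesgue_measure]_(z in `[x, y]) (s^-1)%:E)%E).
  apply: ge0_le_integral => //=.
  - by move=> z _; rewrite lee_fin normal_pdf_ge0.
  - by apply/measurable_EFinP/measurable_funTS; exact: measurable_normal_pdf.
  - move=> z _; rewrite lee_fin (le_trans (normal_pdf_ub _ _ _))//.
      by rewrite gt_eqF.
    exact: normal_peak_le.
rewrite integral_cst//= lebesgue_measure_itv/= lte_fin.
case: ltP => xy'; first by rewrite -EFinB -EFinM lee_fin mulrC.
by rewrite mule0 lee_fin divr_ge0 ?subr_ge0// ltW.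
Qed.

Lemma PhiE x : (Phi x)%:E = normal_prob 0 1 `]-oo, x].
Proof. by rewrite /Phi fineK// normal_prob_fin. Qed.

Lemma Phi_ge0 x : 0 <= Phi x.
Proof. by rewrite -lee_fin PhiE measure_ge0. Qed.

Lemma Phi_le1 x : Phi x <= 1.
Proof. by rewrite -lee_fin PhiE probability_le1. Qed.

Lemma Phi_incr x y : x <= y -> Phi y = Phi x + fine (normal_prob 0 1 `]x, y]).
Proof.
move=> xy; apply: EFin_inj; rewrite EFinD !PhiE fineK ?normal_prob_fin//.
rewrite -(@measureU _ _ _ (normal_prob 0 1))//.
  congr (normal_prob 0 1 _); apply/seteqP; split => z /=; rewrite !in_itv /=.
    by move=> zy; have [|] := leP z x; [left|right].
  by case=> [/le_trans|/andP[]//]; exact.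
apply/seteqP; split => // z [] /=; rewrite !in_itv /= => zx /andP[xz _].
by move: xz; rewrite ltNge zx.
Qed.

Lemma Phi_nondecreasing x y : x <= y -> Phi x <= Phi y.
Proof.
move=> /Phi_incr ->; rewrite lerDl fine_ge0//.
Qed.

Lemma Phi_lip x y : x <= y -> Phi y <= Phi x + (y - x).
Proof.
move=> xy; rewrite (Phi_incr xy) lerD2l -lee_fin fineK ?normal_prob_fin//.
apply: (@le_trans _ _ (normal_prob 0 1 `[x, y])).
  by apply: le_measure; rewrite ?inE//; apply: subset_itvr; rewrite bnd_simp.
by have := normal_prob_itv_le 0 ltr01 xy; rewrite divr1.
Qed.

Lemma measurable_Phi : measurable_fun setT (@Phi R).
Proof. by apply: nondecreasing_measurable => // x y; exact: Phi_nondecreasing. Qed.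

Lemma phi_even x : phi (- x) = phi x.
Proof. by rewrite normal_pdfE ?oner_neq0// /normal_fun !subr0 sqrrN. Qed.

Lemma phi_ge x t : `|x| <= t -> phi t <= phi x.
Proof.
move=> xt; rewrite normal_pdfE ?oner_neq0// ler_wpM2l ?normal_peak_ge0//.
rewrite /normal_fun !subr0 ler_expR !mulNr lerN2.
rewrite ler_wpM2r ?invr_ge0 ?mulrn_wge0 ?sqr_ge0// -[x ^+ 2]real_normK ?num_real//.
by rewrite lerXn2r ?nnegrE// (le_trans _ xt).
Qed.

Lemma phi_gt0 x : 0 < phi x.
Proof.
by rewrite normal_pdfE ?oner_neq0// mulr_gt0 ?expR_gt0// normal_peak_gt0.
Qed.

Lemma Phi_grow x t : 0 <= x -> x <= t -> Phi 0 + x * phi t <= Phi x.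
Proof.
move=> x0 xt; rewrite (Phi_incr x0) lerD2l -lee_fin fineK ?normal_prob_fin//.
rewrite /normal_prob.
apply: (@le_trans _ _ (\int[lebesgue_measure]_(z in `]0%R, x]) (phi t)%:E)%E); last first.
  apply: ge0_le_integral => //=.
  - by move=> z _; rewrite lee_fin ltW// phi_gt0.
  - by apply/measurable_EFinP/measurable_funTS; exact: measurable_normal_pdf.
  - move=> z; rewrite in_itv /= => /andP[z0 zx]; rewrite lee_fin phi_ge//.
    by rewrite ger0_norm ?(ltW z0)// (le_trans zx).
rewrite integral_cst//= lebesgue_measure_itv/= lte_fin.
have [_|x0'] := ltP 0 x; first by rewrite -EFinB -EFinM lee_fin subr0 mulrC.
by rewrite mule0 lee_fin mulr_le0_ge0// ltW// phi_gt0.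
Qed.

Lemma normal_prob_ge x : normal_prob 0 1 `[x, +oo[ = (Phi (- x))%:E.
Proof.
rewrite PhiE /normal_prob ge0_integration_by_substitutionNy.
- by apply: eq_integral => z _ /=; rewrite phi_even.
- apply: continuous_subspaceT; apply: continuous_normal_pdf.
  by rewrite oner_neq0.
- by move=> z _; exact: normal_pdf_ge0.
Qed.

Lemma PhiN x : Phi (- x) = 1 - Phi x.
Proof.
apply: EFin_inj; rewrite -normal_prob_ge EFinB PhiE.
rewrite /normal_prob -(integral_itv_obnd_cbnd (r := x)); last first.
  by apply/measurable_EFinP/measurable_funTS; exact: measurable_normal_pdf.
rewrite -/(normal_prob 0 1 `]x, +oo[) -/(normal_prob 0 1 `]-oo, x]).
rewrite -(probability_setC (normal_prob 0 1))//; congr (normal_prob 0 1 _).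
by rewrite setCitvl.
Qed.

Lemma Phi0 : Phi 0 = 2^-1 :> R.
Proof. by have := PhiN 0; rewrite oppr0; lra. Qed.

Lemma Phi_to1 (c : R) : c < 1 -> exists2 x, 0 < x & c < Phi x.
Proof.
move=> c1.
have cv : (normal_prob 0 1 \o (fun n : nat => `]-oo, (n%:R : R)])) n @[n --> \oo]
    --> normal_prob 0 1 (\bigcup_n `]-oo, (n%:R : R)]).
  apply: nondecreasing_cvg_mu => //; first exact: bigcupT_measurable.
  move=> k l kl; apply/subsetPset => z /=; rewrite !in_itv /= => /le_trans; apply.
  by rewrite ler_nat.
have U : \bigcup_n `]-oo, (n%:R : R)] = setT.
  apply/seteqP; split => // z _; exists (Num.truncn `|z|).+1 => //=.
  rewrite in_itv /=; apply: (le_trans (ler_norm z)); exact/ltW/truncnS_gt.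
rewrite U probability_setT in cv.
have /fine_cvg cv' := cv.
have : \forall n \near \oo, c < Phi (n%:R : R) by apply: (cvgr_gt _ cv').
move=> [N _ /(_ N.+1)] /=; rewrite leqnSn => /(_ isT) h.
by exists N.+1%:R.
Qed.

(** Stated for an upper half-line, which is the shape of a section of a depth region. *)
Lemma normal_prob_affine m s x : 0 < s ->
  normal_prob m s `[m + x, +oo[ = (Phi (- (x / s)))%:E.
Proof.
move=> s0; rewrite -normal_prob_ge /normal_prob.
pose F z := m + s * z : R.
have DF : F^`() = cst s.
  apply/funext => z; rewrite derive1E /F deriveD// derive_cst add0r.
  by rewrite deriveZ//= derive_id /GRing.scale /= mulr1.
have FE : m + x = F (x / s) by rewrite /F mulrCA divff ?mulr1// gt_eqF.
rewrite {1}FE increasing_ge0_integration_by_substitutiony.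
- apply: eq_integral => z _; rewrite fctE DF /= /cst; congr (_%:E).
  rewrite !normal_pdfE ?oner_neq0 ?gt_eqF// /normal_fun /F /normal_peak.
  rewrite addrAC subrr add0r subr0 mulrAC; congr (_ * _).
    rewrite expr1n mul1r -[s ^+ 2 * pi *+ 2]mulrnAr sqrtrM ?sqr_ge0// sqrtr_sqr.
    by rewrite gtr0_norm// invfM mulrAC mulVf ?mul1r// gt_eqF.
  by congr expR; field; rewrite gt_eqF.
- by move=> a b _ _ ab; rewrite ltrD2l ltr_pM2l.
- by rewrite DF => ? _; exact: cvg_cst.
- by rewrite DF; exact: is_cvg_cst.
- by rewrite DF; exact: is_cvg_cst.
- split => //; apply: cvg_at_right_filter.
  by apply: cvgD; [exact: cvg_cst|apply: cvgM; [exact: cvg_cst|exact: cvg_id]].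
- apply/cvgryPge => a; have := nbhs_pinfty_ge (num_real (s^-1 * (a - m))).
  by apply: filterS => z; rewrite /F -lerBlDl -ler_pdivrMl.
- by apply: continuous_subspaceT; apply: continuous_normal_pdf; rewrite gt_eqF.
- by move=> z _; exact: normal_pdf_ge0.
Qed.

End standard_normal.

(** * Second moments and the function g *)

Lemma integral_probability_cst d (T : measurableType d) (R : realType)
    (P : probability T R) (c : R) : (\int[P]_x c%:E = c%:E)%E.
Proof.
rewrite integral_cst; last exact: measurableT.
by rewrite -[RHS]mule1; congr (_ * _)%E; exact: probability_setT.
Qed.

Section gaussian_moments.
Context (R : realType).
Local Open Scope ring_scope.
Local Open Scope classical_set_scope.
Implicit Types (x y t s : R).

(** Doubling the standard deviation absorbs the factor [x^2], so the second moment is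
    bounded by the total mass of a wider normal law. *)
Lemma sqr_normal_pdf_le s x : 0 < s ->
  x ^+ 2 * normal_pdf 0 s x <= 8 * s ^+ 2 * normal_pdf 0 (2 * s) x.
Proof.
move=> s0; have s20 : 0 < 2 * s by lra.
rewrite !normal_pdfE ?gt_eqF// /normal_peak.
have -> : (2 * s) ^+ 2 * pi *+ 2 = 2 ^+ 2 * (s ^+ 2 * pi *+ 2) :> R by ring.
rewrite sqrtrM ?sqr_ge0// sqrtr_sqr gtr0_norm// invfM.
set c := (Num.sqrt _)^-1; have c0 : 0 <= c by rewrite invr_ge0.
have -> : x ^+ 2 * (c * normal_fun 0 s x) = c * (x ^+ 2 * normal_fun 0 s x) by ring.
have -> : 8 * s ^+ 2 * (2^-1 * c * normal_fun 0 (2 * s) x) =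
  c * (4 * s ^+ 2 * normal_fun 0 (2 * s) x) by field.
rewrite ler_wpM2l// /normal_fun !subr0.
pose u := x ^+ 2 / (4 * s ^+ 2).
have u0 : 0 <= u by rewrite divr_ge0 ?sqr_ge0// mulr_ge0 ?sqr_ge0.
have -> : - x ^+ 2 / (s ^+ 2 *+ 2) = - (2 * u).
  by rewrite /u; field; rewrite gt_eqF.
have -> : - x ^+ 2 / ((2 * s) ^+ 2 *+ 2) = - (2 * u) + 3 / 2 * u.
  by rewrite /u; field; rewrite gt_eqF.
have -> : x ^+ 2 = 4 * s ^+ 2 * u by rewrite /u; field; rewrite gt_eqF.
rewrite expRD -[leLHS]mulrA [u * _]mulrC ler_wpM2l ?mulr_ge0 ?(ltW s0)//.
rewrite ler_wpM2l ?expR_ge0//.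
by have := expR_ge1Dx (3 / 2 * u); lra.
Qed.

Lemma integral_normal_sqr_le s : 0 < s ->
  (\int[normal_prob 0 s]_x ((x ^+ 2)%:E) <= (8 * s ^+ 2)%:E)%E.
Proof.
move=> s0; rewrite integral_normal_prob; last 2 first.
- by apply/measurable_EFinP; exact: exprn_measurable.
- by move=> x; rewrite lee_fin sqr_ge0.
apply: (@le_trans _ _
  (\int[lebesgue_measure]_x ((8 * s ^+ 2)%:E * (normal_pdf 0 (2 * s) x)%:E))%E).
  apply: ge0_le_integral => //.
  - by move=> x _; rewrite mule_ge0 ?lee_fin ?sqr_ge0 ?normal_pdf_ge0.
  - apply: emeasurable_funM.
      by apply/measurable_EFinP; exact: exprn_measurable.
    by apply/measurable_EFinP; exact: measurable_normal_pdf.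
  - apply: emeasurable_funM => //.
    by apply/measurable_EFinP; exact: measurable_normal_pdf.
  - by move=> x _; rewrite -!EFinM lee_fin sqr_normal_pdf_le.
rewrite ge0_integralZl//.
- by rewrite integral_normal_pdf mule1.
- by apply/measurable_EFinP; exact: measurable_normal_pdf.
- by move=> x _; rewrite lee_fin normal_pdf_ge0.
- by rewrite lee_fin mulr_ge0 ?sqr_ge0.
Qed.

Let nu := normal_prob (0 : R) 1.
Let G t : \bar R := (\int[nu]_z (Phi (t * `|z|))%:E)%E.

Let mabs t : measurable_fun setT (fun z : measurableTypeR R => t * `|z|).
Proof. by apply: measurable_funM => //; exact: normr_measurable. Qed.

Let mPhit t : measurable_fun setT (fun z : measurableTypeR R => (Phi (t * `|z|))%:E).
Proof.
apply/measurable_EFinP.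
exact: (measurableT_comp (@measurable_Phi R) (mabs t)).
Qed.

Let G_ge0 t : (0 <= G t)%E.
Proof. by apply: integral_ge0 => z _; rewrite lee_fin Phi_ge0. Qed.

Let int_cst (c : R) : (\int[nu]_z c%:E = c%:E)%E.
Proof. exact: integral_probability_cst. Qed.

Let G_le1 t : (G t <= 1)%E.
Proof.
rewrite -[leRHS](int_cst 1); apply: ge0_le_integral => //.
- by move=> z _; rewrite lee_fin Phi_ge0.
- by move=> z _; rewrite lee_fin Phi_le1.
Qed.

Let gE t : (g t)%:E = G t.
Proof.
rewrite /g /Rintegral fineK//.
by rewrite ge0_fin_numE ?G_ge0// (le_lt_trans (G_le1 t))// ltry.
Qed.

Lemma g_at0 : g 0 = 2^-1 :> R.
Proof.
apply: EFin_inj; rewrite gE /G -[RHS]int_cst.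
by apply: eq_integral => z _; rewrite mul0r Phi0.
Qed.

Lemma g_nondecreasing t u : t <= u -> g t <= g u.
Proof.
move=> tu; suff : (G t <= G u)%E by rewrite -(gE t) -(gE u) lee_fin.
apply: ge0_le_integral => //.
- by move=> z _; rewrite lee_fin Phi_ge0.
- by move=> z _; rewrite lee_fin Phi_nondecreasing// ler_wpM2r.
Qed.

Lemma g_lip t u : t <= u -> g u <= g t + 9 * (u - t).
Proof.
move=> tu; suff : (G u <= G t + (9 * (u - t))%:E)%E.
  by rewrite -(gE t) -(gE u) -EFinD lee_fin.
have ut0 : 0 <= u - t by rewrite subr_ge0.
have mz : measurable_fun setT (fun z : measurableTypeR R => ((1 + z ^+ 2)%:E)).
  apply/measurable_EFinP; apply: measurable_funD => //; exact: exprn_measurable.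
apply: (@le_trans _ _
  (\int[nu]_z ((Phi (t * `|z|))%:E + (u - t)%:E * (1 + z ^+ 2)%:E))%E).
  apply: ge0_le_integral => //.
  - by move=> z _; rewrite lee_fin Phi_ge0.
  - by apply: emeasurable_funD => //; apply: emeasurable_funM.
  - move=> z _; rewrite -EFinM -EFinD lee_fin.
    apply: (le_trans (Phi_lip (ler_wpM2r (normr_ge0 z) tu))).
    rewrite -mulrBl lerD2l ler_wpM2l// -real_normK ?num_real//.
    by have := sqr_ge0 (`|z| - 1); have := sqr_ge0 `|z|; nra.
rewrite ge0_integralD//; last 3 first.
- by move=> z _; rewrite lee_fin Phi_ge0.
- by move=> z _; rewrite -EFinM lee_fin mulr_ge0// addr_ge0// sqr_ge0.
- exact: emeasurable_funM.
rewrite leeD2l// ge0_integralZl//; last first.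
  by move=> z _; rewrite lee_fin addr_ge0// sqr_ge0.
rewrite [leRHS]EFinM muleC lee_wpmul2r ?lee_fin//.
under eq_integral do rewrite EFinD.
rewrite ge0_integralD//; last 2 first.
- by move=> z _; rewrite lee_fin sqr_ge0.
- by apply/measurable_EFinP; exact: exprn_measurable.
rewrite int_cst (_ : 9 = 1 + 8 * 1 ^+ 2 :> R); last by ring.
by rewrite EFinD leeD2l// integral_normal_sqr_le.
Qed.

(** Outside of the small ball [`|z| <= k] the integrand is at least [Phi x] when
    [t = x / k]. *)
Lemma g_to1 (c : R) : c < 1 -> exists2 t, 0 <= t & c < g t.
Proof.
move=> c1; pose k := (1 - c) / 8.
have [x x0 cx] : exists2 x, 0 < x & (1 + c) / 2 < Phi x by apply: Phi_to1; lra.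
have k0 : 0 < k by rewrite /k; lra.
exists (x / k); first by rewrite divr_ge0// ltW.
have : (Phi x <= g (x / k) + 2 * k).
  rewrite -lee_fin EFinD gE -[leLHS]int_cst.
  apply: (@le_trans _ _ (\int[nu]_z ((Phi (x / k * `|z|))%:E + (\1_`[- k, k] z)%:E))%E).
    apply: ge0_le_integral => //.
    - by move=> z _; rewrite lee_fin Phi_ge0.
    - apply: emeasurable_funD => //; apply/measurable_EFinP.
      exact: measurable_indic.
    - move=> z _; rewrite -EFinD lee_fin indicE.
      have [zk|zk] := leP `|z| k.
        rewrite mem_set ?(le_trans (Phi_le1 _)) ?lerDr ?Phi_ge0//=.
        by rewrite in_itv /= -ler_norml.
      apply: le_trans (_ : Phi (x / k * `|z|) <= _); last by rewrite lerDl.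
      apply: Phi_nondecreasing.
      by rewrite -mulrA mulrC ler_peMl ?(ltW x0)// mulrC ler_pdivlMr// mul1r ltW.
  rewrite ge0_integralD//; last 2 first.
  - by move=> z _; rewrite lee_fin Phi_ge0.
  - by apply/measurable_EFinP; exact: measurable_indic.
  rewrite leeD2l// integral_indic// setIT.
  have := @normal_prob_itv_le R 0 1 (- k) k ltr01 _.
  have kk : - k <= k by lra.
  move=> /(_ kk) /le_trans; apply; rewrite lee_fin divr1; lra.
by rewrite /k; lra.
Qed.

(** The maximum with 0 extends [g] from the half-line, where it is Lipschitz, to a function
    continuous on the whole line, to which the intermediate value theorem applies. *)
Lemma g_max_continuous : continuous (fun t => g (Num.max t 0)).
Proof.
have lip t u : u <= t -> `|g (Num.max t 0) - g (Num.max u 0)| <= 9 * (t - u).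
  move=> ut; have mm : Num.max u 0 <= Num.max t 0 by rewrite ge_max !le_max ut lexx !orbT.
  have h : Num.max t 0 - Num.max u 0 <= t - u.
    by rewrite /Num.max; case: ltP => ?; case: ltP => ?; lra.
  rewrite ger0_norm; last by rewrite subr_ge0; exact: g_nondecreasing.
  by rewrite lerBlDl (le_trans (g_lip mm))// lerD2l ler_wpM2l.
move=> t; apply/(@cvgrPdist_lt _ R) => e e0.
have e9 : 0 < e / 9 by lra.
have : \forall u \near t, `|t - u| < e / 9.
  by apply: (@cvgr_dist_lt _ R _ _ _ id t cvg_id).
apply: filterS => u; rewrite ltr_distlC => /andP[h1 h2].
have [ut|/ltW tu] := leP u t; first by have := lip t u ut; lra.
by have := lip u t tu; rewrite [X in X <= _]distrC; lra.
Qed.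

Lemma g_ginv (v : R) : 2^-1 <= v -> v < 1 -> 0 <= ginv v /\ g (ginv v) = v.
Proof.
move=> v2 v1.
have gv : (@g R @` [set t | 0 <= t]) v.
  have [t t0 tv] := g_to1 v1.
  pose f (u : R) := g (Num.max u 0).
  have fE u : 0 <= u -> f u = g u by move=> u0; rewrite /f max_l.
  have mm : Num.min (f 0) (f t) <= v <= Num.max (f 0) (f t).
    by rewrite (fE 0 (lexx _)) (fE t t0) g_at0 ge_min v2 /= le_max (ltW tv) orbT.
  have [c] := IVT t0 (continuous_subspaceT g_max_continuous) mm.
  rewrite in_itv /= => /andP[c0 _]; rewrite -/(f c) (fE c c0) => <-.
  by exists c.
split; last by apply: pinvK; rewrite inE.
have := @surjpinv_image_sub _ _ (fun=> 0) [set t : R | 0 <= t] _ (@g R)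
  (fun x Bx => Bx : (@g R @` _) x).
by move=> /(_ (ginv v)); apply; exists v.
Qed.

(** By definition [g (bMR2 eps)] exceeds [1/2] by [eps / (1 - eps)], and [g] is Lipschitz
    with [g 0 = 1/2]. *)
Lemma bMR2_ge (eps : R) : 0 <= eps -> eps < 3^-1 ->
  0 <= bMR2 eps /\ eps / (1 - eps) <= 9 * bMR2 eps.
Proof.
move=> e0 e3.
have E : (1 + eps) / (2 * (1 - eps)) = 2^-1 + eps / (1 - eps).
  by field; rewrite gt_eqF; lra.
have h0 : 0 <= eps / (1 - eps) by rewrite divr_ge0//; lra.
have h1 : eps / (1 - eps) < 2^-1 by rewrite ltr_pdivrMr; lra.
have [b0 gb] : 0 <= bMR2 eps /\ g (bMR2 eps) = 2^-1 + eps / (1 - eps).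
  by rewrite /bMR2 E; apply: g_ginv; lra.
split => //.
by have := g_lip b0; rewrite gb g_at0 subr0; lra.
Qed.

End gaussian_moments.

(** * Mixtures *)

Section measurable_entries.
Local Open Scope ring_scope.
Local Open Scope classical_set_scope.
Context (R : realType).

Lemma measurable_entry m n (i : 'I_m) (j : 'I_n) :
  measurable_fun setT (fun M : 'M[R]_(m, n) => M i j).
Proof.
move=> _ A mA; rewrite setTI; apply: sub_sigma_algebra.
by exists (i, j) => //=; exists A => //; rewrite setTI.
Qed.

Lemma measurable_mulmx_entry m n k d (T : measurableType d)
    (A : 'M[R]_(m, n)) (f : T -> 'M[R]_(n, k)) i j :
  (forall l, measurable_fun setT (fun t => f t l j)) ->
  measurable_fun setT (fun t => (A *m f t) i j).
Proof.
move=> mf; under eq_fun do rewrite mxE.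
by apply: measurable_sum => l; apply: measurable_funM.
Qed.

End measurable_entries.

Section mixture.
Local Open Scope ereal_scope.
Local Open Scope classical_set_scope.
Context d1 d2 (X : measurableType d1) (Y : measurableType d2) (R : realType).
Context (N : probability X R) (K : R.-pker X ~> Y).

Lemma measurable_section (S : set (Y * X)) x :
  measurable S -> measurable [set y | S (y, x)].
Proof.
move=> mS; have := measurable_ysection x mS.
by congr measurable; rewrite ysectionE.
Qed.

Lemma measurable_kernel_section (S : set (Y * X)) : measurable S ->
  measurable_fun setT (fun x => K x [set y | S (y, x)]).
Proof.
move=> mS; pose S' := [set xy : X * Y | S (xy.2, xy.1)].
have mS' : measurable S'.
  rewrite -[X in measurable X]setTI.
  by apply: (@measurable_swap _ _ X Y) => //.
have := @measurable_fun_xsection_finite_kernel _ _ X Y R K S' (mem_set mS').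
by congr measurable_fun; apply/funext => x; congr (K x _); rewrite xsectionE.
Qed.

Let mix (S : set (Y * X)) := \int[N]_x K x [set y | S (y, x)].

Let mix0 : mix set0 = 0.
Proof. by rewrite /mix; apply: integral0_eq => x _; exact: measure0. Qed.

Let mix_ge0 S : 0 <= mix S.
Proof. by apply: integral_ge0 => x _; exact: measure_ge0. Qed.

Let mix_sigma_additive : semi_sigma_additive mix.
Proof.
move=> F mF tF mUF.
have -> : mix (\bigcup_n F n) = \int[N]_x \sum_(n <oo) K x [set y | F n (y, x)].
  apply: eq_integral => x _.
  have -> : [set y | (\bigcup_n F n) (y, x)] = \bigcup_n [set y | F n (y, x)].
    by apply/seteqP; split => y [n _ ?]; exists n.
  apply/esym/cvg_lim => //; apply: measure_semi_sigma_additive.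
  - by move=> n; exact: measurable_section.
  - apply/trivIsetP => i j _ _ ij; apply/seteqP; split => // y [yi yj].
    have /trivIsetP/(_ i j I I ij) E := tF.
    by have : (F i `&` F j) (y, x) by []; rewrite E.
  - by apply: bigcupT_measurable => n; exact: measurable_section.
rewrite integral_nneseries//; last by move=> n; exact: measurable_kernel_section.
by apply: is_cvg_nneseries => n _ _; exact: mix_ge0.
Qed.

HB.instance Definition _ := isMeasure.Build _ _ _ mix mix0 mix_ge0 mix_sigma_additive.

(** A regression law is only specified on rectangles; they generate the product
    sigma-algebra and are stable under intersections. *)
Lemma mixture_unique (H : probability (Y * X)%type R) :
  (forall A C, measurable A -> measurable C -> H (A `*` C) = \int[N]_(x in C) K x A) ->
  forall S, measurable S -> H S = \int[N]_x K x [set y | S (y, x)].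
Proof.
move=> Hrect S mS.
apply: (@measure_unique _ R (Y * X)%type
  [set A `*` C | A in measurable & C in measurable] (fun=> setT) _ _ _ _ H mix) => //.
- exact: measurable_prod_measurableType.
- move=> _ _ [A mA [C mC <-]] [A' mA' [C' mC' <-]].
  exists (A `&` A'); first exact: measurableI.
  by exists (C `&` C'); [exact: measurableI|rewrite setXI].
- by move=> _; exists setT => //; exists setT => //; rewrite setXTT.
- by apply/seteqP; split => // x _; exists 0%N.
- move=> _ [A mA [C mC <-]]; apply: (eq_trans (Hrect A C mA mC)).
  rewrite integral_mkcond.
  apply: eq_integral => x _; rewrite patchE.
  case: ifPn => [/set_mem xC|/negP xC].
    by congr (K x _); apply/seteqP; split => y // [].
  rewrite (_ : [set y | _] = set0) ?measure0//.
  by apply/seteqP; split => y // [_ /= Cx]; apply: xC; rewrite inE.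
- by move=> _; apply: (le_lt_trans (probability_le1 H measurableT)); rewrite ltry.
Qed.

End mixture.

(** * Gaussian vectors *)

Section gaussian_vector.
Local Open Scope ring_scope.
Local Open Scope classical_set_scope.
Context (R : realType) (p : nat) (Sigma : 'M[R]_p).
Context (N : probability 'cV[R]_p R).
Hypotheses (NS : is_mvnormal 0 Sigma N) (covS : is_covariance Sigma).
Implicit Types (u : 'cV[R]_p) (k c : R).

Local Notation lin u x := ((u^T *m x)%R (0%R : 'I_1) (0%R : 'I_1)).

Definition qform u : R := (u^T *m Sigma *m u) 0 0.

Lemma qform_ge0 u : 0 <= qform u.
Proof. exact: covS.2. Qed.

Lemma measurable_linear u : measurable_fun setT (fun x : 'cV[R]_p => lin u x).
Proof. by apply: measurable_mulmx_entry => l; exact: measurable_entry. Qed.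

Lemma linear_law u (A : set R) : measurable A ->
  N [set x | A (lin u x)] = normal_law 0 (qform u) A.
Proof. by move=> mA; rewrite NS// mulmx0 mxE. Qed.

Lemma linear_small_ball u c : 0 < qform u -> 0 <= c ->
  (N [set x : 'cV[R]_p | (`|lin u x| <= c)%R]
    <= (2 * c / Num.sqrt (qform u))%:E)%E.
Proof.
move=> u0 c0.
have -> : [set x : 'cV[R]_p | `|lin u x| <= c] =
    [set x : 'cV[R]_p | `[- c, c] (lin u x)].
  by apply/seteqP; split => x /=; rewrite in_itv /= ler_norml.
rewrite linear_law// /normal_law gt_eqF//.
apply: le_trans (normal_prob_itv_le _ _ _) _; first by rewrite sqrtr_gt0.
  by lra.
by have -> : c - - c = 2 * c by ring.
Qed.

Lemma integral_linear_sqr u :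
  (\int[N]_x ((lin u x) ^+ 2)%:E <= (8 * qform u)%:E)%E.
Proof.
pose phi (x : 'cV[R]_p) : measurableTypeR R := lin u x.
have mphi : measurable_fun setT phi := measurable_linear u.
have msq : measurable_fun setT (fun z : measurableTypeR R => (z ^+ 2)%:E).
  by apply/measurable_EFinP; exact: exprn_measurable.
have := @ge0_integral_pushforward _ _ _ _ R phi mphi N setT
  (fun z => (z ^+ 2)%:E) measurableT msq.
rewrite preimage_setT => H.
rewrite -[leLHS]H; last by move=> z _; rewrite lee_fin sqr_ge0.
have [q0|q0] := eqVneq (qform u) 0.
  rewrite (eq_measure_integral (\d_(0 : measurableTypeR R))); last first.
    move=> A mA _; rewrite /pushforward.
    by have := linear_law u mA; rewrite /normal_law q0 eqxx.
  by rewrite integral_dirac// diracT mul1e expr0n q0 mulr0.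
have qp : 0 < qform u by rewrite lt_neqAle eq_sym q0 qform_ge0.
rewrite (eq_measure_integral (normal_prob 0 (Num.sqrt (qform u)))); last first.
  move=> A mA _; rewrite /pushforward.
  by have := linear_law u mA; rewrite /normal_law (negbTE q0).
apply: (le_trans (integral_normal_sqr_le _)); first by rewrite sqrtr_gt0.
by rewrite sqr_sqrtr// qform_ge0.
Qed.

Definition nrm2 n (v : 'cV[R]_n) : R := \sum_j (v j 0) ^+ 2.

Lemma nrm2_ge0 n (v : 'cV[R]_n) : 0 <= nrm2 v.
Proof. by apply: sumr_ge0 => j _; exact: sqr_ge0. Qed.

Definition tr_qform m (W : 'M[R]_(p, m)) : R := \tr (W^T *m Sigma *m W).

Lemma mulmx_col m (W : 'M[R]_(p, m)) (x : 'cV[R]_p) j :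
  (W^T *m x) j 0 = lin (col j W) x.
Proof. by rewrite !mxE; apply: eq_bigr => i _; rewrite !mxE. Qed.

Lemma tr_qformE m (W : 'M[R]_(p, m)) : tr_qform W = \sum_j qform (col j W).
Proof.
apply: eq_bigr => j _; rewrite /qform !mxE; apply: eq_bigr => i _.
by rewrite !mxE; congr (_ * _); apply: eq_bigr => l _; rewrite !mxE.
Qed.

Lemma tr_qform_ge0 m (W : 'M[R]_(p, m)) : 0 <= tr_qform W.
Proof. by rewrite tr_qformE; apply: sumr_ge0 => j _; exact: qform_ge0. Qed.

Lemma measurable_nrm2 m (W : 'M[R]_(p, m)) :
  measurable_fun setT (fun x : 'cV[R]_p => nrm2 (W^T *m x)).
Proof.
apply: measurable_sum => j; apply: measurable_funX.
by apply: measurable_mulmx_entry => l; exact: measurable_entry.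
Qed.

Lemma integral_nrm2 m (W : 'M[R]_(p, m)) :
  (\int[N]_x (nrm2 (W^T *m x))%:E <= (8 * tr_qform W)%:E)%E.
Proof.
rewrite tr_qformE mulr_sumr -sumEFin.
under eq_integral do rewrite /nrm2 -sumEFin.
rewrite ge0_integral_sum//.
- apply: lee_sum => j _; under eq_integral do rewrite mulmx_col.
  exact: integral_linear_sqr.
- move=> j; apply/measurable_EFinP; apply: measurable_funX.
  by apply: measurable_mulmx_entry => l; exact: measurable_entry.
- by move=> j x _; rewrite lee_fin sqr_ge0.
Qed.

(** With [c_j = qform (col j W)], which sum to 1, the coordinates whose square exceeds
    [2 k^2 c_j] carry at most half of the weight when the sum of the squares is at most
    [k^2]; the constant [3/2] stands for the square root of 2. *)
Lemma nrm2_small_split m (W : 'M[R]_(p, m)) (x : 'cV[R]_p) k :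
  0 < k -> tr_qform W = 1 -> nrm2 (W^T *m x) <= k ^+ 2 ->
  2^-1 <= \sum_j qform (col j W) *
    (`|lin (col j W) x| <= 3 / 2 * k * Num.sqrt (qform (col j W)))%R%:R.
Proof.
move=> k0 W1 xk.
pose b j := `|lin (col j W) x| <= 3 / 2 * k * Num.sqrt (qform (col j W)).
have k2 : 0 < 2 * k ^+ 2 by rewrite mulr_gt0 ?exprn_gt0.
have step : 1 <= \sum_j
    (qform (col j W) * (b j)%:R + ((W^T *m x) j 0) ^+ 2 / (2 * k ^+ 2)).
  rewrite -[leLHS]W1 tr_qformE; apply: ler_sum => j _; case: (boolP (b j)) => bj.
    by rewrite mulr1 lerDl divr_ge0 ?sqr_ge0// ltW.
  rewrite mulr0 add0r ler_pdivlMr// mulmx_col -[leRHS]real_normK ?num_real//.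
  move: bj; rewrite /b -ltNge => bj.
  have s2 : Num.sqrt (qform (col j W)) ^+ 2 = qform (col j W).
    by rewrite sqr_sqrtr// qform_ge0.
  have h : (3 / 2 * k * Num.sqrt (qform (col j W))) ^+ 2 <= `|lin (col j W) x| ^+ 2.
    rewrite lerXn2r ?nnegrE ?(ltW bj)//.
    by rewrite mulr_ge0 ?sqrtr_ge0// mulr_ge0 ?(ltW k0)//; lra.
  rewrite (le_trans _ h)// !exprMn s2.
  by have := sqr_ge0 k; have := qform_ge0 (col j W); nra.
move: step; rewrite big_split /= /b.
have : \sum_j ((W^T *m x) j 0) ^+ 2 / (2 * k ^+ 2) <= 2^-1.
  by rewrite -mulr_suml ler_pdivrMr// mulrA mulVf// mul1r.
lra.
Qed.

(** The coordinates of [W^T x] may be correlated in any way: the norm is only small if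
    coordinates of total weight at least 1/2 are small, and each coordinate is small with
    probability at most a multiple of [k].  This is why the bound is free of [m]. *)
Lemma nrm2_small_ball m (W : 'M[R]_(p, m)) k : 0 < k -> tr_qform W = 1 ->
  (N [set x | (nrm2 (W^T *m x) <= k ^+ 2)%R] <= (6 * k)%:E)%E.
Proof.
move=> k0 W1; set A := [set x | _].
have mA : measurable A.
  rewrite -[X in measurable X]setTI.
  have := measurable_nrm2 W measurableT (measurable_itv `]-oo, k ^+ 2]%R).
  by congr measurable; apply/seteqP; split => x [_] /=; rewrite in_itv.
pose c j := 3 / 2 * k * Num.sqrt (qform (col j W)).
have c0 j : 0 <= c j.
  by rewrite mulr_ge0 ?sqrtr_ge0// mulr_ge0 ?(ltW k0)//; lra.
pose B j : set 'cV[R]_p := [set x | `|lin (col j W) x| <= c j].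
have mB j : measurable (B j).
  rewrite -[X in measurable X]setTI.
  have := measurable_linear (col j W) measurableT (measurable_itv `[- c j, c j]%R).
  by congr measurable; apply/seteqP; split => x; rewrite /B /= in_itv /= ler_norml // => -[].
have mI j : measurable_fun setT (fun x => (\1_(B j) x)%:E : \bar R).
  by apply/measurable_EFinP; exact: measurable_indic.
have q0 j : (0 <= (2 * qform (col j W))%:E)%E.
  by rewrite lee_fin mulr_ge0// qform_ge0.
rewrite -[X in N X]setIT -integral_indic//.
apply: (@le_trans _ _ (\int[N]_x (\sum_(j < m)
    ((2 * qform (col j W))%:E * (\1_(B j) x)%:E)))%E).
  apply: ge0_le_integral => //.
  - by apply/measurable_EFinP; exact: measurable_indic.
  - by apply: emeasurable_sum => j; exact: emeasurable_funM.
  - move=> x _; rewrite [X in (_ <= X)%E](_ : _ = (2 * \sum_(j < m)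
      qform (col j W) * \1_(B j) x)%:E); last first.
      rewrite mulr_sumr -sumEFin; apply: eq_bigr => j _.
      by rewrite mulrA EFinM.
    rewrite lee_fin indicE; case: (boolP (x \in A)) => [/set_mem xA|_] /=; last first.
      by rewrite mulr_ge0// sumr_ge0// => j _; rewrite mulr_ge0 ?qform_ge0.
    have := nrm2_small_split k0 W1 xA.
    rewrite (eq_bigr (fun j => qform (col j W) * \1_(B j) x)); first by move=> ?; lra.
    move=> j _; congr (_ * _); rewrite indicE; congr ((nat_of_bool _)%:R).
    by apply/idP/idP; rewrite inE.
rewrite ge0_integral_sum//; last 2 first.
- by move=> j; exact: emeasurable_funM.
- by move=> j x _; rewrite mule_ge0.
apply: (@le_trans _ _ (\sum_(j < m) (2 * qform (col j W) * (3 * k))%:E)%E); last first.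
  by rewrite sumEFin lee_fin -mulr_suml -mulr_sumr -tr_qformE W1; lra.
apply: lee_sum => j _; rewrite ge0_integralZl//.
rewrite integral_indic// setIT [leRHS]EFinM.
have [qj|qj] := ltP 0 (qform (col j W)); last first.
  have -> : qform (col j W) = 0 by apply/eqP; rewrite eq_le qj qform_ge0.
  by rewrite mulr0 !mul0e.
apply: lee_wpmul2l => //; apply: (le_trans (linear_small_ball qj (c0 j))).
rewrite lee_fin /c ler_pdivrMr ?sqrtr_gt0//.
by have := sqrtr_ge0 (qform (col j W)); lra.
Qed.

End gaussian_vector.

(** * Depth regions under the regression model *)

Section euclidean.
Local Open Scope ring_scope.
Context (R : realType).

Definition dot n (v w : 'cV[R]_n) : R := \sum_j v j 0 * w j 0.

Lemma dotE n (v w : 'cV[R]_n) : (v^T *m w) 0 0 = dot v w.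
Proof. by rewrite mxE; apply: eq_bigr => j _; rewrite mxE. Qed.

Lemma dotDr n (v w w' : 'cV[R]_n) : dot v (w + w') = dot v w + dot v w'.
Proof. by rewrite -!dotE mulmxDr mxE. Qed.

Lemma dotNr n (v w : 'cV[R]_n) : dot v (- w) = - dot v w.
Proof. by rewrite -!dotE mulmxN mxE. Qed.

Lemma dotZr n a (v w : 'cV[R]_n) : dot v (a *: w) = a * dot v w.
Proof. by rewrite -!dotE -scalemxAr mxE. Qed.

Lemma dot_self n (v : 'cV[R]_n) : dot v v = nrm2 v.
Proof. by apply: eq_bigr => j _; rewrite expr2. Qed.

Lemma nrm2_eq0 n (v : 'cV[R]_n) : nrm2 v = 0 -> v = 0.
Proof.
move=> /eqP; rewrite psumr_eq0 => [/allP v0|j _]; last exact: sqr_ge0.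
apply/colP => j; rewrite mxE; apply/eqP; rewrite -sqrf_eq0.
by apply: v0; rewrite mem_index_enum.
Qed.

Lemma cauchy_schwarz n (w d : 'cV[R]_n) : 0 < nrm2 w ->
  - (Num.sqrt (nrm2 w) * Num.sqrt (nrm2 d)) <= dot w d.
Proof.
move=> w0; set a := Num.sqrt (nrm2 w); set b := Num.sqrt (nrm2 d).
have a0 : 0 < a by rewrite sqrtr_gt0.
have b0 : 0 <= b by rewrite sqrtr_ge0.
have a2 : a ^+ 2 = nrm2 w by rewrite sqr_sqrtr// ltW.
have b2 : b ^+ 2 = nrm2 d by rewrite sqr_sqrtr// nrm2_ge0.
have [b00|bp] := eqVneq b 0.
  have -> : d = 0 by apply: nrm2_eq0; rewrite -b2 b00 expr0n.
  by rewrite b00 mulr0 oppr0 /dot big1// => j _; rewrite mxE mulr0.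
have {}bp : 0 < b by rewrite lt_neqAle eq_sym bp.
have : 0 <= \sum_j (a * d j 0 + b * w j 0) ^+ 2.
  by apply: sumr_ge0 => j _; exact: sqr_ge0.
have -> : \sum_j (a * d j 0 + b * w j 0) ^+ 2 =
    a ^+ 2 * nrm2 d + 2 * a * b * dot w d + b ^+ 2 * nrm2 w.
  rewrite /nrm2 /dot !mulr_sumr -!big_split /=; apply: eq_bigr => j _; ring.
rewrite -a2 -b2 => h.
have ab : 0 < 2 * a * b by rewrite !mulr_gt0.
by rewrite -(ler_pM2l ab); lra.
Qed.

End euclidean.

Section conditional.
Local Open Scope ring_scope.
Local Open Scope classical_set_scope.
Context (R : realType) (m : nat) (sigma : R) (mu : 'cV[R]_m).
Context (N : {measure set 'cV[R]_m -> \bar R}).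
Hypotheses (s0 : 0 < sigma) (Nmu : is_mvnormal mu (sigma ^+ 2)%:M N).

Lemma conditional_halfspace (w q : 'cV[R]_m) : 0 < nrm2 w ->
  N [set y | 0 <= dot w (y - (mu + q))] =
  (Phi (- (dot w q / (sigma * Num.sqrt (nrm2 w)))))%:E.
Proof.
move=> w0.
have -> : [set y | 0 <= dot w (y - (mu + q))] =
    [set y : 'cV[R]_m | `[dot w mu + dot w q, +oo[ ((w^T *m y) 0 0)].
  apply/seteqP; split => y /=; rewrite in_itv /= andbT dotE dotDr dotNr dotDr; lra.
rewrite Nmu// dotE.
have -> : (w^T *m (sigma ^+ 2)%:M *m w) 0 0 = sigma ^+ 2 * nrm2 w.
  by rewrite mul_mx_scalar -scalemxAl mxE dotE dot_self.
have v0 : 0 < sigma ^+ 2 * nrm2 w by rewrite mulr_gt0 ?exprn_gt0.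
rewrite /normal_law gt_eqF// normal_prob_affine ?sqrtr_gt0//.
by rewrite sqrtrM ?sqr_ge0// sqrtr_sqr gtr0_norm.
Qed.

Lemma conditional_center (w : 'cV[R]_m) : N setT = 1%E ->
  ((2^-1)%:E <= N [set y | (0 <= dot w (y - mu))%R])%E.
Proof.
move=> N1; have [w0|w0] := eqVneq (nrm2 w) 0.
  rewrite (_ : [set y | _] = setT); first by rewrite N1 lee_fin; lra.
  apply/seteqP; split => // y _ /=; rewrite (nrm2_eq0 w0) /dot big1// => j _.
  by rewrite mxE mul0r.
have wp : 0 < nrm2 w by rewrite lt_neqAle eq_sym w0 nrm2_ge0.
have := conditional_halfspace 0 wp; rewrite addr0 => ->.
by rewrite /dot big1 ?mul0r ?oppr0 ?Phi0// => j _; rewrite mxE mulr0.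
Qed.

(** The test direction [w] replaces the exact direction [v] at the price of the norm of
    [v - w], by the Cauchy-Schwarz inequality. *)
Lemma conditional_shifted (w v : 'cV[R]_m) (rho : R) : 0 < nrm2 w -> 0 <= rho ->
  (N [set y | (0 <= dot w (y - (mu + rho *: v)))%R] <=
   (Phi (- (rho / sigma * (Num.sqrt (nrm2 w) - Num.sqrt (nrm2 (v - w))))))%:E)%E.
Proof.
move=> w0 rho0; rewrite conditional_halfspace// lee_fin; apply: Phi_nondecreasing.
rewrite lerN2 dotZr.
set a := Num.sqrt (nrm2 w); set b := Num.sqrt _.
have a0 : 0 < a by rewrite sqrtr_gt0.
have -> : rho * dot w v / (sigma * a) = rho / sigma * (dot w v / a).
  by field; rewrite !gt_eqF.
rewrite ler_wpM2l ?divr_ge0 ?(ltW s0)// ler_pdivlMr//.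
have -> : dot w v = nrm2 w + dot w (v - w) by rewrite dotDr dotNr dot_self; ring.
have := cauchy_schwarz (v - w) w0; rewrite -/a -/b.
have a2 : a ^+ 2 = nrm2 w by rewrite sqr_sqrtr// ltW.
by rewrite -a2; lra.
Qed.

End conditional.

Section pointwise.
Local Open Scope ring_scope.
Local Open Scope classical_set_scope.
Context (R : realType).
Implicit Types (a b t T k : R).
Local Notation phi := (normal_pdf 0 1 : R -> R).

Lemma Phi_far a b t T k : 0 < k -> 0 <= T -> T <= t -> 2 * k < a -> b < k ->
  Phi (- (t * (a - b))) <= Phi (- (T * k)).
Proof. by move=> k0 T0 Tt ak bk; apply: Phi_nondecreasing; nra. Qed.

(** Here [b <= eta / 2 + b^2 / (2 eta)] turns the Lipschitz error [t b] into a quantity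
    controlled by the second moment of [b]. *)
Lemma Phi_near a b t T k eta : 0 < k -> 0 <= t -> t <= T -> 0 <= a -> 0 <= b -> 0 < eta ->
  Phi (- (t * (a - b))) <= 2^-1 - t * k * phi (T * k) + t * eta / 2
     + t * k * phi (T * k) * (a ^+ 2 <= k ^+ 2)%R%:R + t / (2 * eta) * b ^+ 2.
Proof.
move=> k0 t0 tT a0 b0 eta0.
have tb : t * b <= t * eta / 2 + t / (2 * eta) * b ^+ 2.
  have -> : t * eta / 2 + t / (2 * eta) * b ^+ 2 =
     t * b + t / (2 * eta) * (b - eta) ^+ 2 by field; rewrite gt_eqF.
  by rewrite lerDl mulr_ge0 ?sqr_ge0// divr_ge0// mulr_ge0// ltW.
have h1 : - (t * a) <= - (t * (a - b)) by nra.
have := Phi_lip h1.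
have -> : - (t * (a - b)) - - (t * a) = t * b by ring.
suff : Phi (- (t * a)) <= 2^-1 - t * k * phi (T * k) +
   t * k * phi (T * k) * (a ^+ 2 <= k ^+ 2)%R%:R by move: tb; lra.
have [ak|ak] := leP (a ^+ 2) (k ^+ 2).
  rewrite mulr1 subrK -Phi0; apply: Phi_nondecreasing.
  by rewrite oppr_le0 mulr_ge0.
rewrite mulr0 addr0; apply: (@le_trans _ _ (Phi (- (t * k)))).
  apply: Phi_nondecreasing; rewrite lerN2 ler_wpM2l//.
  by have := ltr0_norm; nra.
rewrite PhiN; have h2 : t * k <= T * k by rewrite ler_wpM2r// ltW.
have h3 : 0 <= t * k by rewrite mulr_ge0// ltW.
by have := Phi_grow h3 h2; rewrite Phi0; lra.
Qed.

End pointwise.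

Section regression_model.
Local Open Scope ring_scope.
Local Open Scope classical_set_scope.
Context (R : realType) (m p : nat).
Context (B : 'M[R]_(p, m)) (sigma : R) (Sigma : 'M[R]_p).
Context (H : probability ('cV[R]_m * 'cV[R]_p)%type R).
Hypotheses (s0 : 0 < sigma) (covS : is_covariance Sigma).
Hypothesis (HB : regression_law B sigma Sigma H).

Definition positive_part (W Q : 'M[R]_(p, m)) : set ('cV[R]_m * 'cV[R]_p) :=
  [set yx | 0 <= dot (W^T *m yx.2) (yx.1 - (B^T *m yx.2 + Q^T *m yx.2))].

Lemma measurable_positive_part W Q : measurable (positive_part W Q).
Proof.
pose f (yx : 'cV[R]_m * 'cV[R]_p) :=
  dot (W^T *m yx.2) (yx.1 - (B^T *m yx.2 + Q^T *m yx.2)).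
have m2 k l (M : 'M[R]_(k, p)) (i : 'I_k) :
    measurable_fun setT (fun yx : 'cV[R]_m * 'cV[R]_p => (M *m yx.2) i l).
  apply: measurable_mulmx_entry => j.
  exact: (measurableT_comp (measurable_entry j l) measurable_snd).
have m1 (i : 'I_m) : measurable_fun setT (fun yx : 'cV[R]_m * 'cV[R]_p => yx.1 i 0).
  exact: (measurableT_comp (measurable_entry i 0) measurable_fst).
have mf : measurable_fun setT f.
  apply: measurable_sum => j; apply: measurable_funM; first exact: m2.
  rewrite (_ : (fun _ => _) = (fun yx : 'cV[R]_m * 'cV[R]_p => yx.1 j 0 -
    ((B^T *m yx.2) j 0 + (Q^T *m yx.2) j 0))); last first.
    by apply/funext => yx; rewrite !mxE.
  apply: measurable_funB; first exact: m1.
  by apply: measurable_funD; apply: (m2 m 0 _ j).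
rewrite -[X in measurable X]setTI.
have := mf measurableT _ (measurable_itv `[0, +oo[%R).
by congr measurable; apply/seteqP; split => x [_] /=; rewrite in_itv /= andbT.
Qed.

Lemma prob_center W : ((2^-1)%:E <= H (positive_part W 0))%E.
Proof.
have [N [K [NS KS HR]]] := HB.
rewrite (mixture_unique HR (measurable_positive_part W 0)).
apply: (@le_trans _ _ (\int[N]_x (2^-1)%:E)%E).
  by rewrite integral_probability_cst.
apply: ge0_le_integral => //.
- apply: measurable_kernel_section; exact: measurable_positive_part.
- move=> x _; rewrite /positive_part /= trmx0.
  under eq_set do rewrite mul0mx addr0.
  apply: (conditional_center s0 (KS x)); exact: prob_kernel.
Qed.

(** The common shape of the pointwise bounds below: constants, indicators of small balls
    of [W^T x], and the squared norm of the rounding error [D^T x]. *)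
Lemma integral_bound N (W D : 'M[R]_(p, m)) (f : 'cV[R]_p -> \bar R) c0 c1 c2 c3 k1 k3 :
  is_mvnormal 0 Sigma (N : probability 'cV[R]_p R) -> tr_qform Sigma W = 1 ->
  0 <= c0 -> 0 <= c1 -> 0 <= c2 -> 0 <= c3 -> 0 < k1 -> 0 < k3 ->
  measurable_fun setT f -> (forall x, 0 <= f x)%E ->
  (forall x, f x <= (c0 + c1 * (nrm2 (W^T *m x) <= k1 ^+ 2)%R%:R
     + c2 * nrm2 (D^T *m x) + c3 * (nrm2 (W^T *m x) <= k3 ^+ 2)%R%:R)%:E)%E ->
  (\int[N]_x f x <= (c0 + c1 * (6 * k1) + c2 * (8 * tr_qform Sigma D) + c3 * (6 * k3))%:E)%E.
Proof.
move=> NS W1 c00 c10 c20 c30 k10 k30 mf f0 fb.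
pose A k : set 'cV[R]_p := [set x | nrm2 (W^T *m x) <= k ^+ 2].
have mA k : measurable (A k).
  rewrite -[X in measurable X]setTI.
  have := measurable_nrm2 W measurableT (measurable_itv `]-oo, k ^+ 2]%R).
  by congr measurable; apply/seteqP; split => x [_] /=; rewrite in_itv.
have mI k : measurable_fun setT (fun x => (\1_(A k) x)%:E : \bar R).
  by apply/measurable_EFinP; exact: measurable_indic.
have mn : measurable_fun setT (fun x => (nrm2 (D^T *m x))%:E : \bar R).
  by apply/measurable_EFinP; exact: measurable_nrm2.
have AI k x : (nrm2 (W^T *m x) <= k ^+ 2)%R%:R = \1_(A k) x :> R.
  by rewrite indicE; congr ((nat_of_bool _)%:R); apply/idP/idP; rewrite inE.
have n0 x : (0 <= (nrm2 (D^T *m x))%:E)%E by rewrite lee_fin nrm2_ge0.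
have i0 k x : (0 <= (\1_(A k) x)%:E :> \bar R)%E by rewrite lee_fin.
pose f0' (x : 'cV[R]_p) : \bar R := c0%:E.
pose f1 x := (c1%:E * (\1_(A k1) x)%:E)%E.
pose f2 x := (c2%:E * (nrm2 (D^T *m x))%:E)%E.
pose f3 x := (c3%:E * (\1_(A k3) x)%:E)%E.
have mf1 : measurable_fun setT f1 by exact: emeasurable_funM.
have mf2 : measurable_fun setT f2 by exact: emeasurable_funM.
have mf3 : measurable_fun setT f3 by exact: emeasurable_funM.
have f10 x : (0 <= f1 x)%E by rewrite mule_ge0.
have f20 x : (0 <= f2 x)%E by rewrite mule_ge0.
have f30 x : (0 <= f3 x)%E by rewrite mule_ge0.
have mf01 : measurable_fun setT (fun x => c0%:E + f1 x)%E by exact: emeasurable_funD.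
have mf02 : measurable_fun setT (fun x => c0%:E + f1 x + f2 x)%E.
  exact: emeasurable_funD.
have f01 x : (0 <= c0%:E + f1 x)%E by apply: adde_ge0; [rewrite lee_fin|exact: f10].
have f02 x : (0 <= c0%:E + f1 x + f2 x)%E.
  by apply: adde_ge0; [exact: f01|exact: f20].
apply: (@le_trans _ _ (\int[N]_x (c0%:E + f1 x + f2 x + f3 x))%E).
  apply: ge0_le_integral => //; first exact: emeasurable_funD.
  by move=> x _; rewrite /f1 /f2 /f3 -!EFinM -!EFinD -!AI.
rewrite (ge0_integralD _ measurableT (fun x _ => f02 x) mf02 (fun x _ => f30 x) mf3).
rewrite (ge0_integralD _ measurableT (fun x _ => f01 x) mf01 (fun x _ => f20 x) mf2).
rewrite (ge0_integralD _ measurableT (fun x _ => _ : (0 <= c0%:E)%E) (measurable_cst _)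
  (fun x _ => f10 x) mf1)//.
rewrite !ge0_integralZl// integral_probability_cst !integral_indic// !setIT.
rewrite !EFinD; apply: leeD; first apply: leeD; first apply: leeD => //.
- rewrite [leRHS]EFinM; apply: lee_wpmul2l; first by rewrite lee_fin.
  exact: (nrm2_small_ball NS covS k10 W1).
- rewrite [leRHS]EFinM; apply: lee_wpmul2l; first by rewrite lee_fin.
  exact: (integral_nrm2 NS covS D).
- rewrite [leRHS]EFinM; apply: lee_wpmul2l; first by rewrite lee_fin.
  exact: (nrm2_small_ball NS covS k30 W1).
Qed.

Section shifted.
Context (W V : 'M[R]_(p, m)) (rho : R).
Hypotheses (W1 : tr_qform Sigma W = 1) (rho0 : 0 < rho).
Let t := rho / sigma.

Let t0 : 0 < t. Proof. exact: divr_gt0. Qed.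

Lemma prob_shifted_le c0 c1 c2 c3 k1 k3 :
  0 <= c0 -> 0 <= c1 -> 0 <= c2 -> 0 <= c3 -> 0 < k1 -> 0 < k3 ->
  (forall x : 'cV[R]_p,
    let a := nrm2 (W^T *m x) in let b := nrm2 ((V - W)^T *m x) in
    let bound := c0 + c1 * (a <= k1 ^+ 2)%R%:R + c2 * b + c3 * (a <= k3 ^+ 2)%R%:R in
    1 <= bound \/ 0 < a /\ Phi (- (t * (Num.sqrt a - Num.sqrt b))) <= bound) ->
  (H (positive_part W (rho *: V)) <=
    (c0 + c1 * (6 * k1) + c2 * (8 * tr_qform Sigma (V - W)) + c3 * (6 * k3))%:E)%E.
Proof.
move=> c00 c10 c20 c30 k10 k30 hb.
have [N [K [NS KS HR]]] := HB.
have mS := measurable_positive_part W (rho *: V).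
rewrite (mixture_unique HR mS).
apply: (integral_bound NS W1) => //; first exact: measurable_kernel_section.
move=> x; have [h1|[a0 h]] := hb x.
  apply: (@le_trans _ _ 1%E); last by rewrite lee_fin.
  have <- : K x setT = 1%E by exact: prob_kernel.
  by apply: le_measure; rewrite ?inE//; exact: measurable_section.
apply: (@le_trans _ _ (Phi (- (t * (Num.sqrt (nrm2 (W^T *m x)) -
   Num.sqrt (nrm2 ((V - W)^T *m x))))))%:E); last by rewrite lee_fin.
have := conditional_shifted s0 (KS x) (V^T *m x) a0 (ltW rho0).
rewrite [(V - W)^T]linearB /= mulmxBl; apply: le_trans.
by rewrite /positive_part /= [(rho *: V)^T]linearZ /= -scalemxAl.
Qed.

(** For large distances the conditional probability is small as soon as [W^T x] is not
    small and the rounding error is. *)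
Lemma prob_shifted_far T k : 0 < k -> 0 <= T -> T <= t ->
  (H (positive_part W (rho *: V)) <=
   (Phi (- (T * k)) + 12 * k + 8 * tr_qform Sigma (V - W) / k ^+ 2)%:E)%E.
Proof.
move=> k0 T0 Tt; have k2 : 0 < k ^+ 2 by rewrite exprn_gt0.
apply: (@le_trans _ _ (Phi (- (T * k)) + 1 * (6 * (2 * k))
   + (k ^+ 2)^-1 * (8 * tr_qform Sigma (V - W)) + 0 * (6 * k))%:E); last first.
  by rewrite lee_fin; lra.
apply: prob_shifted_le => //; rewrite ?Phi_ge0 ?invr_ge0 ?sqr_ge0 ?mulr_gt0//.
move=> x a b bound; rewrite /bound mul0r addr0 mul1r.
have a0 : 0 <= a by exact: nrm2_ge0.
have b0 : 0 <= b by exact: nrm2_ge0.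
have P0 := Phi_ge0 (- (T * k)).
have kb0 : 0 <= (k ^+ 2)^-1 * b by rewrite mulr_ge0// invr_ge0 ltW.
have [ak|ak] := leP a ((2 * k) ^+ 2); first by left => /=; lra.
have [bk|bk] := leP (k ^+ 2) b.
  have : 1 <= (k ^+ 2)^-1 * b by rewrite mulrC ler_pdivlMr// mul1r.
  by left => /=; lra.
have ap : 0 < a by rewrite (lt_trans _ ak)// exprn_gt0// mulr_gt0.
right; split => //.
have sa : 2 * k < Num.sqrt a.
  have -> : 2 * k = Num.sqrt ((2 * k) ^+ 2).
    by rewrite sqrtr_sqr ger0_norm// mulr_ge0// ltW.
  by rewrite ltr_sqrt.
have sb : Num.sqrt b < k.
  have -> : k = Num.sqrt (k ^+ 2) by rewrite sqrtr_sqr gtr0_norm.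
  by rewrite ltr_sqrt.
have := @Phi_far R (Num.sqrt a) (Num.sqrt b) t T k k0 T0 Tt sa sb.
by move: kb0 => /=; lra.
Qed.

(** For bounded distances the gap is linear in [t].  The small ball of radius 1/12 costs
    half of the gain [c t]; the ball of radius [c t / 96] covers the points where
    [W^T x = 0], at which the conditional probability is 1. *)
Lemma prob_shifted_near T eta (c := normal_pdf 0 1 (T / 12) / 12) : t <= T ->
  0 < eta -> 36 * eta <= c -> tr_qform Sigma (V - W) <= eta ^+ 2 ->
  (H (positive_part W (rho *: V)) <= (2^-1 - c * t / 4)%:E)%E.
Proof.
move=> tT eta0 etac trD.
have T0 : 0 < T by apply: lt_le_trans tT.
have c0 : 0 < c by rewrite divr_gt0// phi_gt0.
have k0 : 0 < 12^-1 :> R by rewrite invr_gt0.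
have ct : c * t = t * 12^-1 * normal_pdf 0 1 (T * 12^-1) by rewrite /c; ring.
have ct0 : 0 < c * t by rewrite mulr_gt0.
have cthalf : c * t <= 2^-1.
  have h3 : t / 12 <= T / 12 by rewrite ler_wpM2r// ltW.
  have h4 : 0 <= t / 12 by rewrite divr_ge0// ltW.
  have := Phi_grow h4 h3; rewrite Phi0; have := Phi_le1 (t / 12); rewrite /c; lra.
have te0 : 0 <= t / (2 * eta) by rewrite divr_ge0 ?(ltW t0)// mulr_ge0// ltW.
have k3 : 0 < c * t / 96 by rewrite divr_gt0.
apply: (@le_trans _ _ ((2^-1 - c * t + t * eta / 2) + c * t * (6 * 12^-1)
   + t / (2 * eta) * (8 * tr_qform Sigma (V - W)) + 1 * (6 * (c * t / 96)))%:E); last first.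
  rewrite lee_fin.
  have : t / (2 * eta) * (8 * tr_qform Sigma (V - W)) <= 4 * (t * eta).
    have -> : 4 * (t * eta) = t / (2 * eta) * (8 * eta ^+ 2) by field; rewrite gt_eqF.
    by rewrite ler_wpM2l// ler_wpM2l.
  have : t * (36 * eta) <= t * c by rewrite ler_wpM2l// ltW.
  lra.
have te : 0 <= t * eta by rewrite mulr_ge0// ltW.
apply: prob_shifted_le => //; [lra|exact: ltW|].
move=> x a b bound; rewrite /bound mul1r.
have a0 : 0 <= a by exact: nrm2_ge0.
have b0 : 0 <= b by exact: nrm2_ge0.
have h2 : 0 <= t / (2 * eta) * b by rewrite mulr_ge0.
have h1 : 0 <= c * t * (a <= 12^-1 ^+ 2)%R%:R by rewrite mulr_ge0// ltW.
have [ak|ak] := leP a ((c * t / 96) ^+ 2); first by left => /=; lra.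
right; split; first by rewrite (lt_trans _ ak)// exprn_gt0.
rewrite /= addr0.
have := @Phi_near R (Num.sqrt a) (Num.sqrt b) t T 12^-1 eta k0 (ltW t0) tT
  (sqrtr_ge0 _) (sqrtr_ge0 _) eta0.
by rewrite -ct !sqr_sqrtr// => /le_trans; apply; lra.
Qed.

End shifted.
End regression_model.

(** * A finite net in the covariance norm *)

Section factorization.
Local Open Scope ring_scope.
Context (R : realType).

(** Cholesky's recursion on the Schur complement.  A vanishing corner entry forces its row
    to vanish, and as the inverse of 0 is 0 both cases share the same formulas. *)
Lemma psd_factor p (S : 'M[R]_p) : is_covariance S -> exists A : 'M[R]_p, S = A *m A^T.
Proof.
elim: p S => [|p IH] S [Ssym Spsd]; first by exists 0; rewrite [LHS]flatmx0 [RHS]flatmx0.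
pose a := S 0 0; pose r : 'rV[R]_p := @ursubmx _ 1 p 1 p S; pose D : 'M[R]_p := @drsubmx _ 1 p 1 p S.
have e1 : @ulsubmx _ 1 p 1 p S = a%:M.
  by rewrite [LHS]mx11_scalar !mxE; congr (S _ _)%:M; apply/val_inj.
have e2 : @dlsubmx _ 1 p 1 p S = r^T by rewrite /r trmx_ursub Ssym.
have SE : S = block_mx (a%:M : 'M[R]_1) r r^T D.
  by rewrite -[LHS](@submxK _ 1 p 1 p) e1 e2.
have Dsym : D^T = D by rewrite /D trmx_drsub Ssym.
have quad x (u : 'cV[R]_p) :
    0 <= x ^+ 2 * a + 2 * x * (r *m u) 0 0 + (u^T *m D *m u) 0 0.
  have : 0 <= ((col_mx (x%:M : 'M[R]_1) u)^T *m block_mx (a%:M : 'M[R]_1) r r^T D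
      *m col_mx (x%:M : 'M[R]_1) u) 0 0 by rewrite -SE; exact: Spsd.
  rewrite tr_col_mx.
  rewrite mul_row_block mul_row_col mulmxDl mulmxDl tr_scalar_mx.
  have -> : (u^T *m r^T *m x%:M) = ((x%:M : 'M[R]_1) *m (r *m u))^T.
    by rewrite !trmx_mul tr_scalar_mx.
  rewrite -!scalar_mxM -[x%:M *m r *m u]mulmxA !mul_scalar_mx.
  rewrite [X in 0 <= X](_ : _ = x * a * x + x * (r *m u) 0 0 +
     (x * (r *m u) 0 0 + (u^T *m D *m u) 0 0)); last by rewrite !mxE /= mulr1n.
  by lra.
have ar : a = 0 -> r = 0.
  move=> a0; apply/rowP => j; rewrite [RHS]mxE.
  pose u : 'cV[R]_p := delta_mx j 0; pose d := (u^T *m D *m u) 0 0.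
  have ru : (r *m u) 0 0 = r 0 j.
    by rewrite /u -colE mxE.
  apply/eqP/negPn/negP => rj.
  have := quad (- (d + 1) / (2 * r 0 j)) u; rewrite a0 mulr0 add0r ru -/d.
  have -> : 2 * (- (d + 1) / (2 * r 0 j)) * r 0 j = - (d + 1) by field.
  by lra.
have a0 : 0 <= a.
  by have := quad 1 0; rewrite !mulmx0 !mxE expr1n mulr0 !addr0 mul1r.
have [|L LE] := IH (D - a^-1 *: (r^T *m r)).
  split; first by rewrite linearB linearZ /= Dsym trmx_mul trmxK.
  move=> u; have := quad (- (a^-1 * (r *m u) 0 0)) u.
  set c := (r *m u) 0 0.
  have -> : (u^T *m (D - a^-1 *: (r^T *m r)) *m u) 0 0 =
      (u^T *m D *m u) 0 0 - a^-1 * c ^+ 2.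
    rewrite mulmxBr mulmxBl mxE [X in _ + X]mxE -scalemxAr -scalemxAl [X in _ - X]mxE.
    congr (_ - _ * _); rewrite mulmxA -trmx_mul -mulmxA.
    by rewrite [LHS]mxE big_ord1 mxE expr2.
  suff -> : (- (a^-1 * c)) ^+ 2 * a = a^-1 * c ^+ 2 by move: (u^T *m D *m u) => ?; lra.
  have [->|an0] := eqVneq a 0; first by rewrite invr0 !mul0r mulr0.
  by field.
pose s := Num.sqrt a.
have s2 : s * s = a by rewrite -expr2 sqr_sqrtr.
have sr : (s * s^-1) *: r = r.
  have [s0|s0] := eqVneq s 0; last by rewrite divff// scale1r.
  by rewrite ar ?scaler0// -s2 s0 mulr0.
pose X : 'M[R]_(1 + p) := block_mx (s%:M : 'M[R]_1) 0 (s^-1 *: r^T) L.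
suff E : block_mx (a%:M : 'M[R]_1) r r^T D = X *m X^T by exists X; rewrite SE.
rewrite tr_block_mx mulmx_block !tr_scalar_mx !trmx0 !mulmx0 !mul0mx !addr0.
rewrite [(s^-1 *: r^T)^T]linearZ /= trmxK -scalar_mxM s2; congr block_mx.
- by rewrite mul_scalar_mx scalerA sr.
- by rewrite mul_mx_scalar scalerA -[in LHS]sr linearZ.
- rewrite -LE -scalemxAl -scalemxAr scalerA -invfM s2.
  by rewrite addrC subrK.
Qed.

End factorization.

Section covariance_net.
Local Open Scope ring_scope.
Context (R : realType).

(** Each code counted has weight at least [2 ^ - K] under a product weight of total
    mass at most [4 ^ #|J|]. *)
Lemma card_small_codes (J : finType) (B K : nat) :
  #|[set f : {ffun J -> bool * 'I_B.+1} | (\sum_j (f j).2 <= K)%N]|%:R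
    <= 4 ^+ #|J| * 2 ^+ K :> R.
Proof.
set G := [set f | _].
apply: (@le_trans _ _ (\sum_(f : {ffun J -> bool * 'I_B.+1})
    2 ^+ K * \prod_j (2^-1) ^+ (f j).2)).
  rewrite -sum1_card natr_sum big_mkcond /=; apply: ler_sum => f _.
  have p0 : 0 <= \prod_j (2^-1 : R) ^+ (f j).2 by apply: prodr_ge0 => j _; rewrite exprn_ge0.
  case: ifP => [|_]; last by rewrite mulr_ge0// exprn_ge0.
  rewrite inE => fK; rewrite prodrXr exprVn ler_pdivlMr ?exprn_gt0// mul1r.
  by rewrite ler_eXn2l ?ltr1n.
rewrite -mulr_sumr mulrC ler_wpM2r ?exprn_ge0//.
rewrite -(bigA_distr_bigA (fun _ c => (2^-1 : R) ^+ (c : bool * 'I_B.+1).2)) /=.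
rewrite -[leRHS]prodr_const; apply: ler_prod => j _; apply/andP; split.
  by apply: sumr_ge0 => c _; rewrite exprn_ge0.
rewrite -(pair_big predT predT (fun b (k : 'I_B.+1) => (2^-1 : R) ^+ k)) /=.
rewrite big_bool /=.
suff : \sum_(k < B.+1) (2^-1 : R) ^+ k <= 2 by lra.
have -> n : \sum_(k < n) (2^-1 : R) ^+ k = 2 - 2 * (2^-1) ^+ n.
  elim: n => [|n IH]; first by rewrite big_ord0 expr0; lra.
  by rewrite big_ord_recr /= IH exprS; lra.
by rewrite gerBl mulr_ge0// exprn_ge0.
Qed.

Lemma tr_qform_factor p m (A : 'M[R]_p) (V : 'M[R]_(p, m)) :
  tr_qform (A *m A^T) V = \sum_(ij : 'I_p * 'I_m) ((A^T *m V) ij.1 ij.2) ^+ 2.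
Proof.
rewrite /tr_qform.
have -> : V^T *m (A *m A^T) *m V = (A^T *m V)^T *m (A^T *m V).
  by rewrite trmx_mul trmxK !mulmxA.
rewrite -(pair_big predT predT (fun i j => ((A^T *m V) i j) ^+ 2)) /= exchange_big /=.
by apply: eq_bigr => j _; rewrite mxE; apply: eq_bigr => i _; rewrite !mxE expr2.
Qed.

Definition net_const (eta : R) : nat := (Num.truncn (1 + eta^-1)).+1.

(** Round the coordinates of [A^T V], where [Sigma = A A^T], to multiples of
    [eta / sqrt (p m)].  On the unit sphere the rounded coordinates have a sum of absolute
    values of order [p m], which leaves [exp (O(p m))] cells, instead of the extra
    logarithm of a cubic grid.  The net picks one unit matrix in each occupied cell: the
    rounded coordinates may not come from any matrix when [A] is singular. *)
Lemma covariance_net p m (Sigma : 'M[R]_p) (eta : R) : 0 < eta -> is_covariance Sigma ->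
  exists (C : nat) (W : 'I_C -> 'M[R]_(p, m)),
    C%:R <= expR ((2 + net_const eta)%:R * (p * m)%:R) :> R /\
    forall V, tr_qform Sigma V = 1 ->
      exists k, tr_qform Sigma (W k) = 1 /\ tr_qform Sigma (V - W k) <= eta ^+ 2.
Proof.
move=> eta0 /psd_factor[A SA].
pose J : finType := ('I_p * 'I_m)%type.
have cJ : #|J| = (p * m)%N by rewrite card_prod !card_ord.
pose M (V : 'M[R]_(p, m)) (j : J) := (A^T *m V) j.1 j.2.
have trE V : tr_qform Sigma V = \sum_j M V j ^+ 2 by rewrite SA tr_qform_factor.
pose s := Num.sqrt (p * m)%:R / eta.
have s0 : 0 <= s by rewrite divr_ge0 ?sqrtr_ge0// ltW.
have s2 : s ^+ 2 * eta ^+ 2 = (p * m)%:R.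
  by rewrite -exprMn divfK ?gt_eqF// sqr_sqrtr.
pose L := net_const eta; pose K := (L * (p * m))%N.
pose z V j := Num.floor (s * M V j).
have zle V : tr_qform Sigma V = 1 -> (\sum_j `|z V j| <= K)%N.
  move=> V1; rewrite -(ler_nat R) natr_sum.
  apply: (@le_trans _ _ (\sum_j (1 + (s ^+ 2 * eta * M V j ^+ 2 + eta^-1) / 2))).
    apply: ler_sum => j _; rewrite natr_absz.
    have h1 := floor_le_tmp (s * M V j); have h2 := lt_succ_floor (s * M V j).
    have h3 : `|s * M V j| <= (s ^+ 2 * eta * M V j ^+ 2 + eta^-1) / 2.
      have -> : (s ^+ 2 * eta * M V j ^+ 2 + eta^-1) / 2 = `|s * M V j| +
         eta / 2 * (`|s * M V j| - eta^-1) ^+ 2.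
        have hu : `|s * M V j| ^+ 2 = s ^+ 2 * M V j ^+ 2.
          by rewrite real_normK ?num_real// exprMn.
        transitivity ((eta * `|s * M V j| ^+ 2 + eta^-1) / 2); first by rewrite hu; ring.
        by field; rewrite gt_eqF.
      by rewrite lerDl mulr_ge0 ?sqr_ge0// divr_ge0// ltW.
    rewrite intr_norm; move: h3; rewrite !ler_norml => /andP[h3 h4].
    rewrite intrD in h2; apply/andP; split; lra.
  have sumJ (c : R) : \sum_(j : J) c = (p * m)%:R * c by rewrite sumr_const cJ mulr_natl.
  rewrite big_split /= sumJ -mulr_suml big_split /= -mulr_sumr -trE V1 mulr1 sumJ.
  have -> : s ^+ 2 * eta = (p * m)%:R / eta by rewrite -s2; field; rewrite gt_eqF.
  rewrite /K [leRHS]natrM [leLHS](_ : _ = (1 + eta^-1) * (p * m)%:R); last first.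
    by field; rewrite gt_eqF.
  by rewrite ler_wpM2r// ltW// truncnS_gt.
pose code V : {ffun J -> bool * 'I_K.+1} := [ffun j => (z V j < 0, inord `|z V j|%N)].
pose G := [set f : {ffun J -> bool * 'I_K.+1} | (\sum_j (f j).2 <= K)%N].
have zK V j : tr_qform Sigma V = 1 -> (`|z V j| <= K)%N.
  by move=> V1; rewrite (leq_trans _ (zle V V1))// (bigD1 j)//= leq_addr.
have codeG V : tr_qform Sigma V = 1 -> code V \in G.
  move=> V1; rewrite inE (leq_trans _ (zle V V1))// leq_sum// => j _.
  by rewrite ffunE /= inordK// ltnS zK.
pose W (k : 'I_#|G|) : 'M[R]_(p, m) :=
  xget 0 [set V | tr_qform Sigma V = 1 /\ code V = enum_val k]%classic.
exists #|G|, W; split.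
  apply: (le_trans (card_small_codes J K K)).
  have e2 : 2 <= expR 1 :> R by have := expR_ge1Dx (1 : R); lra.
  have e4 : 4 <= expR 2 :> R.
    have -> : 4 = 2 ^+ 2 :> R by ring.
    rewrite (_ : expR 2 = expR 1 ^+ 2); last by rewrite -expRM_natr mul1r.
    by rewrite lerXn2r ?nnegrE ?expR_ge0.
  rewrite natrD mulrDl expRD cJ ler_pM ?exprn_ge0//.
    by rewrite expRM_natr lerXn2r ?nnegrE ?expR_ge0.
  by rewrite -natrM -[X in expR X]mul1r expRM_natr lerXn2r ?nnegrE ?expR_ge0.
move=> V V1; exists (enum_rank_in (codeG V V1) (code V)).
set k := enum_rank_in _ _.
have [W1 WV] : tr_qform Sigma (W k) = 1 /\ code (W k) = enum_val k.
  apply: (@xgetPex _ 0 [set V | tr_qform Sigma V = 1 /\ code V = enum_val k]%classic).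
  by exists V; rewrite /= /k enum_rankK_in ?codeG.
split => //; rewrite enum_rankK_in ?codeG// in WV.
have zz j : z (W k) j = z V j.
  have /ffunP/(_ j) := WV; rewrite !ffunE => -[h1 /(congr1 val)].
  rewrite /= !inordK ?ltnS ?zK// => h2.
  by move: h1 h2; case: (z (W k) j) => a; case: (z V j) => b //= _; lia.
have [d0|d0] := posnP (p * m)%N.
  have := V1; rewrite trE big1 => [/esym/eqP|j _]; first by rewrite oner_eq0.
  by have := fintype.card0_eq (etrans cJ d0) j; rewrite inE.
have d1 : 0 < (p * m)%:R :> R by rewrite ltr0n.
have sp : 0 < s ^+ 2 by move: d1; rewrite -s2 pmulr_lgt0// exprn_gt0.
rewrite -(ler_pM2l sp) s2 trE mulr_sumr.
apply: (@le_trans _ _ (\sum_(j : J) 1)); last by rewrite sumr_const cJ.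
apply: ler_sum => j _; rewrite -exprMn.
have -> : s * M (V - W k) j = s * M V j - s * M (W k) j.
  by rewrite /M mulmxBr mxE [X in _ + X]mxE; ring.
have := floor_le_tmp (s * M V j); have := lt_succ_floor (s * M V j).
have := floor_le_tmp (s * M (W k) j); have := lt_succ_floor (s * M (W k) j).
rewrite -/(z V j) -/(z (W k) j) zz intrD => h1 h2 h3 h4.
rewrite -[leRHS](expr1n _ 2) -[leLHS]real_normK ?num_real// lerXn2r ?nnegrE//.
by rewrite ler_norml; apply/andP; split; lra.
Qed.

End covariance_net.

(** * Deviations of empirical depths *)

Lemma union_bound d (T : measurableType d) (R : realType) (P : probability T R)
    (I : Type) (r : seq I) (E : I -> set T) :
  (forall k, measurable (E k)) ->
  (P (\big[setU/set0]_(k <- r) E k) <= \sum_(k <- r) P (E k))%E.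
Proof.
move=> mE; elim: r => [|k r IH]; first by rewrite !big_nil measure0.
rewrite !big_cons; apply: (le_trans (measureU2 _ (mE k) _)).
  by apply: bigsetU_measurable.
exact: leeD.
Qed.

Section deviations.
Local Open Scope ring_scope.
Local Open Scope classical_set_scope.
Context (R : realType).

Lemma halfspace_deviation_fin d (T : measurableType d) (P : probability T R)
    d' (Omega : measurableType d') (Pr : probability Omega R) n
    (Z : 'I_n -> {RV Pr >-> T}) (J : finType) (phi : T -> J -> R) (x : R) :
  random_sample P Z ->
  (forall j, measurable_fun setT (phi^~ j)) -> (0 < n)%N -> 0 <= x ->
  exists E : set Omega, [/\ measurable E, (Pr E <= (4 * expR (- x))%:E)%E &
    forall w, ~ E w -> forall theta : J -> R,
      `|count Z [set t | 0 <= \sum_j theta j * phi t j] w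
        - n%:R * fine (P [set t | 0 <= \sum_j theta j * phi t j])|
        <= 4 * Num.sqrt (288 * n%:R * (x + 7 * #|J|.+1%:R))].
Proof.
move=> ZP mphi n0 x0.
have [E [mE PE HE]] := halfspace_deviation ZP
  (phi := fun t (i : 'I_#|J|) => phi t (enum_val i)) (fun i => mphi _) n0 x0.
exists E; split => // w /HE{}HE theta; have := HE (fun i => theta (enum_val i)).
have -> : [set t | 0 <= \sum_(i < #|J|) theta (enum_val i) * phi t (enum_val i)] =
    [set t | 0 <= \sum_j theta j * phi t j]; last by [].
have E0 t : \sum_(i < #|J|) theta (enum_val i) * phi t (enum_val i) =
    \sum_j theta j * phi t j.
  by rewrite -(big_enum_val (A := J) (fun j => theta j * phi t j)).
by apply/seteqP; split => t /=; rewrite E0.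
Qed.

Lemma empiricalE d (T : measurableType d) n (z : 'I_n -> T) (A : set T) :
  empirical R z A = (n%:R^-1 * \sum_(i < n) \1_A (z i))%:E.
Proof.
by rewrite /empirical EFinM -sumEFin; congr (_ * _)%E.
Qed.

Context (m p n : nat) (B : 'M[R]_(p, m)).
Local Notation sample_space := ('cV[R]_m * 'cV[R]_p)%type.
Context (P : probability sample_space R).
Context d' (Omega : measurableType d') (Pr : probability Omega R).
Context (Z : 'I_n -> {RV Pr >-> sample_space}).
Hypotheses (ZP : random_sample P Z) (n0 : (0 < n)%N) (p0 : (0 < p)%N) (m0 : (0 < m)%N).

Definition radius (x : R) : R := 4 * Num.sqrt (288 * n%:R * (x + 21 * (p * m)%:R)).

Let pm0 : (0 < p * m)%N.
Proof. by rewrite muln_gt0 p0. Qed.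

Let radius_ge x D : (D <= 3 * (p * m))%N ->
  4 * Num.sqrt (288 * n%:R * (x + 7 * D%:R)) <= radius x.
Proof.
rewrite -(ler_nat R) natrM => D3; apply: ler_wpM2l; first exact: ler0n.
apply: ler_wsqrtr; apply: ler_wpM2l; first by rewrite mulr_ge0 ?ler0n.
rewrite lerD2l; lra.
Qed.

Let measurable_x i : measurable_fun setT (fun yx : sample_space => yx.2 i 0).
Proof. exact: (measurableT_comp (measurable_entry i 0) measurable_snd). Qed.

Let measurable_res j :
  measurable_fun setT (fun yx : sample_space => (yx.1 - B^T *m yx.2) j 0).
Proof.
rewrite (_ : (fun _ => _) = (fun yx : sample_space => yx.1 j 0 - (B^T *m yx.2) j 0)).
  apply: measurable_funB.
    exact: (measurableT_comp (measurable_entry j 0) measurable_fst).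
  by apply: measurable_mulmx_entry => l; exact: measurable_x.
by apply/funext => yx; rewrite !mxE.
Qed.

Lemma dot_mulmx (U : 'M[R]_(p, m)) (x : 'cV[R]_p) (e : 'cV[R]_m) :
  dot (U^T *m x) e = \sum_(ij : 'I_p * 'I_m) U ij.1 ij.2 * (x ij.1 0 * e ij.2 0).
Proof.
rewrite -(pair_big predT predT (fun i j => U i j * (x i 0 * e j 0))) exchange_big /=.
apply: eq_bigr => j _; rewrite mxE mulr_suml; apply: eq_bigr => i _.
by rewrite mxE mulrA.
Qed.

(** For the residual at the truth the regions are halfspaces in the [p m] products of a
    coordinate of [X] and a coordinate of the residual. *)
Lemma center_deviation (x : R) : 0 <= x ->
  exists E : set Omega, [/\ measurable E, (Pr E <= (4 * expR (- x))%:E)%E &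
    forall w, ~ E w -> forall U : 'M[R]_(p, m),
      `|count Z (positive_part B U 0) w - n%:R * fine (P (positive_part B U 0))|
        <= radius x].
Proof.
move=> x0; pose phi (yx : sample_space) (ij : 'I_p * 'I_m) :=
  yx.2 ij.1 0 * (yx.1 - B^T *m yx.2) ij.2 0.
have [|E [mE PE HE]] := @halfspace_deviation_fin _ _ P _ _ Pr n Z _ phi x ZP _ n0 x0.
  by move=> ij; apply: measurable_funM.
exists E; split => // w /HE{}HE U; have := HE (fun ij => U ij.1 ij.2).
have -> : [set yx | 0 <= \sum_ij U ij.1 ij.2 * phi yx ij] = positive_part B U 0.
  apply/seteqP; split => yx; rewrite /positive_part /= -dot_mulmx trmx0 mul0mx addr0 //.
move=> /le_trans; apply; apply: radius_ge.
by rewrite card_prod !card_ord; lia.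
Qed.

(** For a fixed test direction the region of [Q] is a halfspace in [p m + 1] features, with
    a normal vector linear in [Q]. *)
Lemma shifted_deviation (W : 'M[R]_(p, m)) (x : R) : 0 <= x ->
  exists E : set Omega, [/\ measurable E, (Pr E <= (4 * expR (- x))%:E)%E &
    forall w, ~ E w -> forall Q : 'M[R]_(p, m),
      `|count Z (positive_part B W Q) w - n%:R * fine (P (positive_part B W Q))|
        <= radius x].
Proof.
move=> x0; pose phi (yx : sample_space) (o : 'I_1 + 'I_p * 'I_m) :=
  match o with
  | inl _ => dot (W^T *m yx.2) (yx.1 - B^T *m yx.2)
  | inr ij => yx.2 ij.1 0 * (W^T *m yx.2) ij.2 0
  end.
have mW j : measurable_fun setT (fun yx : sample_space => (W^T *m yx.2) j 0).
  by apply: measurable_mulmx_entry => l; exact: measurable_x.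
have [|E [mE PE HE]] := @halfspace_deviation_fin _ _ P _ _ Pr n Z _ phi x ZP _ n0 x0.
  move=> [k|ij] /=; last first.
    by apply: measurable_funM; [exact: measurable_x|exact: mW].
  apply: measurable_sum => j; apply: measurable_funM; [exact: mW|exact: measurable_res].
exists E; split => // w /HE{}HE Q.
have := HE (fun o => if o is inr ij then - Q ij.1 ij.2 else 1).
set S := [set t | _].
have -> : S = positive_part B W Q.
  have E0 yx : \sum_o (if o is inr ij then - Q ij.1 ij.2 else 1) * phi yx o =
      dot (W^T *m yx.2) (yx.1 - (B^T *m yx.2 + Q^T *m yx.2)).
    rewrite big_sumType /= big_ord1 mul1r opprD addrA [RHS]dotDr dotNr; congr (_ + _).
    rewrite [dot _ (Q^T *m _)](_ : _ = dot (Q^T *m yx.2) (W^T *m yx.2)); last first.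
      by apply: eq_bigr => j _; rewrite mulrC.
    by rewrite dot_mulmx -sumrN; apply: eq_bigr => ij _; rewrite mulNr.
  by apply/seteqP; split => yx; rewrite /S /positive_part /= E0.
move=> /le_trans; apply; apply: radius_ge.
by rewrite card_sum card_prod !card_ord; lia.
Qed.

Lemma net_deviation (C : nat) (W : 'I_C -> 'M[R]_(p, m)) (x : R) : 0 <= x ->
  exists E : set Omega, [/\ measurable E, (Pr E <= (C%:R * (4 * expR (- x)))%:E)%E &
    forall w, ~ E w -> forall k (Q : 'M[R]_(p, m)),
      `|count Z (positive_part B (W k) Q) w
         - n%:R * fine (P (positive_part B (W k) Q))| <= radius x].
Proof.
move=> x0; have [E HE] := boolp.choice (fun k => shifted_deviation (W k) x0).
exists (\big[setU/set0]_(k < C) E k); split.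
- by apply: bigsetU_measurable => k _; case: (HE k).
- apply: (@le_trans _ _ (\sum_(k < C) Pr (E k))).
    by apply: union_bound => k; case: (HE k).
  apply: (@le_trans _ _ (\sum_(k < C) (4 * expR (- x))%:E)%E).
    by apply: lee_sum => k _; case: (HE k).
  by rewrite sumEFin lee_fin sumr_const card_ord -[leLHS]mulr_natl.
- move=> w nE k Q; have [_ _] := HE k; apply => Ekw; apply: nE.
  by rewrite (bigD1 k)//=; left.
Qed.

(** The estimator is at least as deep as the truth, and its depth is at most the empirical
    probability in the single direction [W]. *)
Lemma depth_comparison (Bhat W : 'M[R]_(p, m)) (w : Omega) (l : R) :
  W != 0 -> deepest (empirical R (fun i => Z i w)) Bhat ->
  (forall U, l <= count Z (positive_part B U 0) w / n%:R) ->
  l <= count Z (positive_part B W (Bhat - B)) w / n%:R.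
Proof.
move=> W0 /(_ B) dB lU.
have Pn A : empirical R (fun i => Z i w) A = (count Z A w / n%:R)%:E.
  by rewrite empiricalE mulrC.
rewrite -lee_fin -Pn; apply: le_trans (le_trans dB _).
  apply/ereal_infP => _ [U U0 <-]; rewrite Pn lee_fin; apply: le_trans (lU U) _.
  rewrite le_eqVlt; apply/orP; left; apply/eqP; congr (count Z _ w / _).
  apply/seteqP; split => yx; rewrite /positive_part /= trmx0 mul0mx addr0 //.
apply: ge_ereal_inf; exists (empirical R (fun i => Z i w) [set yx : sample_space |
  0 <= \sum_(j < m) (W^T *m yx.2) j 0 * (yx.1 - Bhat^T *m yx.2) j 0]).
  by exists W.
rewrite le_eqVlt; apply/orP; left; apply/eqP; congr (empirical _ _ _).
have QE (x : 'cV[R]_p) : B^T *m x + (Bhat - B)^T *m x = Bhat^T *m x.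
  by rewrite -mulmxDl -linearD /= addrC subrK.
by apply/seteqP; split => yx; rewrite /positive_part /dot /= QE.
Qed.

End deviations.

(** * Separating the truth from distant matrices *)

Section assembly.
Local Open Scope ring_scope.
Local Open Scope classical_set_scope.
Context (R : realType).

Lemma contamination_bounds d (T : measurableType d) (eps : R) (H P : probability T R) A :
  0 <= eps -> in_contamination eps H P -> measurable A ->
  (1 - eps) * fine (H A) <= fine (P A) <= (1 - eps) * fine (H A) + eps.
Proof.
move=> e0 [G PG] mA.
have -> : fine (P A) = (1 - eps) * fine (H A) + eps * fine (G A).
  by rewrite PG// fineD ?fineM// ?fin_numM ?fin_num_measure.
have G0 : 0 <= fine (G A) by rewrite fine_ge0.
have G1 : fine (G A) <= 1.
  by rewrite -lee_fin fineK ?fin_num_measure// probability_le1.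
apply/andP; split; first by rewrite lerDl mulr_ge0.
by rewrite lerD2l ler_piMr.
Qed.

(** With [gamma = 1/2 - e0 / (1 - e0)], a probability at most [3 gamma / 8] is below
    [1/2 - e0 / (1 - e0) - gamma / 2].  The three errors of [prob_shifted_far] are made at
    most [gamma / 8] each by choosing in turn the radius [k] of the small ball, the threshold
    [T], and the net precision [eta]. *)
Lemma depth_gap (e0 : R) : 0 <= e0 -> e0 < 3^-1 ->
  exists gamma c eta : R, [/\ 0 < gamma, 0 < c, 0 < eta &
    forall (m p : nat) (B : 'M[R]_(p, m)) (sigma : R) (Sigma : 'M[R]_p)
      (H : probability ('cV[R]_m * 'cV[R]_p)%type R),
    0 < sigma -> is_covariance Sigma -> regression_law B sigma Sigma H ->
    forall (W V : 'M[R]_(p, m)) (rho : R),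
    tr_qform Sigma W = 1 -> tr_qform Sigma (V - W) <= eta ^+ 2 -> 0 < rho ->
    let h := fine (H (positive_part B W (rho *: V))) in
    h <= 2^-1 - e0 / (1 - e0) - gamma \/ h <= 2^-1 - c * (rho / sigma)].
Proof.
move=> e00 e03; set e1 := e0 / (1 - e0).
have e1h : e1 < 2^-1 by rewrite /e1 ltr_pdivrMr; lra.
have e10 : 0 <= e1 by rewrite divr_ge0//; lra.
pose ga := 2^-1 - e1.
have ga0 : 0 < ga by rewrite /ga; lra.
have ga1 : ga <= 2^-1 by rewrite /ga; lra.
pose k := ga / 96.
have k0 : 0 < k by rewrite divr_gt0.
have [x x0 xg] : exists2 x : R, 0 < x & 1 - ga / 8 < Phi x by apply: Phi_to1; lra.
pose T := x / k.
have T0 : 0 < T by rewrite divr_gt0.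
have Tk : T * k = x by rewrite divfK// gt_eqF.
pose c := normal_pdf 0 1 (T / 12) / 12.
have c0 : 0 < c by rewrite divr_gt0// phi_gt0.
pose eta := Num.min (k * ga / 8) (c / 36).
have eta0 : 0 < eta.
  rewrite lt_min; apply/andP; split; last by rewrite divr_gt0.
  by rewrite divr_gt0 ?mulr_gt0.
have eta1 : eta <= k * ga / 8 by rewrite ge_min lexx.
have eta2 : 36 * eta <= c.
  by rewrite -ler_pdivlMl// mulrC ge_min lexx orbT.
exists (ga / 2), (c / 4), eta; split; [by lra|by lra|exact: eta0|].
move=> m p B sigma Sigma H s0 covS HB W V rho W1 WV rho0 /=.
set A := positive_part B W (rho *: V).
have fA : H A \is a fin_num.
  by rewrite fin_num_measure//; exact: measurable_positive_part.
have [Tt|/ltW tT] := leP T (rho / sigma).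
  left; have := prob_shifted_far s0 covS HB V W1 rho0 k0 (ltW T0) Tt.
  rewrite -/A -[H A]fineK// lee_fin Tk PhiN.
  have k2 : 0 < k ^+ 2 by rewrite exprn_gt0.
  have : 8 * tr_qform Sigma (V - W) / k ^+ 2 <= ga / 8.
    rewrite ler_pdivrMr//.
    have : eta ^+ 2 <= (k * ga / 8) ^+ 2.
      by rewrite lerXn2r ?nnegrE ?(ltW eta0)// divr_ge0// mulr_ge0// ltW.
    have -> : (k * ga / 8) ^+ 2 = k ^+ 2 * ga ^+ 2 / 64 by field.
    have : k ^+ 2 * ga ^+ 2 <= k ^+ 2 * ga.
      by rewrite ler_wpM2l ?(ltW k2)//; nra.
    move: WV; lra.
  have ke : 12 * k = ga / 8 by rewrite /k; field.
  rewrite ke; move: xg; rewrite /ga; lra.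
right; have := prob_shifted_near s0 covS HB W1 rho0 tT eta0 eta2 WV.
by rewrite -/A -[H A]fineK// lee_fin mulrAC.
Qed.

Lemma gap_from_depths (eps h D : R) : 0 <= eps -> eps < 3^-1 -> 0 <= D ->
  (1 - eps) / 2 - D <= (1 - eps) * h + eps + D ->
  2^-1 - h <= eps / (1 - eps) + 3 * D.
Proof.
move=> e0 e3 D0 H; have e1 : 0 < 1 - eps by lra.
have E : (1 - eps) * (eps / (1 - eps) + 3 * D) = eps + (1 - eps) * (3 * D).
  by field; rewrite gt_eqF.
rewrite -(ler_pM2l e1) E.
have : 0 <= D * (3 * (1 - eps) - 2) by rewrite mulr_ge0//; lra.
lra.
Qed.

Lemma lt_of_sqr (a b : R) : 0 <= b -> a ^+ 2 < b ^+ 2 -> a < b.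
Proof. by move=> b0 ab; rewrite ltNge; apply/negP => ba; nra. Qed.

(** Here [D] is the uniform deviation and [h] the model probability of the exposing
    region.  In the linear regime the squares of both [eps / (1 - eps)] and [3 D] are below
    [(c t / 2)^2]: the former since [eps / (1 - eps) < 1/2] makes its square at most
    [9 b / 2], the latter since [D^2 <= L dn]. *)
Lemma distance_contradiction (eps e0 b D dn c t C L gamma h : R) :
  0 <= eps -> eps <= e0 -> e0 < 3^-1 -> 0 <= D -> 0 < gamma -> 0 < c -> 0 <= t ->
  0 <= L -> 0 <= dn ->
  eps / (1 - eps) <= 9 * b -> D ^+ 2 <= L * dn -> D < gamma / 3 ->
  18 + 36 * L <= C * c ^+ 2 -> C * Num.max dn b < t ^+ 2 ->
  (1 - eps) / 2 - D <= (1 - eps) * h + eps + D ->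
  h <= 2^-1 - e0 / (1 - e0) - gamma \/ h <= 2^-1 - c * t -> False.
Proof.
move=> p0 pe e3 D0 g0 c0 t0 L0 dn0 eb DL Dg CC Ct /gap_from_depths H.
have {}H : 2^-1 - h <= eps / (1 - eps) + 3 * D by apply: H => //; lra.
have ee : eps / (1 - eps) <= e0 / (1 - e0).
  rewrite ler_pdivrMr; last by lra.
  by rewrite mulrAC ler_pdivlMr; [nra|lra].
have eh : eps / (1 - eps) < 2^-1 by rewrite ltr_pdivrMr; lra.
have ep : 0 <= eps / (1 - eps) by rewrite divr_ge0//; lra.
case=> hh; first by lra.
set e := eps / (1 - eps) in H ee eb eh ep.
have b0 : 0 <= b by lra.
have M0 : 0 <= Num.max dn b by rewrite le_max dn0.
have c2 : 0 < c ^+ 2 by rewrite exprn_gt0.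
have key : (18 + 36 * L) * Num.max dn b < (c * t) ^+ 2.
  apply: (@le_lt_trans _ _ (C * c ^+ 2 * Num.max dn b)); first by rewrite ler_wpM2r.
  by rewrite exprMn mulrC mulrA [_ * C]mulrC mulrC ltr_pM2l.
have mb : b <= Num.max dn b by rewrite le_max lexx orbT.
have md : dn <= Num.max dn b by rewrite le_max lexx.
have ct0 : 0 <= c * t / 2 by rewrite divr_ge0// mulr_ge0// ltW.
have LM : L * dn <= L * Num.max dn b by rewrite ler_wpM2l.
have LM0 : 0 <= L * Num.max dn b by rewrite mulr_ge0.
have hsq : (c * t / 2) ^+ 2 = (c * t) ^+ 2 / 4 by field.
have h1 : e < c * t / 2.
  apply: lt_of_sqr => //; rewrite hsq.
  have : e ^+ 2 <= e / 2 by nra.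
  lra.
have h2 : 3 * D < c * t / 2.
  apply: lt_of_sqr => //; rewrite hsq exprMn.
  have : (18 + 36 * L) * Num.max dn b = 18 * Num.max dn b + 36 * (L * Num.max dn b) by ring.
  lra.
lra.
Qed.

Lemma measurable_loss d (Omega : measurableType d) p m (Sigma : 'M[R]_p) (B : 'M[R]_(p, m))
    (X : Omega -> 'M[R]_(p, m)) (c : R) : is_covariance Sigma ->
  measurable_fun setT X ->
  measurable [set w | (\tr ((X w - B)^T *m Sigma *m (X w - B)) <= c)%R].
Proof.
move=> /psd_factor[A SA] mX.
have mf : measurable_fun setT (fun w => tr_qform Sigma (X w - B)).
  rewrite SA; under eq_fun do rewrite tr_qform_factor.
  apply: measurable_sum => ij; apply: measurable_funX.
  apply: measurable_mulmx_entry => l.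
  rewrite (_ : (fun _ => _) = (fun w => X w l ij.2 - B l ij.2)).
    apply: measurable_funB => //.
    exact: (measurableT_comp (measurable_entry l ij.2) mX).
  by apply/funext => w; rewrite !mxE.
rewrite -[X in measurable X]setTI.
have := mf measurableT _ (measurable_itv `]-oo, c]%R).
by congr measurable; apply/seteqP; split => w [_] /=; rewrite in_itv.
Qed.

End assembly.

(** * The error bound *)

Section final.
Local Open Scope ring_scope.
Local Open Scope classical_set_scope.
Context (R : realType).

Lemma tr_qformZ m p (Sigma : 'M[R]_p) (a : R) (V : 'M[R]_(p, m)) :
  tr_qform Sigma (a *: V) = a ^+ 2 * tr_qform Sigma V.
Proof.
rewrite /tr_qform [(a *: V)^T]linearZ /= -!scalemxAl -scalemxAr !mxtraceZ.
by rewrite mulrA expr2.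
Qed.

Lemma depth_inequality m p n (B Bhat W : 'M[R]_(p, m)) (sigma eps r : R) (Sigma : 'M[R]_p)
    (H P : probability ('cV[R]_m * 'cV[R]_p)%type R)
    d (Omega : measurableType d) (Pr : probability Omega R)
    (Z : 'I_n -> {RV Pr >-> ('cV[R]_m * 'cV[R]_p)%type}) (w : Omega) :
  (0 < n)%N -> 0 < sigma -> regression_law B sigma Sigma H ->
  0 <= eps -> eps <= 1 -> in_contamination eps H P -> W != 0 ->
  deepest (empirical R (fun i => Z i w)) Bhat ->
  (forall U : 'M[R]_(p, m),
    `|count Z (positive_part B U 0) w - n%:R * fine (P (positive_part B U 0))| <= r) ->
  (forall Q : 'M[R]_(p, m),
    `|count Z (positive_part B W Q) w - n%:R * fine (P (positive_part B W Q))| <= r) ->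
  (1 - eps) / 2 - r / n%:R <=
    (1 - eps) * fine (H (positive_part B W (Bhat - B))) + eps + r / n%:R.
Proof.
move=> n0 s0 HB e0 e1 PH W0 dB dU dQ; have np : 0 < n%:R :> R by rewrite ltr0n.
have le1 : 0 <= 1 - eps by lra.
have lo U : (1 - eps) / 2 - r / n%:R <= count Z (positive_part B U 0) w / n%:R.
  have mU := measurable_positive_part B U 0.
  have /andP[h1 _] := contamination_bounds e0 PH mU.
  have h2 : 2^-1 <= fine (H (positive_part B U 0)).
    by rewrite -lee_fin fineK ?fin_num_measure//; exact: prob_center s0 HB U.
  have := dU U; rewrite ler_distl => /andP[h3 _].
  rewrite lerBlDr -mulrDl ler_pdivlMr//.
  have h4 : (1 - eps) * 2^-1 <= fine (P (positive_part B U 0)).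
    by apply: le_trans h1; rewrite ler_wpM2l.
  have : n%:R * ((1 - eps) * 2^-1) <= n%:R * fine (P (positive_part B U 0)).
    by rewrite ler_wpM2l.
  by rewrite [_ * n%:R]mulrC; lra.
apply: (le_trans (depth_comparison W0 dB lo)).
have mW := measurable_positive_part B W (Bhat - B).
have /andP[_ h1] := contamination_bounds e0 PH mW.
have := dQ (Bhat - B); rewrite ler_distl => /andP[_ h3].
rewrite -lerBlDr -mulrBl ler_pdivrMr//; apply: le_trans (_ : n%:R * _ <= _).
  by rewrite lerBlDr; exact: h3.
by rewrite mulrC ler_wpM2r// ltW.
Qed.

Lemma radius_sqr : exists2 k : R, 0 < k & forall m p n (x : R), (0 < n)%N -> 0 <= x ->
  (radius m p n x / n%:R) ^+ 2 = k * (x + 21 * (p * m)%:R) / n%:R.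
Proof.
exists (4 ^+ 2 * 288) => [|m p n x n0 x0]; first by rewrite pmulr_rgt0 ?ltr0n// exprn_gt0.
have np : n%:R != 0 :> R by rewrite gt_eqF// ltr0n.
rewrite /radius expr_div_n exprMn sqr_sqrtr; last first.
  apply: mulr_ge0; first by rewrite -natrM ler0n.
  by apply: addr_ge0 => //; rewrite -natrM ler0n.
move: (4 : R) (288 : R) (x + _) => a b y.
by field.
Qed.

(** The first bound gives the rate, with [l] the logarithm of [1 / delta].  The second one,
    uniform in [l], gives the smallness of the deviation.  The constant is kept abstract
    because only its existence matters. *)
Lemma radius_bounds : exists2 k : R, 0 < k & forall m p n (l L c0 : R),
  (0 < n)%N -> (0 < p)%N -> (0 < m)%N -> 0 <= l -> 0 <= L ->
  (p%:R + l) / n%:R <= c0 ->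
  let x := ln 4 + l + L * (p * m)%:R in
  (radius m p n x / n%:R) ^+ 2 <= k * (l + (L + 23)) * ((p * m)%:R / n%:R) /\
  (radius m p n x / n%:R) ^+ 2 <= k * (L + 23) * m.+1%:R * c0.
Proof.
have [k k0 kE] := radius_sqr; exists k => // m p n l L c0 n0 p0 m0 l0 L0 hc x.
have np : 0 < n%:R :> R by rewrite ltr0n.
have p1 : 1 <= p%:R :> R by rewrite ler1n.
have m1 : 1 <= m%:R :> R by rewrite ler1n.
have ln40 : 0 <= ln 4 :> R by apply: ln_ge0; lra.
have ln42 : ln 4 <= 2 :> R.
  have -> : 4%:R = 2 ^+ 2 :> R by ring.
  rewrite lnXn// -[ln _ *+ _]mulr_natr.
  by have := @le_ln1Dx R 1 _; lra.
have d1 : 1 <= (p * m)%:R :> R by rewrite natrM; nra.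
have d0 : 0 <= (p * m)%:R :> R by rewrite ler0n.
have Ld : 0 <= L * (p * m)%:R by rewrite mulr_ge0.
have x0 : 0 <= x by rewrite /x; lra.
have ni : 0 <= n%:R^-1 :> R by rewrite invr_ge0 ltW.
have L23 : 0 <= L + 23 by lra.
rewrite kE//; split.
  rewrite mulrA; apply: ler_wpM2r => //.
  rewrite -[leRHS]mulrA; apply: ler_wpM2l; first exact: ltW.
  have : 0 <= l * ((p * m)%:R - 1) by rewrite mulr_ge0// subr_ge0.
  rewrite /x; lra.
have kL : 0 <= k * (L + 23) * m.+1%:R by rewrite !mulr_ge0// ltW.
apply: (@le_trans _ _ (k * (L + 23) * m.+1%:R * ((p%:R + l) / n%:R))); last first.
  exact: ler_wpM2l.
rewrite mulrA; apply: ler_wpM2r => //.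
rewrite -2![leRHS]mulrA; apply: ler_wpM2l; first exact: ltW.
have h1 : 0 <= l * (L * m%:R) by rewrite !mulr_ge0.
have h2 : 0 <= l * m%:R by rewrite mulr_ge0.
have h3 : 0 <= L * l by rewrite mulr_ge0.
have h4 : 0 <= L * p%:R by rewrite mulr_ge0.
have h5 : 1 <= p%:R * m%:R :> R by nra.
by rewrite /x natrM -[m.+1%:R]natr1; lra.
Qed.

End final.

Unset Implicit Arguments.
Set Strict Implicit.
Set Printing Implicit Defensive.

Local Open Scope classical_set_scope.
Local Open Scope ring_scope.

Theorem lemma9 (R : realType) (eps' : R) (heps' : eps' < 3^-1) :
  exists c0 : nat -> R, (forall m : nat, 0 < c0 m) /\
  forall delta : R, 0 < delta -> delta < 2^-1 ->
  exists C : R, 0 < C /\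
  forall (m p n : nat), (0 < m)%N -> (0 < p)%N -> (0 < n)%N ->
  (p%:R + ln (delta^-1)) / n%:R <= c0 m ->
  forall (eps : R), 0 <= eps -> eps <= eps' ->
  forall (sigma : R) (Sigma : 'M[R]_p), 0 < sigma -> is_covariance Sigma ->
  forall (B : 'M[R]_(p, m)) (H P : probability ('cV[R]_m * 'cV[R]_p)%type R),
  regression_law B sigma Sigma H ->
  in_contamination eps H P ->
  forall (d : measure_display) (Omega : measurableType d)
    (Pr : probability Omega R)
    (Z : 'I_n -> {RV Pr >-> ('cV[R]_m * 'cV[R]_p)%type})
    (Bhat : {RV Pr >-> 'M[R]_(p, m)}),
  random_sample P Z ->
  (forall w : Omega, deepest (empirical R (fun i => Z i w)) (Bhat w)) ->
  ((1 - 2 * delta)%:E <=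
   Pr [set w | (\tr ((Bhat w - B)^T *m Sigma *m (Bhat w - B)) <=
       C * sigma ^+ 2 * Num.max ((p * m)%:R / n%:R) (bMR2 eps)
       + ln (delta^-1) / n%:R)%R])%E.
Proof.
pose e0 := Num.max eps' 0.
have e00 : 0 <= e0 by rewrite le_max lexx orbT.
have e03 : e0 < 3^-1 by rewrite /e0 gt_max heps' /= invr_gt0 ltr0n.
have [gamma [c [eta [g0 c0 eta0 gap]]]] := depth_gap e00 e03.
have [k0 k0p bounds] := @radius_bounds R.
pose L : R := (2 + net_const eta)%:R.
have L0 : 0 <= L by rewrite /L.
have L23 : 0 < L + 23 by rewrite ltr_wpDl.
exists (fun m => gamma ^+ 2 / (18 * (k0 * (L + 23) * m.+1%:R))); split.
  by move=> m; rewrite divr_gt0 ?exprn_gt0// !mulr_gt0.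
move=> delta d0 d2; pose l := ln (delta^-1).
have l0 : 0 <= l by apply: ln_ge0; rewrite invf_ge1//; lra.
pose K := k0 * (l + (L + 23)).
have K0 : 0 <= K by rewrite mulr_ge0 ?(ltW k0p)// addr_ge0// ltW.
exists ((18 + 36 * K) / c ^+ 2); split.
  by rewrite divr_gt0 ?exprn_gt0//; lra.
move=> m p n m0 p0 n0 small eps eps0 epse sigma Sigma s0 covS B H P HB PH.
move=> d Omega Pr Z Bhat ZP deep.
have np : 0 < n%:R :> R by rewrite ltr0n.
have epse0 : eps <= e0 by rewrite le_max epse.
pose x := ln 4 + l + L * (p * m)%:R.
have ln40 : 0 <= ln 4 :> R by apply: ln_ge0; rewrite ler1n.
have x0 : 0 <= x by rewrite /x !addr_ge0// mulr_ge0.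
have [D1 D2] := bounds m p n l L _ n0 p0 m0 l0 L0 small.
rewrite -/x in D1 D2; set D := radius m p n x / n%:R in D1 D2.
have D0 : 0 <= D by rewrite divr_ge0 ?(ltW np)// mulr_ge0 ?sqrtr_ge0.
have Dg : D < gamma / 3.
  apply: lt_of_sqr; first by rewrite divr_ge0 ?(ltW g0).
  apply: (le_lt_trans D2).
  have M0 : k0 * (L + 23) * m.+1%:R != 0 by rewrite gt_eqF// !mulr_gt0.
  have -> : k0 * (L + 23) * m.+1%:R * (gamma ^+ 2 / (18 * (k0 * (L + 23) * m.+1%:R)))
      = gamma ^+ 2 / 18 by move: M0; move: (_ * m.+1%:R) => M M0; field.
  by have := exprn_gt0 2 g0; rewrite expr_div_n; lra.
have [C [W [cardC coverW]]] := covariance_net m eta0 covS.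
have [E1 [mE1 PE1 good1]] := center_deviation B ZP n0 p0 m0 x0.
have [E2 [mE2 PE2 good2]] := net_deviation B ZP n0 p0 m0 W x0.
have expx : 4 * expR (- x) = delta * expR (- (L * (p * m)%:R)).
  have lnd : ln delta = - l by rewrite /l lnV ?posrE// opprK.
  rewrite (_ : - x = - ln 4 + ln delta - L * (p * m)%:R); last by rewrite lnd /x; ring.
  have h4 : expR (- ln 4) = 4^-1 :> R by rewrite expRN lnK// posrE ltr0n.
  by rewrite !expRD h4 lnK ?posrE// !mulrA divff ?mul1r// pnatr_eq0.
have PE : (Pr (E1 `|` E2) <= (2 * delta)%:E)%E.
  apply: (le_trans (measureU2 _ mE1 mE2)).
  apply: (le_trans (leeD PE1 PE2)); rewrite -EFinD lee_fin expx.
  have h1 : expR (- (L * (p * m)%:R)) <= 1.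
    by rewrite -[leRHS]expR0 ler_expR oppr_le0 mulr_ge0.
  have h2 : C%:R * expR (- (L * (p * m)%:R)) <= 1.
    by rewrite expRN ler_pdivrMr ?expR_gt0// mul1r.
  have h3 : delta * expR (- (L * (p * m)%:R)) <= delta by rewrite ler_piMr// ltW.
  have h4 : delta * (C%:R * expR (- (L * (p * m)%:R))) <= delta by rewrite ler_piMr// ltW.
  by rewrite [C%:R * _]mulrCA; lra.
have mE : measurable (E1 `|` E2) by exact: measurableU.
apply: (@le_trans _ _ (Pr (~` (E1 `|` E2)))).
  by rewrite probability_setC// EFinB leeB.
apply: le_measure; rewrite ?inE.
- exact: measurableC.
- by apply: measurable_loss => //; exact: measurable_funPT.
move=> w nE /=; rewrite leNgt; apply/negP => far.
pose Q := Bhat w - B; pose rho2 := tr_qform Sigma Q.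
have b0 : 0 <= bMR2 eps /\ eps / (1 - eps) <= 9 * bMR2 eps by apply: bMR2_ge; lra.
have M0 : 0 <= Num.max ((p * m)%:R / n%:R) (bMR2 eps) by rewrite le_max b0.1 orbT.
have C0 : 0 <= (18 + 36 * K) / c ^+ 2 by rewrite divr_ge0 ?sqr_ge0//; lra.
have ln0 : 0 <= l / n%:R by rewrite divr_ge0// ltW.
have far2 : (18 + 36 * K) / c ^+ 2 * sigma ^+ 2 *
    Num.max ((p * m)%:R / n%:R) (bMR2 eps) < rho2.
  by apply: le_lt_trans far; rewrite lerDl.
have rho2p : 0 < rho2.
  apply: le_lt_trans far2; apply: mulr_ge0 => //.
  by apply: mulr_ge0 => //; exact: sqr_ge0.
pose rho := Num.sqrt rho2; have rho0 : 0 < rho by rewrite sqrtr_gt0.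
have rhoE : rho ^+ 2 = rho2 by rewrite sqr_sqrtr// ltW.
pose V := rho^-1 *: Q.
have QV : Q = rho *: V by rewrite /V scalerA divff ?scale1r// gt_eqF.
have V1 : tr_qform Sigma V = 1.
  by rewrite /V tr_qformZ -/rho2 -rhoE exprVn mulVf// sqrf_eq0 gt_eqF.
have [k [W1 VW]] := coverW V V1.
have W0 : W k != 0.
  apply: contra_eq_neq W1 => ->.
  by rewrite /tr_qform mulmx0 mxtrace0 eq_sym oner_eq0.
have := depth_inequality n0 s0 HB eps0 _ PH W0 (deep w)
  (good1 w (fun h => nE (or_introl h))) (good2 w (fun h => nE (or_intror h)) k).
rewrite -/D -/Q QV => ineq.
apply: (@distance_contradiction R eps e0 (bMR2 eps) D ((p * m)%:R / n%:R) c (rho / sigma)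
  ((18 + 36 * K) / c ^+ 2) K gamma) => //.
- by rewrite divr_ge0 ?(ltW rho0) ?(ltW s0).
- exact: b0.2.
- by rewrite divfK// sqrf_eq0 gt_eqF.
- have s2 : 0 < sigma ^+ 2 by rewrite exprn_gt0.
  by rewrite expr_div_n rhoE ltr_pdivlMr// mulrAC.
- by apply: ineq; lra.
- exact: (gap m p B sigma Sigma H s0 covS HB (W k) V rho W1 VW rho0).
Qed.
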